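(* Let $\mathcal{N}$ be a (possibly infinite) near hexagon with exactly three points on each line, and let $\mathcal{H}$ be a full proper subgeometry of $\mathcal{N}$ which is isomorphic to $H^D(2)$ and isometrically embedded in $\mathcal{N}$. Then $\mathcal{N}$ is a generalized hexagon and hence isomorphic to $T(2,8)$.
   Context: A near hexagon is a partial linear space whose collinearity graph is connected of diameter $3$ such that for every point $x$ and line $L$ there is a unique point on $L$ nearest to $x$. A generalized hexagon is a near hexagon in which every point is on at least two lines and any two points at distance $2$ have a unique common neighbour. A subgeometry is full if every point of $\mathcal{N}$ incident with a line of the subgeometry belongs to the subgeometry; it is isometrically embedded if its distances agree with those of $\mathcal{N}$; proper means distinct from $\mathcal{N}$. $H^D(2)$ is the point-line dual of the split Cayley hexagon $H(2)$ of order $2$; $T(2,8)$ is the dual twisted triality hexagon of order $(2,8)$. *)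

(* Defs.v *)
From HB Require Import structures.
From mathcomp Require Import all_boot all_order all_algebra all_field.

Set Implicit Arguments.
Unset Strict Implicit.
Unset Printing Implicit Defensive.

Import GRing.Theory.

(** * Point-line geometries *)

Record geometry : Type := Geometry {
  point : Type;
  line : Type;
  inc : point -> line -> Prop }.

Definition dual_geometry (G : geometry) : geometry :=
  Geometry (fun (l : line G) (p : point G) => inc p l).

Definition isomorphic (G H : geometry) : Prop :=
  exists (f : point G -> point H) (g : line G -> line H),
    [/\ bijective f, bijective g &
        forall p l, inc p l <-> inc (f p) (g l)].

Definition collinear (G : geometry) (x y : point G) : Prop :=
  x <> y /\ exists l, inc x l /\ inc y l.

Fixpoint walk (G : geometry) (n : nat) (x y : point G) : Prop :=
  if n is m.+1 then exists2 z, collinear x z & walk m z y else x = y.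

(* The distance in the collinearity graph, as a relation since that graph may
   be infinite or disconnected: [distance x y n] means d(x, y) = n. *)
Definition distance (G : geometry) (x y : point G) (n : nat) : Prop :=
  walk n x y /\ forall m, walk m x y -> n <= m.

Definition connected_geometry (G : geometry) : Prop :=
  forall x y : point G, exists n, walk n x y.

Definition has_diameter (G : geometry) (d : nat) : Prop :=
  (forall (x y : point G) n, distance x y n -> n <= d) /\
  (exists x y : point G, distance x y d).

Definition partial_linear_space (G : geometry) : Prop :=
  (forall l : line G, exists x y, [/\ x <> y, inc x l & inc y l]) /\
  (forall (x y : point G) (l m : line G), x <> y ->
     inc x l -> inc y l -> inc x m -> inc y m -> l = m).

Definition nearest (G : geometry) (x : point G) (l : line G) (p : point G) :
    Prop :=
  inc p l /\
  forall q m n, inc q l -> distance x p m -> distance x q n -> m <= n.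

Definition near_hexagon (G : geometry) : Prop :=
  [/\ partial_linear_space G,
      connected_geometry G,
      has_diameter G 3 &
      forall (x : point G) (l : line G), exists! p, nearest x l p].

Definition generalized_hexagon (G : geometry) : Prop :=
  [/\ near_hexagon G,
      forall x : point G, exists l m, [/\ l <> m, inc x l & inc x m] &
      forall x y : point G, distance x y 2 ->
        exists! z, collinear x z /\ collinear z y].

Definition three_points_per_line (G : geometry) : Prop :=
  forall l : line G, exists x y z,
    [/\ x <> y, x <> z, y <> z &
        forall p, inc p l <-> [\/ p = x, p = y | p = z]].

(** * Subgeometries *)

Record subgeometry (N : geometry) : Type := Subgeometry {
  sub_point : point N -> Prop;
  sub_line : line N -> Prop }.

Definition geometry_of (N : geometry) (H : subgeometry N) : geometry :=
  Geometry (fun (p : {p : point N | sub_point H p})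
                (l : {l : line N | sub_line H l}) =>
              inc (proj1_sig p) (proj1_sig l)).

Definition full_subgeometry (N : geometry) (H : subgeometry N) : Prop :=
  forall (p : point N) (l : line N), sub_line H l -> inc p l -> sub_point H p.

Definition proper_subgeometry (N : geometry) (H : subgeometry N) : Prop :=
  ~ ((forall p, sub_point H p) /\ (forall l, sub_line H l)).

Definition isometrically_embedded (N : geometry) (H : subgeometry N) : Prop :=
  forall (x y : point (geometry_of H)) (n : nat),
    distance x y n <-> distance (proj1_sig x) (proj1_sig y) n.

(** * The hexagons of the trialities of the hyperbolic quadric in PG(7, K) *)

Section Triality.

Local Open Scope ring_scope.

Variables (K : finFieldType) (sigma : K -> K).

Definition entry (x : 'rV[K]_8) (i : nat) : K := x 0 (inord i).

(* The 3 x 3 determinant of the coordinates k, k+1, k+2 of x, y, z. *)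
Definition det3 (k : nat) (x y z : 'rV[K]_8) : K :=
  \det (\matrix_(i < 3, j < 3) entry (nth 0 [:: x; y; z] i) (k + j)).

(* x_0 y_4 + x_1 y_5 + x_2 y_6 *)
Definition pairing (x y : 'rV[K]_8) : K :=
  \sum_(i < 3) entry x i * entry y (4 + i).

(* Tits' trilinear form on K^8.  For points <x>, <y>, <z> of the quadric
   X_0 X_4 + X_1 X_5 + X_2 X_6 + X_3 X_7 = 0, regarded as elements of the three
   types of the D_4-geometry permuted by triality, <x> and <y> are incident iff
   the form vanishes on (x, y, w) for all w, and cyclically. *)
Definition trilinear (x y z : 'rV[K]_8) : K :=
  det3 0 x y z + det3 4 x y z
  + entry x 3 * pairing z y + entry x 7 * pairing y z
  + entry y 3 * pairing x z + entry y 7 * pairing z x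
  + entry z 3 * pairing y x + entry z 7 * pairing x y
  - entry x 3 * entry y 3 * entry z 3
  - entry x 7 * entry y 7 * entry z 7.

(* The triality of sigma (an automorphism of K with sigma^3 = 1) sends an
   element with coordinates x to the one of the next type with coordinates
   sigma(x).  A 1-dimensional U is absolute iff it is a point of the quadric
   incident with its image; a 2-dimensional U is absolute iff it is a line of
   the quadric fixed by the triality, i.e., iff every point of U is incident
   with the images of all the points of U. *)
Definition absolute (U : {vspace 'rV[K]_8}) : bool :=
  [forall u : 'rV[K]_8, forall v : 'rV[K]_8, forall w : 'rV[K]_8,
     (u \in U) ==> (v \in U) ==> (trilinear u (map_mx sigma v) w == 0)].

(* Tits' hexagon T(K, K^sigma, sigma) of absolute points and fixed lines. *)
Definition triality_hexagon : geometry :=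
  Geometry (fun (P : {U : {vspace 'rV[K]_8} | (\dim U == 1)%N && absolute U})
                (L : {U : {vspace 'rV[K]_8} | (\dim U == 2)%N && absolute U}) =>
              (val P <= val L)%VS : Prop).

End Triality.

Definition GF8 : finFieldType := s2val (@pPrimePowerField 2 3 isT isT).

(* The split Cayley hexagon H(2), of order (2, 2): the points are those of the
   quadric Q(6, 2) in the hyperplane X_3 + X_7 = 0. *)
Definition split_Cayley_hexagon_2 : geometry :=
  @triality_hexagon 'F_2 (fun a => a).

Definition HD2 : geometry := dual_geometry split_Cayley_hexagon_2.

(* The dual of the twisted triality hexagon T(8, 2), of order (8, 2). *)
Definition T28 : geometry :=
  dual_geometry (@triality_hexagon GF8 (fun a => a ^+ 2)%R).

(* Main.v *)
Require Import Defs.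
From HB Require Import structures.
From Stdlib Require Import ClassicalEpsilon NArith PArith FMapPositive.
From mathcomp Require Import all_boot all_order all_algebra all_field.
From mathcomp Require Import ring zify.
Set Implicit Arguments. Unset Strict Implicit. Unset Printing Implicit Defensive.
Import GRing.Theory.
Module PM := PositiveMap.

(* A point x of N outside H determines the valuation p |-> d(x, p) of H, and a
   search shows that only 252 functions on the 63 points of H can occur.  Each of
   them takes the value 1 at exactly one point, and two collinear points outside H
   have valuations that are adjacent in an explicit graph: the points outside H
   form a cover of this graph, in which every edge lifts uniquely.  A line of
   valuations with exactly three lifts shows that the cover is 3-fold, and
   counting the lifts of short walks excludes quadrangles, whence N is a
   generalized hexagon.

   Label the fibres by Z/3, by lifting a spanning tree.  The absence of
   quadrangles makes the holonomy of a closed walk of length 4 a 3-cycle, which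
   fixes the orientation; from then on, three walks with common ends but pairwise
   different lifts leave only one possibility for the lift of a further edge.  All
   edges are deduced in this way, so that the lines of N are those of one explicit
   table.  The lines of T(8, 2) that are not defined over the field of order 2 are
   orbits of length 3 of the Frobenius automorphism, and the table describes the
   dual of T(8, 2) as well, by a computation with Tits' trilinear form over the
   field of order 8. *)

(** * Triple systems modelling a geometry *)

(** The obstacle is that N comes without coordinates and is possibly infinite: a priori a valuation
    could be induced by no point of N or by infinitely many. Hence all counting is done in the
    finite graph of valuations, and facts about N are obtained by lifting walks. The number 252
    comes from T(2, 8). A point of it is on nine lines, three of which belong to the subhexagon when
    the point does; this leaves twelve outer neighbours, or four Frobenius orbits of length 3, and
    63 times 4 is 252. The neighbour in H of an outer point is its foot; the line joining them has
    one more point, whose valuation is the mate of the first one. The orientation must be fixed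
    before any deduction: replacing every label by its negative preserves the tree edges and all the
    excluded configurations, so that these alone cannot distinguish a shift from its opposite. No
    uniqueness theorem for T(2, 8) is invoked: N and T(2, 8) are both shown to realise the same
    table of triples. The tables are computed from bases of the lines of T(8, 2), but nothing is
    inferred from their origin; each property in use is verified by evaluating a boolean. *)

Definition on (I : Type) (i : I) (t : I * I * I) : Prop :=
  [\/ i = t.1.1, i = t.1.2 | i = t.2].

Definition extensional_lines (G : geometry) : Prop :=
  forall l m : line G, (forall x, inc x l <-> inc x m) -> l = m.

(** [rep] is a relation so that a labelling of N and the recognition of an absolute subspace by a
    basis both fit without choosing inverse maps. Its first four fields make it a bijection between
    [dom] and the points. *)
Record models (I : Type) (dom : I -> Prop) (block : I * I * I -> Prop)
    (G : geometry) (rep : I -> point G -> Prop) : Prop := Models {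
  rep_ex : forall i, dom i -> exists x, rep i x;
  rep_onto : forall x, exists2 i, dom i & rep i x;
  rep_inj : forall i j x, dom i -> dom j -> rep i x -> rep j x -> i = j;
  rep_fun : forall i x y, dom i -> rep i x -> rep i y -> x = y;
  block_line : forall t, block t ->
    exists l, forall i x, dom i -> rep i x -> (inc x l <-> on i t);
  line_block : forall l : line G, exists2 t, block t &
    forall i x, dom i -> rep i x -> (inc x l <-> on i t) }.

Section Transfer.
Variables (I : Type) (dom : I -> Prop) (block : I * I * I -> Prop).

Lemma models_maps (G H : geometry) (r : I -> point G -> Prop)
    (s : I -> point H -> Prop) :
  models dom block r -> models dom block s ->
  exists (f : point G -> point H) (g : line G -> line H),
    (forall x, exists i, [/\ dom i, r i x & s i (f x)]) /\
    (forall l, exists2 t, block t & forall i, dom i ->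
       (forall x, r i x -> (inc x l <-> on i t)) /\
       (forall y, s i y -> (inc y (g l) <-> on i t))).
Proof.
move=> mG mH.
have hf x : exists y, exists i, [/\ dom i, r i x & s i y].
  have [i di ri] := rep_onto mG x; have [y si] := rep_ex mH di.
  by exists y, i.
have hg l : exists m : line H, exists2 t, block t & forall i, dom i ->
       (forall x, r i x -> (inc x l <-> on i t)) /\
       (forall y, s i y -> (inc y m <-> on i t)).
  have [t bt lt] := line_block mG l; have [m mt] := block_line mH bt.
  by exists m, t => // i di; split=> x; [exact: lt | exact: mt].
exists (fun x => proj1_sig (constructive_indefinite_description _ (hf x))).
exists (fun l => proj1_sig (constructive_indefinite_description _ (hg l))).
split=> [x | l].
  exact: (proj2_sig (constructive_indefinite_description _ (hf x))).
exact: (proj2_sig (constructive_indefinite_description _ (hg l))).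
Qed.

(** The maps on lines come from choosing a line for each block, so a priori they are only compatible
    with incidence. They are mutually inverse because a line is determined by its points. *)
Lemma models_isomorphic (G H : geometry) (r : I -> point G -> Prop)
    (s : I -> point H -> Prop) :
  extensional_lines G -> extensional_lines H ->
  models dom block r -> models dom block s -> isomorphic G H.
Proof.
move=> eG eH mG mH.
have [f [g [fP gP]]] := models_maps mG mH.
have [f' [g' [fP' gP']]] := models_maps mH mG.
have can_f x : f' (f x) = x.
  have [i [di ri si]] := fP x; have [j [dj sj rj]] := fP' (f x).
  by rewrite (rep_inj mH di dj si sj) in ri; exact: (rep_fun mG dj rj ri).
have can_f' y : f (f' y) = y.
  have [i [di si ri]] := fP' y; have [j [dj rj sj]] := fP (f' y).
  by rewrite (rep_inj mG di dj ri rj) in si; exact: (rep_fun mH dj sj si).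
have gi x l : inc x l <-> inc (f x) (g l).
  have [i [di ri si]] := fP x; have [t _ /(_ i di) [h1 h2]] := gP l.
  by rewrite (h1 _ ri) (h2 _ si).
have gi' y m : inc y m <-> inc (f' y) (g' m).
  have [i [di si ri]] := fP' y; have [t _ /(_ i di) [h1 h2]] := gP' m.
  by rewrite (h1 _ si) (h2 _ ri).
exists f, g; split => //; first by exists f'.
exists g' => [l | m].
  apply: eG => x; have := gi' (f x) (g l); rewrite can_f => h.
  exact: iff_trans (iff_sym h) (iff_sym (gi x l)).
apply: eH => y; have := gi (f' y) (g' m); rewrite can_f' => h.
exact: iff_trans (iff_sym h) (iff_sym (gi' y m)).
Qed.
End Transfer.

(** * Triality hexagons over a coded field of characteristic 2 *)

(** A constructor with eight arguments rather than a row matrix, so that the large checks evaluate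
    quickly. *)
Inductive vec (T : Type) := Vec of T & T & T & T & T & T & T & T.

Section Code.
Variables (T : Type) (z : T) (add mul : T -> T -> T) (sq : T -> T).
Variable eqb : T -> T -> bool.
Local Notation "x + y" := (add x y).
Local Notation "x * y" := (mul x y).

Definition vadd (x y : vec T) : vec T :=
  let: Vec x0 x1 x2 x3 x4 x5 x6 x7 := x in
  let: Vec y0 y1 y2 y3 y4 y5 y6 y7 := y in
  Vec (x0 + y0) (x1 + y1) (x2 + y2) (x3 + y3)
      (x4 + y4) (x5 + y5) (x6 + y6) (x7 + y7).

Definition vmap (U : Type) (f : T -> U) (x : vec T) : vec U :=
  let: Vec x0 x1 x2 x3 x4 x5 x6 x7 := x in
  Vec (f x0) (f x1) (f x2) (f x3) (f x4) (f x5) (f x6) (f x7).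

Definition vscale a := vmap (mul a).

Definition null (x : vec T) : bool :=
  let: Vec x0 x1 x2 x3 x4 x5 x6 x7 := x in
  [&& eqb x0 z, eqb x1 z, eqb x2 z, eqb x3 z,
      eqb x4 z, eqb x5 z, eqb x6 z & eqb x7 z].

(* The coefficients of Tits' form, as a linear form in its third argument, in
   characteristic 2. *)
Definition prod (x y : vec T) : vec T :=
  let: Vec x0 x1 x2 x3 x4 x5 x6 x7 := x in
  let: Vec y0 y1 y2 y3 y4 y5 y6 y7 := y in
  Vec (x1 * y2 + x2 * y1 + x3 * y4 + x4 * y7)
      (x0 * y2 + x2 * y0 + x3 * y5 + x5 * y7)
      (x0 * y1 + x1 * y0 + x3 * y6 + x6 * y7)
      (x4 * y0 + x5 * y1 + x6 * y2 + x3 * y3)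
      (x5 * y6 + x6 * y5 + x7 * y0 + x0 * y3)
      (x4 * y6 + x6 * y4 + x7 * y1 + x1 * y3)
      (x4 * y5 + x5 * y4 + x7 * y2 + x2 * y3)
      (x0 * y4 + x1 * y5 + x2 * y6 + x7 * y7).

Definition incident x y := null (prod x (vmap sq y)).

Definition absolute_pair (u : vec T * vec T) :=
  [&& incident u.1 u.1, incident u.1 u.2, incident u.2 u.1 & incident u.2 u.2].

(* A symmetry of order 6 of Tits' form that is transitive on the coordinates
   other than X_3 and X_7. *)
Definition turn (x : vec T) : vec T :=
  let: Vec x0 x1 x2 x3 x4 x5 x6 x7 := x in Vec x5 x6 x4 x7 x1 x2 x0 x3.

Definition comb (a b : T) (u : vec T * vec T) :=
  vadd (vscale a u.1) (vscale b u.2).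
End Code.

Section CodedField.
Local Open Scope ring_scope.
Variables (T : Type) (z : T) (add mul : T -> T -> T) (sq : T -> T).
Variable eqb : T -> T -> bool.
Variables (K : finFieldType) (sigma : K -> K) (e : T -> K).
Hypothesis eqbP : forall a b, reflect (a = b) (eqb a b).
Hypothesis e_inj : injective e.
Hypothesis e_surj : forall a, exists t, a = e t.
Hypothesis e_z : e z = 0.
Hypothesis e_add : {morph e : a b / add a b >-> a + b}.
Hypothesis e_mul : {morph e : a b / mul a b >-> a * b}.
Hypothesis e_sq : {morph e : a / sq a >-> sigma a}.
(** This covers both hexagons: squaring is the identity on the field of order 2 and an automorphism
    of order 3 on the field of order 8. *)
Hypothesis sigmaE : forall a, sigma a = a ^+ 2.
Hypothesis char2 : 1 + 1 = 0 :> K.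

Local Notation vecT := (vec T).
Local Notation vadd := (vadd add).
Local Notation vscale := (vscale mul).
Local Notation null := (null z eqb).
Local Notation prod := (prod add mul).
Local Notation incident := (incident z add mul sq eqb).
Local Notation absolute_pair := (absolute_pair z add mul sq eqb).
Local Notation comb := (comb add mul).

Definition coords (x : vec T) : seq T :=
  let: Vec x0 x1 x2 x3 x4 x5 x6 x7 := x in [:: x0; x1; x2; x3; x4; x5; x6; x7].

Definition row_vec (x : vecT) : 'rV[K]_8 := \row_i e (nth z (coords x) i).

Lemma entry_row_vec x i : (i < 8)%N -> entry (row_vec x) i = e (nth z (coords x) i).
Proof. by move=> i8; rewrite /entry mxE inordK. Qed.

Lemma row_vec_surj (v : 'rV[K]_8) : exists x, v = row_vec x.
Proof.
have [f fE] : exists f : 'I_8 -> T, forall i, v 0 i = e (f i).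
  exact: (fin_all_exists (fun i => e_surj (v 0 i))).
exists (Vec (f (inord 0)) (f (inord 1)) (f (inord 2)) (f (inord 3))
            (f (inord 4)) (f (inord 5)) (f (inord 6)) (f (inord 7))).
apply/rowP => i; rewrite mxE fE; congr e.
case: i => [] [|[|[|[|[|[|[|[|//]]]]]]]] i8 /=; congr f; apply: val_inj;
  by rewrite /= inordK.
Qed.

Lemma row_vec_add x y : row_vec (vadd x y) = row_vec x + row_vec y.
Proof.
apply/rowP => i; rewrite !mxE -e_add; congr e.
by case: x y => ? ? ? ? ? ? ? ? [? ? ? ? ? ? ? ?]; case: i => [] [|[|[|[|[|[|[|[|//]]]]]]]].
Qed.

Lemma row_vec_scale a x : row_vec (vscale a x) = e a *: row_vec x.
Proof.
apply/rowP => i; rewrite !mxE -e_mul; congr e.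
by case: x => ? ? ? ? ? ? ? ?; case: i => [] [|[|[|[|[|[|[|[|//]]]]]]]].
Qed.

Lemma row_vec_frob x : map_mx sigma (row_vec x) = row_vec (vmap sq x).
Proof.
apply/rowP => i; rewrite !mxE -e_sq; congr e.
by case: x => ? ? ? ? ? ? ? ?; case: i => [] [|[|[|[|[|[|[|[|//]]]]]]]].
Qed.

Lemma row_vec_inj : injective row_vec.
Proof.
move=> [x0 x1 x2 x3 x4 x5 x6 x7] [y0 y1 y2 y3 y4 y5 y6 y7] E.
have h i : (i < 8)%N -> nth z [:: x0; x1; x2; x3; x4; x5; x6; x7] i =
    nth z [:: y0; y1; y2; y3; y4; y5; y6; y7] i.
  by move=> i8; apply: e_inj; move/rowP/(_ (Ordinal i8)): E; rewrite !mxE.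
by congr Vec; [exact: (h 0%N) | exact: (h 1%N) | exact: (h 2) | exact: (h 3)
  | exact: (h 4) | exact: (h 5) | exact: (h 6) | exact: (h 7)].
Qed.

Lemma null_row_vec x : null x = (row_vec x == 0).
Proof.
have -> : null x = all (fun a => eqb a z) (coords x).
  by case: x => * /=; rewrite andbT.
have sz : size (coords x) = 8 by case: x.
apply/(all_nthP z)/eqP => [h | E i].
  apply/rowP => i; rewrite !mxE -e_z; congr e.
  by apply/eqbP/h; rewrite sz.
rewrite sz => i8; apply/eqbP/e_inj.
by move/rowP/(_ (Ordinal i8)): E; rewrite !mxE e_z.
Qed.

(** * Tits' form in coordinates, and absolute points and lines *)

Lemma opp2 (a : K) : - a = a.
Proof. by apply/esym/eqP; rewrite -addr_eq0 -(mulr1 a) -mulrDr char2 mulr0. Qed.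

Lemma trilinear_row_vec x y w :
  trilinear (row_vec x) (row_vec y) w = \sum_i row_vec (prod x y) 0 i * w 0 i.
Proof.
have -> : \sum_i row_vec (prod x y) 0 i * w 0 i =
    \sum_(i < 8) e (nth z (coords (prod x y)) i) * entry w i.
  by apply: eq_bigr => i _; rewrite mxE /entry inord_val.
rewrite /trilinear /det3 /pairing.
rewrite !(expand_det_row _ ord0) !big_ord_recl !big_ord0 /cofactor.
rewrite !(expand_det_row _ ord0) !big_ord_recl !big_ord0 /cofactor.
rewrite !(expand_det_row _ ord0) !big_ord_recl !big_ord0 /cofactor !det_mx00.
rewrite !mxE /= /bump /= !opp2 !expr1n.
case: x => x0 x1 x2 x3 x4 x5 x6 x7; case: y => y0 y1 y2 y3 y4 y5 y6 y7.
rewrite !entry_row_vec //= !e_add !e_mul; ring.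
Qed.

(** The coefficient vector of the linear form that sends w to T(x, sigma(y), w). It is linear in x
    and semilinear in y, and incidence is its vanishing. *)
Definition tits (x y : vecT) : 'rV[K]_8 := row_vec (prod x (vmap sq y)).

Lemma incidentE x y : incident x y = (tits x y == 0).
Proof. exact: null_row_vec. Qed.

Lemma incidentP x y :
  reflect (forall w, trilinear (row_vec x) (map_mx sigma (row_vec y)) w = 0)
          (incident x y).
Proof.
rewrite incidentE; apply: (iffP eqP) => [E w | E].
  rewrite row_vec_frob trilinear_row_vec -/(tits x y) E.
  by apply: big1 => i _; rewrite mxE mul0r.
apply/rowP => i; have := E (delta_mx 0 i).
rewrite row_vec_frob trilinear_row_vec (bigD1 i) //= big1 => [|j ji].
  by rewrite !mxE !eqxx mulr1 addr0.
by rewrite !mxE (negPf ji) andbF mulr0.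
Qed.

Lemma e_sq_add a b : e (sq (add a b)) = e (sq a) + e (sq b).
Proof.
by rewrite !e_sq !sigmaE e_add sqrrD mulr2n -{2}[_ * _]opp2 subrr addr0.
Qed.

Lemma e_sq_mul a b : e (sq (mul a b)) = e (sq a) * e (sq b).
Proof. by rewrite !e_sq !sigmaE e_mul exprMn. Qed.

Lemma tits_addl x x' y : tits (vadd x x') y = tits x y + tits x' y.
Proof.
rewrite /tits -row_vec_add; congr row_vec.
case: x => ? ? ? ? ? ? ? ?; case: x' => ? ? ? ? ? ? ? ?; case: y => ? ? ? ? ? ? ? ?.
by congr Vec; apply: e_inj; rewrite !(e_add, e_mul); ring.
Qed.

Lemma tits_addr x y y' : tits x (vadd y y') = tits x y + tits x y'.
Proof.
rewrite /tits -row_vec_add; congr row_vec.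
case: x => ? ? ? ? ? ? ? ?; case: y => ? ? ? ? ? ? ? ?; case: y' => ? ? ? ? ? ? ? ?.
by congr Vec; apply: e_inj; rewrite !(e_sq_add, e_add, e_mul); ring.
Qed.

Lemma tits_scalel a x y : tits (vscale a x) y = e a *: tits x y.
Proof.
rewrite /tits -row_vec_scale; congr row_vec.
case: x => ? ? ? ? ? ? ? ?; case: y => ? ? ? ? ? ? ? ?.
by congr Vec; apply: e_inj; rewrite !(e_add, e_mul); ring.
Qed.

Lemma tits_scaler a x y : tits x (vscale a y) = e (sq a) *: tits x y.
Proof.
rewrite /tits -row_vec_scale; congr row_vec.
case: x => ? ? ? ? ? ? ? ?; case: y => ? ? ? ? ? ? ? ?.
by congr Vec; apply: e_inj; rewrite !(e_sq_mul, e_add, e_mul); ring.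
Qed.

Lemma row_vec_comb a b u :
  row_vec (comb a b u) = e a *: row_vec u.1 + e b *: row_vec u.2.
Proof. by rewrite row_vec_add !row_vec_scale. Qed.

Definition span (u : vecT * vecT) : {vspace 'rV[K]_8} :=
  (<[row_vec u.1]> + <[row_vec u.2]>)%VS.

Lemma mem_spanP u v :
  reflect (exists a b, v = row_vec (comb a b u)) (v \in span u).
Proof.
apply: (iffP memv_addP) => [[_ /vlineP[a ->]] [_ /vlineP[b ->]] -> |].
  have [[a' ->] [b' ->]] := (e_surj a, e_surj b).
  by exists a', b'; rewrite row_vec_comb.
move=> [a [b ->]]; exists (e a *: row_vec u.1).
  by rewrite memvZ ?memv_line.
by exists (e b *: row_vec u.2); rewrite ?memvZ ?memv_line ?row_vec_comb.
Qed.

Lemma absoluteP (U : {vspace 'rV[K]_8}) :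
  reflect (forall x y, row_vec x \in U -> row_vec y \in U -> incident x y)
          (absolute sigma U).
Proof.
apply: (iffP idP) => [abs x y xU yU | abs].
  apply/incidentP => w.
  by move/forallP/(_ (row_vec x))/forallP/(_ (row_vec y))/forallP/(_ w): abs; rewrite xU yU => /eqP.
apply/forallP => u; apply/forallP => v; apply/forallP => w.
have [[x ->] [y ->]] := (row_vec_surj u, row_vec_surj v).
by apply/implyP => xU; apply/implyP => yU; apply/eqP/incidentP/abs.
Qed.

Lemma absolute_line x : absolute sigma <[row_vec x]>%VS = incident x x.
Proof.
apply/absoluteP/idP => [-> // | xx y y' /vlineP[a ya] /vlineP[b yb]].
  exact: memv_line.
  exact: memv_line.
have [[a' aE] [b' bE]] := (e_surj a, e_surj b).
have -> : y = vscale a' x by apply: row_vec_inj; rewrite ya row_vec_scale aE.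
have -> : y' = vscale b' x by apply: row_vec_inj; rewrite yb row_vec_scale bE.
move: xx; rewrite !incidentE tits_scalel tits_scaler => /eqP ->.
by rewrite !scaler0.
Qed.

(** By the semilinearity of [tits], the four incidences between the two spanning vectors propagate
    to all pairs of vectors in the span. *)
Lemma absolute_span u : absolute sigma (span u) = absolute_pair u.
Proof.
apply/absoluteP/idP => [abs | /and4P[h11 h12 h21 h22] x y].
  have m1 : row_vec u.1 \in span u by rewrite -[row_vec _]addr0 memv_add ?mem0v ?memv_line.
  have m2 : row_vec u.2 \in span u by rewrite -[row_vec _]add0r memv_add ?mem0v ?memv_line.
  by apply/and4P; split; apply: abs.
move=> /mem_spanP[a [b /row_vec_inj ->]] /mem_spanP[c [d /row_vec_inj ->]].
move: h11 h12 h21 h22; rewrite !incidentE => /eqP h11 /eqP h12 /eqP h21 /eqP h22.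
rewrite !(tits_addl, tits_addr, tits_scalel, tits_scaler) h11 h12 h21 h22.
by rewrite !(scaler0, addr0) eqxx.
Qed.

Lemma null_turn x : null (turn x) = null x.
Proof.
by case: x => ? ? ? ? ? ? ? ? /=; do 8!case: (eqb _ z).
Qed.

Lemma incident_turn x y : incident (turn x) (turn y) = incident x y.
Proof.
rewrite -[RHS]null_turn; congr null.
case: x => ? ? ? ? ? ? ? ?; case: y => ? ? ? ? ? ? ? ?.
by congr Vec; apply: e_inj; rewrite !(e_add, e_mul); ring.
Qed.

Definition independent (u : vecT * vecT) : Prop :=
  forall a b, null (comb a b u) -> a = z /\ b = z.

Lemma e_eq0 a : e a = 0 -> a = z.
Proof. by rewrite -e_z => /e_inj. Qed.

Lemma comb_null_pair u a b : null (comb a b u) = (e a *: row_vec u.1 + e b *: row_vec u.2 == 0).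
Proof. by rewrite null_row_vec row_vec_comb. Qed.

Lemma dim_span u : independent u -> \dim (span u) = 2%N.
Proof.
move=> ind; rewrite dimv_disjoint_sum.
  have d1 v : v != 0 -> \dim <[v : 'rV[K]_8]> = 1%N by move=> v0; rewrite dim_vline v0.
  have [o oE] := e_surj 1.
  have o0 : o <> z by move=> oz; move: (oner_neq0 K); rewrite oE oz e_z eqxx.
  rewrite !d1 //; apply/negP => /eqP u0.
    have /ind[_ /o0//] : null (comb z o u).
    by rewrite comb_null_pair u0 e_z scaler0 scale0r add0r.
  have /ind[/o0//] : null (comb o z u).
  by rewrite comb_null_pair u0 e_z scaler0 scale0r add0r.
apply/eqP; rewrite -subv0; apply/subvP => v; rewrite memv_cap => /andP[].
move=> /vlineP[a ->] /vlineP[b E].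
have [[a' aE] [b' bE]] := (e_surj a, e_surj b).
have /ind[az _] : null (comb a' b' u).
  by rewrite comb_null_pair -aE -bE E -scalerDl -{2}[b]opp2 subrr scale0r.
by rewrite aE az e_z scale0r mem0v.
Qed.

Lemma dim2_span (U : {vspace 'rV[K]_8}) : \dim U = 2%N ->
  exists2 u, independent u & U = span u.
Proof.
move=> dU; have /andP[/eqP spU frU] := vbasisP U.
move: (vbasis U) spU frU; rewrite dU => -[[|v0 [|v1 []]] //= _].
rewrite span_cons span_seq1 => <- fr.
have [[x xE] [y yE]] := (row_vec_surj v0, row_vec_surj v1).
exists (x, y); last by rewrite /span /= -xE -yE.
move=> a b; rewrite comb_null_pair /= -xE -yE => /eqP E.
have /freeP/(_ (fun i => if val i == 0%N then e a else e b)) := fr.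
rewrite !big_ord_recl big_ord0 /= addr0 E => /(_ erefl) h.
by split; apply: e_eq0; [have := h ord0 | have := h (lift ord0 ord0)].
Qed.

Definition in_span (u : vecT * vecT) (x : vecT) : Prop :=
  exists a b, x = comb a b u.

Lemma in_spanP u x : in_span u x <-> row_vec x \in span u.
Proof.
split=> [[a [b ->]] | /mem_spanP[a [b /row_vec_inj ->]]]; last by exists a, b.
by apply/mem_spanP; exists a, b.
Qed.

Lemma absolute_pair_comb u a b c d :
  absolute_pair u -> incident (comb a b u) (comb c d u).
Proof.
by rewrite -absolute_span => /absoluteP; apply; apply/in_spanP; [exists a, b | exists c, d].
Qed.

(** * From a table of absolute points and lines to a model of the dual hexagon *)

Section Model.
Variables (I : Type) (dom : I -> Prop) (basis : I -> vecT * vecT).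
(** Indices number the absolute lines, which are the points of the dual; [block s t] says that the
    absolute point spanned by s is on exactly the three lines in t. The scalars in the hypotheses
    allow s to be a normalised representative. *)
Variable block : vecT -> I * I * I -> Prop.
Hypothesis basis_abs : forall i, dom i -> absolute_pair (basis i).
Hypothesis basis_ind : forall i, dom i -> independent (basis i).
Hypothesis basis_inj : forall i j, dom i -> dom j ->
  in_span (basis j) (basis i).1 -> in_span (basis j) (basis i).2 -> i = j.
Hypothesis block_mem : forall s t, block s t ->
  [/\ ~~ null s, dom t.1.1, dom t.1.2, dom t.2 & t.1.1 <> t.1.2 /\
      forall i, on i t -> in_span (basis i) s].
Hypothesis block_on : forall i x, dom i -> in_span (basis i) x -> ~~ null x ->
  exists c t, block (vscale c x) t /\ on i t.
Hypothesis block_fun : forall c s t t',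
  block s t -> block (vscale c s) t' -> t = t'.
Hypothesis points_listed : forall x, ~~ null x -> incident x x ->
  exists c t, block (vscale c x) t.
Hypothesis lines_listed : forall u, independent u -> absolute_pair u ->
  exists i, [/\ dom i, in_span (basis i) u.1 & in_span (basis i) u.2].

Let represents (i : I) (P : line (triality_hexagon sigma)) := val P = span (basis i).

Lemma span_sub u v : (span u <= span v)%VS <-> in_span v u.1 /\ in_span v u.2.
Proof.
rewrite !in_spanP subv_add -!memvE; split=> [/andP[] // | [-> ->] //].
Qed.

Lemma span_basis_inj i j : dom i -> dom j -> span (basis i) = span (basis j) -> i = j.
Proof.
move=> di dj E; have /span_sub[h1 h2] : (span (basis i) <= span (basis j))%VS by rewrite E.
exact: basis_inj.
Qed.

Lemma row_vec_line c x : ~~ null (vscale c x) ->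
  <[row_vec (vscale c x)]>%VS = <[row_vec x]>%VS.
Proof.
rewrite null_row_vec row_vec_scale scaler_eq0 negb_or => /andP[c0 _].
apply/vspaceP => v; apply/vlineP/vlineP => -[k ->].
  by exists (k * e c); rewrite scalerA.
by exists (k / e c); rewrite scalerA divfK.
Qed.

Lemma triality_line_span (P : line (triality_hexagon sigma)) :
  exists2 i, dom i & represents i P.
Proof.
case: P => U /= dU; have /andP[/eqP d2 aU] := dU.
have [u ind uE] := dim2_span d2.
rewrite uE absolute_span in aU; have [i [di h1 h2]] := lines_listed ind aU.
exists i => //; rewrite /represents /= uE; apply/eqP.
rewrite eqEdim !dim_span ?andbT //; last exact: basis_ind.
by apply/span_sub.
Qed.

Lemma triality_point_block (L : point (triality_hexagon sigma)) :
  exists s t, block s t /\ val L = <[row_vec s]>%VS.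
Proof.
case: L => U /= dU; have /andP[/eqP d1 aU] := dU.
have [v vE] : exists v, U = <[v]>%VS.
  have /andP[/eqP spU _] := vbasisP U.
  move: (vbasis U) spU; rewrite d1 => -[[|v []] //= _] <-.
  by exists v; rewrite span_seq1.
have [x xE] := row_vec_surj v; rewrite xE in vE.
have x0 : ~~ null x.
  rewrite null_row_vec; apply/eqP => x0.
  by move: d1; rewrite vE x0 dim_vline eqxx.
rewrite vE absolute_line in aU; have [c [t b]] := points_listed x0 aU.
by exists (vscale c x), t; split => //=; rewrite vE row_vec_line //; case: (block_mem b).
Qed.

Lemma block_incident s t i P (L : point (triality_hexagon sigma)) :
  block s t -> val L = <[row_vec s]>%VS -> dom i -> represents i P ->
  (@inc (triality_hexagon sigma) L P <-> on i t).
Proof.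
move=> b LE di PE; rewrite /inc /= LE PE -memvE; split=> [/in_spanP si | oi].
  have [s0 _ _ _ _] := block_mem b.
  have [c [t' [b' oi]]] := block_on di si s0.
  by rewrite (block_fun b b').
by have [_ _ _ _ [_ /(_ i oi)/in_spanP]] := block_mem b.
Qed.

Lemma dual_triality_models :
  models dom (fun t => exists s, block s t)
    (represents : I -> point (dual_geometry (triality_hexagon sigma)) -> Prop).
Proof.
split=> [i di | P | i j P di dj | i P Q di | t [s b] | L].
- have absU : (\dim (span (basis i)) == 2%N) && absolute sigma (span (basis i)).
    by rewrite dim_span ?absolute_span ?basis_abs //; apply: basis_ind.
  by exists (exist (fun U : {vspace 'rV_8} => (\dim U == 2%N) && absolute sigma U) _ absU).
- exact: triality_line_span.
- by rewrite /represents => -> /(span_basis_inj di dj).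
- by rewrite /represents => <- E; apply: val_inj.
- have [s0 d1 _ _ [_ son]] := block_mem b.
  have absL : (\dim <[row_vec s]> == 1)%N && absolute sigma <[row_vec s]>%VS.
    rewrite dim_vline -null_row_vec s0 absolute_line /=.
    have /in_spanP si : in_span (basis t.1.1) s by apply: son; constructor.
    by have := basis_abs d1; rewrite -absolute_span => /absoluteP; apply.
  exists (exist (fun U : {vspace 'rV_8} => (\dim U == 1%N) && absolute sigma U) _ absL) => i P di PE.
  exact: (block_incident b).
have [s [t [b LE]]] := triality_point_block L.
exists t => [|i P di PE]; first by exists s.
exact: (block_incident b).
Qed.

(** An absolute point is the intersection of any two distinct absolute lines through it. So two
    absolute points with the same lines both equal the intersection [W] of the first two lines of a
    block. *)
Lemma dual_triality_extensional :
  extensional_lines (dual_geometry (triality_hexagon sigma)).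
Proof.
move=> L M LM; apply: val_inj.
have [s [t [b LE]]] := triality_point_block L.
have [_ d1 d2 _ [d12 son]] := block_mem b.
have [s' [t' [b' ME]]] := triality_point_block M.
have [P1 P1E] := rep_ex dual_triality_models d1.
have [P2 P2E] := rep_ex dual_triality_models d2.
have L1 := (block_incident b LE d1 P1E).2 (Or31 _ _ erefl).
have L2 := (block_incident b LE d2 P2E).2 (Or32 _ _ erefl).
have M1 : (val M <= val P1)%VS by apply/(LM P1).
have M2 : (val M <= val P2)%VS by apply/(LM P2).
have dL : \dim (val L) = 1%N by case/andP: (valP L) => /eqP.
have dM : \dim (val M) = 1%N by case/andP: (valP M) => /eqP.
pose W := (val P1 :&: val P2)%VS.
have dW : (\dim W <= 1)%N.
  rewrite leqNgt; apply/negP => W2; apply: d12.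
  have dP1 : \dim (val P1) = 2%N by case/andP: (valP P1) => /eqP.
  have dP2 : \dim (val P2) = 2%N by case/andP: (valP P2) => /eqP.
  have W1 : W = val P1 by apply/eqP; rewrite eqEdim capvSl dP1.
  have W2' : W = val P2 by apply/eqP; rewrite eqEdim capvSr dP2.
  by apply: span_basis_inj => //; rewrite -P1E -P2E -W1 -W2'.
have LW : val L = W by apply/eqP; rewrite eqEdim subv_cap L1 L2 dL.
by rewrite LW; apply/esym/eqP; rewrite eqEdim subv_cap M1 M2 dM.
Qed.
Lemma dual_triality_coded : extensional_lines (dual_geometry (triality_hexagon sigma)) /\
  exists r : I -> point (dual_geometry (triality_hexagon sigma)) -> Prop,
    models dom (fun t => exists s, block s t) r.
Proof.
split; first exact: dual_triality_extensional.
by exists represents; exact: dual_triality_models.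
Qed.
End Model.
End CodedField.

(** * The field of order 8 *)

(** The binary digits of n are the coefficients of the polynomial that [A]n stands for, modulo X^3 +
    X + 1. *)
Inductive F8 := A0 | A1 | A2 | A3 | A4 | A5 | A6 | A7.

Definition add8 (a b : F8) : F8 := match a with
  | A0 => b
  | A1 => match b with | A0 => A1 | A1 => A0 | A2 => A3 | A3 => A2 | A4 => A5 | A5 => A4 | A6 => A7 | A7 => A6 end
  | A2 => match b with | A0 => A2 | A1 => A3 | A2 => A0 | A3 => A1 | A4 => A6 | A5 => A7 | A6 => A4 | A7 => A5 end
  | A3 => match b with | A0 => A3 | A1 => A2 | A2 => A1 | A3 => A0 | A4 => A7 | A5 => A6 | A6 => A5 | A7 => A4 end
  | A4 => match b with | A0 => A4 | A1 => A5 | A2 => A6 | A3 => A7 | A4 => A0 | A5 => A1 | A6 => A2 | A7 => A3 end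
  | A5 => match b with | A0 => A5 | A1 => A4 | A2 => A7 | A3 => A6 | A4 => A1 | A5 => A0 | A6 => A3 | A7 => A2 end
  | A6 => match b with | A0 => A6 | A1 => A7 | A2 => A4 | A3 => A5 | A4 => A2 | A5 => A3 | A6 => A0 | A7 => A1 end
  | A7 => match b with | A0 => A7 | A1 => A6 | A2 => A5 | A3 => A4 | A4 => A3 | A5 => A2 | A6 => A1 | A7 => A0 end
  end.

Definition mul8 (a b : F8) : F8 := match a with
  | A0 => A0
  | A1 => b
  | A2 => match b with | A0 => A0 | A1 => A2 | A2 => A4 | A3 => A6 | A4 => A3 | A5 => A1 | A6 => A7 | A7 => A5 end
  | A3 => match b with | A0 => A0 | A1 => A3 | A2 => A6 | A3 => A5 | A4 => A7 | A5 => A4 | A6 => A1 | A7 => A2 end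
  | A4 => match b with | A0 => A0 | A1 => A4 | A2 => A3 | A3 => A7 | A4 => A6 | A5 => A2 | A6 => A5 | A7 => A1 end
  | A5 => match b with | A0 => A0 | A1 => A5 | A2 => A1 | A3 => A4 | A4 => A2 | A5 => A7 | A6 => A3 | A7 => A6 end
  | A6 => match b with | A0 => A0 | A1 => A6 | A2 => A7 | A3 => A1 | A4 => A5 | A5 => A3 | A6 => A2 | A7 => A4 end
  | A7 => match b with | A0 => A0 | A1 => A7 | A2 => A5 | A3 => A2 | A4 => A1 | A5 => A6 | A6 => A4 | A7 => A3 end
  end.

Definition sq8 a := mul8 a a.
Definition eq8 (a b : F8) : bool := if add8 a b is A0 then true else false.
(** The inverse is a^6 = a^2 a^4; it sends zero to zero. *)
Definition inv8 (a : F8) : F8 := mul8 (sq8 a) (sq8 (sq8 a)).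
Definition elts8 := [:: A0; A1; A2; A3; A4; A5; A6; A7].

Lemma eq8P : Equality.axiom eq8.
Proof. by do 2!case; constructor. Qed.

HB.instance Definition _ := hasDecEq.Build F8 eq8P.

Lemma mem_elts8 a : a \in elts8.
Proof. by case: a. Qed.

Section GF8Code.
Local Open Scope ring_scope.

Lemma GF8_char2 : 1 + 1 = 0 :> GF8.
Proof.
rewrite /GF8; case: (pPrimePowerField _ _) => L /= + _.
by rewrite inE => /andP[_ /eqP]; rewrite (natrD _ 1 1).
Qed.

Lemma card_GF8 : #|GF8| = 8%N.
Proof. by rewrite /GF8; case: (pPrimePowerField _ _) => L /= _ ->. Qed.

Lemma add_self (x : GF8) : x + x = 0.
Proof. by rewrite -[x]mulr1 -mulrDr GF8_char2 mulr0. Qed.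

(** Modulo 2, X^8 - X is X (X - 1) (X^3 + X + 1) (X^3 + X^2 + 1). An element other than 0 and 1 is a
    root of one of the cubics, and inversion exchanges their roots. *)
Lemma GF8_generator : exists a : GF8, a ^+ 3 = a + 1.
Proof.
have [x /andP[x0 x1]] : exists x : GF8, (x != 0) && (x != 1).
  case: (boolP [exists x : GF8, (x != 0) && (x != 1)]) => [/existsP // | /existsPn h].
  have : (#|[set: GF8]| <= #|[set (0%R : GF8); 1%R]|)%N.
    apply/subset_leq_card/subsetP => y _; rewrite !inE.
    by have := h y; rewrite negb_and !negbK.
  by rewrite cardsT card_GF8 cards2; case: eqP.
have : x * (x - 1) * ((x ^+ 3 + x + 1) * (x ^+ 3 + x ^+ 2 + 1)) = 0.
  have x8 : x ^+ 8 = x by have := expf_card x; rewrite card_GF8.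
  have -> : x * (x - 1) * ((x ^+ 3 + x + 1) * (x ^+ 3 + x ^+ 2 + 1)) =
    x ^+ 8 - x + (x ^+ 5 - x ^+ 4) * (1 + 1) by ring.
  by rewrite x8 GF8_char2 mulr0 addr0 subrr.
move/eqP; rewrite !mulf_eq0 subr_eq0 (negPf x0) (negPf x1) /=.
have opp (y : GF8) : - y = y by apply/esym/eqP; rewrite -addr_eq0 add_self.
case/orP => /eqP E.
  by exists x; apply/eqP; rewrite -subr_eq0 -[- (x + 1)]opp opprK addrA E.
exists x^-1; apply: (mulfI (expf_neq0 3 x0)).
have -> : x ^+ 3 * (x^-1 + 1) = x ^+ 2 + x ^+ 3 by field.
rewrite -exprMn divff // expr1n -[RHS]opp; apply/eqP.
by rewrite -subr_eq0 opprK addrC [x ^+ 2 + _]addrC E.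
Qed.

Definition gen8 : GF8 := proj1_sig (constructive_indefinite_description _ GF8_generator).

Lemma gen8E : gen8 ^+ 3 = gen8 + 1.
Proof. exact: (proj2_sig (constructive_indefinite_description _ GF8_generator)). Qed.

Definition bits8 (a : F8) : bool * bool * bool :=
  match a with
  | A0 => (false, false, false) | A1 => (true, false, false)
  | A2 => (false, true, false) | A3 => (true, true, false)
  | A4 => (false, false, true) | A5 => (true, false, true)
  | A6 => (false, true, true) | A7 => (true, true, true)
  end.

Definition emb8 (a : F8) : GF8 :=
  let: (a0, a1, a2) := bits8 a in a0%:R + a1%:R * gen8 + a2%:R * gen8 ^+ 2.

Lemma natr_addb (a b : bool) : (a (+) b)%:R = a%:R + b%:R :> GF8.
Proof. by case: a b => -[] /=; rewrite ?GF8_char2 ?addr0 ?add0r. Qed.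

Lemma natr_andb (a b : bool) : (a && b)%:R = a%:R * b%:R :> GF8.
Proof. by case: a b => -[] /=; rewrite ?mulr1 ?mulr0. Qed.

Lemma emb8_add : {morph emb8 : a b / add8 a b >-> a + b}.
Proof.
move=> a b; rewrite /emb8.
have -> : bits8 (add8 a b) =
    let: (a0, a1, a2) := bits8 a in let: (b0, b1, b2) := bits8 b in
    (a0 (+) b0, a1 (+) b1, a2 (+) b2) by case: a b => -[].
case: (bits8 a) (bits8 b) => [[a0 a1] a2] [[b0 b1] b2].
by rewrite !natr_addb; ring.
Qed.

Lemma emb8_mul : {morph emb8 : a b / mul8 a b >-> a * b}.
Proof.
move=> a b; rewrite /emb8.
have -> : bits8 (mul8 a b) =
    let: (a0, a1, a2) := bits8 a in let: (b0, b1, b2) := bits8 b in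
    ((a0 && b0) (+) (a1 && b2) (+) (a2 && b1),
     (a0 && b1) (+) (a1 && b0) (+) (a1 && b2) (+) (a2 && b1) (+) (a2 && b2),
     (a0 && b2) (+) (a1 && b1) (+) (a2 && b0) (+) (a2 && b2)) by case: a b => -[].
case: (bits8 a) (bits8 b) => [[a0 a1] a2] [[b0 b1] b2].
rewrite !natr_addb !natr_andb; apply/esym/eqP; rewrite -subr_eq0; apply/eqP.
set c0 := a0%:R; set c1 := a1%:R; set c2 := a2%:R.
set d0 := b0%:R; set d1 := b1%:R; set d2 := b2%:R.
(* The cofactor is the part of degree at least 3 of the product of the two polynomials, divided by
   X^3. *)
transitivity ((gen8 ^+ 3 - (gen8 + 1)) * (c1 * d2 + c2 * d1 + c2 * d2 * gen8)).
  by ring.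
by rewrite gen8E subrr mul0r.
Qed.

Lemma emb8_eq0 a : emb8 a = 0 -> a = A0.
Proof.
move=> a0; case: (eqVneq a A0) => // an0.
have : emb8 (mul8 a (inv8 a)) = 0 by rewrite emb8_mul a0 mul0r.
by case: a an0 {a0} => //= _; rewrite /emb8 /= !mul0r !addr0 => /eqP; rewrite oner_eq0.
Qed.

Lemma emb8_inj : injective emb8.
Proof.
move=> a b ab; have : emb8 (add8 a b) = 0 by rewrite emb8_add ab add_self.
by move/emb8_eq0; case: a b {ab} => -[].
Qed.

Lemma emb8_surj (x : GF8) : exists a, x = emb8 a.
Proof.
pose s := [seq emb8 a | a <- elts8].
have us : uniq s by rewrite map_inj_uniq //; exact: emb8_inj.
have cs : #|s| = #|GF8| by rewrite (card_uniqP us) size_map card_GF8.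
have /(subset_cardP cs)/(_ x) : s \subset GF8 by apply/subsetP.
by rewrite [in RHS]inE => /mapP[a _ ->]; exists a.
Qed.

Lemma emb8_sq : {morph emb8 : a / sq8 a >-> a ^+ 2}.
Proof. by move=> a; rewrite emb8_mul. Qed.

Lemma emb8_0 : emb8 A0 = 0.
Proof. by rewrite /emb8 /= !mul0r !addr0. Qed.
End GF8Code.

(** * The points and lines of the dual of T(8, 2) *)

HB.instance Definition _ := hasDecEq.Build positive (fun b c => equivP idP (Pos.eqb_eq b c)).

Inductive Z3 := Z0 | Z1 | Z2.

Definition add3 (i j : Z3) : Z3 :=
  match i, j with
  | Z0, k | k, Z0 => k
  | Z1, Z1 => Z2
  | Z2, Z2 => Z1
  | Z1, Z2 | Z2, Z1 => Z0
  end.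
Definition opp3 (i : Z3) : Z3 := match i with Z0 => Z0 | Z1 => Z2 | Z2 => Z1 end.
Definition eq3 (i j : Z3) : bool := if add3 i (opp3 j) is Z0 then true else false.
Definition elts3 := [:: Z0; Z1; Z2].

Lemma eq3P : Equality.axiom eq3.
Proof. by do 2!case; constructor. Qed.

HB.instance Definition _ := hasDecEq.Build Z3 eq3P.

Lemma mem_elts3 i : i \in elts3.
Proof. by case: i. Qed.

(* [Rat p], p < 63, is a point of the subhexagon H and [Irr b i] a point outside
   it, where b <= 252 determines the distances to the points of H; the three
   points that share b are permuted by the Frobenius automorphism. *)
Inductive index := Rat of nat | Irr of positive & Z3.

Definition eqi (x y : index) : bool :=
  match x, y with
  | Rat p, Rat q => eqn p q
  | Irr b i, Irr c j => Pos.eqb b c && eq3 i j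
  | _, _ => false
  end.

Lemma eqiP : Equality.axiom eqi.
Proof.
case=> [p|b i] [q|c j]; try by constructor.
  by apply: (iffP eqnP) => [-> | [->]].
apply: (iffP andP) => [[/Pos.eqb_eq -> /eq3P -> //] | [-> ->]].
by split; [exact/Pos.eqb_eq | exact/eq3P].
Qed.

HB.instance Definition _ := hasDecEq.Build index eqiP.

Fixpoint digits (B : N) (k : nat) (n : N) : seq N :=
  if k is k'.+1 then rcons (digits B k' (N.div n B)) (N.modulo n B) else [::].

Definition vec8_of_digits (l : seq N) : vec F8 :=
  let a i := nth A0 elts8 (N.to_nat (nth 0%num l i)) in
  Vec (a 0) (a 1) (a 2) (a 3) (a 4) (a 5) (a 6) (a 7).

Definition basis_of (B n : N) : vec F8 * vec F8 :=
  let l := digits B 16 n in (vec8_of_digits (take 8 l), vec8_of_digits (drop 8 l)).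

(* Bases, over the field of order 2, of the 63 lines of H(2).  The order is such
   that a search along the list for the valuations of [HD2] is fast. *)
Definition rational_bases : seq (vec F8 * vec F8) := Eval vm_compute in
  map (basis_of 2) [::
  0x2cd9; 0x5faa; 0x7386; 0x375f; 0x5f9d; 0x7586; 0x680; 0x480; 0x280; 0x240;
  0x2c0; 0x5d9f; 0x4299; 0x429b; 0x6eb7; 0x669f; 0x3b9f; 0x3384; 0x3784;
  0x37db; 0x5db7; 0x75ae; 0x285d; 0x660; 0x6e0; 0x6699; 0x2499; 0x4a0; 0x420;
  0x249d; 0x3f9b; 0x7b9d; 0x7d9b; 0x33cc; 0x3348; 0x55aa; 0x7bae; 0xaa0;
  0xea0; 0xce0; 0xae0; 0x3bd7; 0x57bd; 0x73bd; 0xa40; 0x3b48; 0x840; 0x5782;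
  0x2cd5; 0x3f57; 0x3fcc; 0x4ab3; 0x4ab9; 0x5582; 0x6eb9; 0x7db3; 0x860;
  0xc20; 0xcc0; 0xe60; 0xec0; 0x2855; 0x820]%num.

(* Bases of representatives of the other 756 lines of T(8, 2) up to Frobenius,
   in octal digits. *)
Definition irrational_bases : seq (vec F8 * vec F8) := Eval vm_compute in
  map (basis_of 8) [::
  0x25168106e40c; 0x25168106664c; 0x279dc106de4b; 0x2594c107740d;
  0x30cb2c074d46; 0x38efbe073814; 0x2cb4d307fe83; 0x34d965075a1a;
  0x32406c06f9b2; 0x29205a06a8c4; 0x3ff077065b87; 0x2db05306b9fe;
  0x5a292227443; 0x7e3b6223df1; 0x532db22969f; 0x6536d214a46; 0x3c6dbe056bc2;
  0x34492c067832; 0x305b65075c1a; 0x387ff706d787; 0x32414c0557fc;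
  0x3b61ce072e27; 0x3ff18f074edd; 0x2db08b05a435; 0x20016804c146;
  0x2000d804a01c; 0x20009004f083; 0x2001b004d037; 0x20018000d037;
  0x20010000b125; 0x2000c000a01c; 0x2001c000e1fa; 0x2000380461c2;
  0x20002804416e; 0x200020043105; 0x200020043125; 0x40028204a06;
  0x4001820261c; 0x40030205c07; 0x40010207413; 0x2400180426dc; 0x240028044b46;
  0x240020043925; 0x240020043905; 0x34490c05d63c; 0x34490c06ee95;
  0x305b4d064c97; 0x2836cb05e62f; 0x34122906c546; 0x3c1239051e96;
  0x30122105eed9; 0x381231075587; 0x3c1231075987; 0x34122105e8d9;
  0x38123907e7c2; 0x3012290717b4; 0x2d1691074a39; 0x3f1fb107d987;
  0x2994d9052ac4; 0x2994d9069622; 0x321369064f46; 0x2912d9069e22;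
  0x3f93b107d987; 0x2d9291074439; 0x237e7f0663c2; 0x21365b0694df;
  0x23ec76063fb1; 0x23ec76055387; 0x212052067283; 0x2360760633b1;
  0x22d06d07936b; 0x21b05b0722c4; 0x22416407b305; 0x22416405f221;
  0x23f1bf06e3c2; 0x23f1bf05123d; 0x2773bf051c3d; 0x26532d05c946;
  0x26c36407bb05; 0x27e3f606be31; 0x3cef8e07af27; 0x34cb0c05d83c;
  0x28b4cb0525b5; 0x30d94d06a43b; 0x2d328b05a835; 0x3f738f0748dd;
  0x3be3ce067cde; 0x3be3ce072627; 0x516412370cd; 0x61a4121b34f; 0x5944122e0cc;
  0x6984123234e; 0x48090207403; 0x481b0205db7; 0x481f8206e02; 0x481f8206ffa;
  0x2481f804efc2; 0x2480d804a61c; 0x2481b004dd87; 0x24812004b825;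
  0x29129105f883; 0x321321056e19; 0x3f93f9059e16; 0x3f93f90769c2;
  0x2393c1065c0b; 0x2393c106dc4b; 0x21128106644c; 0x21128106e40c;
  0x2080c000a6dc; 0x2080c000a61c; 0x20818000ddb7; 0x20810000b825;
  0x80c0202604; 0x8140204b46; 0x8080207403; 0x8180205d87; 0x21928106664c;
  0x23938105ce0a; 0x2313c106de4b; 0x221341053a0f; 0x237fbf06e3c2;
  0x21369b06141f; 0x22c96405fa21; 0x23edf605d387; 0x2da45a06aec4;
  0x2da45a05d526; 0x3b7e7705f56c; 0x293653077a83; 0x36c94c066e15;
  0x3fedce067ade; 0x29368b05676f; 0x3b7f8f07e423; 0x26d26d07996b;
  0x26d26d054946; 0x276276055f87; 0x276276063fb1; 0x64224233845;
  0x52212235451; 0x7f23f219e7d; 0x7f23f226e42; 0x30c30c06ee95; 0x38e38e06fc1e;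
  0x34d34d064c97; 0x2cb2cb05ec2f; 0x2d345306b7fe; 0x3f7c77065b87;
  0x29a65a06a8c4; 0x32ca6c06f5b2; 0x208820043105; 0x208410047493;
  0x208e380461c2; 0x208a28044b6e; 0x20892004b105; 0x208db004dc37;
  0x2086d804a0c4; 0x2086d804a61c; 0x2486c000a0dc; 0x248fc000ee3a;
  0x24848000f093; 0x24890000b825; 0x248c300451b7; 0x248c30045d87;
  0x248e380461fa; 0x2486180426c4; 0x27ee760633b1; 0x27ee76055f87;
  0x26586d054946; 0x277c7f0593fd; 0x38f3f706d787; 0x38f3f7057e2c;
  0x2ca29a062ec4; 0x34c32c067432; 0x29b253077a83; 0x3bf27705ff6c;
  0x3f627e07b894; 0x36426c07c746; 0x4082020b025; 0x40c3020dc07; 0x4061820a01c;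
  0x40e3820ee02; 0x7fc3f22ee42; 0x6d82d23106b; 0x64a2423b845; 0x5261223d051;
  0x4040000f013; 0x4040000f413; 0x4060000a01c; 0x40a0000ca2e; 0x28209a055426;
  0x30412c074d46; 0x3c71f705742c; 0x34516505b705; 0x271dc106dc4b;
  0x261941053a0f; 0x269b0107284e; 0x279f8105ce0a; 0x6cb2421f161;
  0x6cb2423b845; 0x534db23a644; 0x534db22109f; 0x25b49b07a4c4; 0x26d92d07122b;
  0x2526d206f683; 0x2526d207d211; 0x309829071bb4; 0x389c3907e7c2;
  0x2c9611057c83; 0x3c9e3106a769; 0x34982906c546; 0x3498290717b4;
  0x28961107c5f9; 0x289611057883; 0x38618e06fa1e; 0x28208a05c7b3;
  0x2c30cb0525b5; 0x2c30cb05e62f; 0x329b2106bd05; 0x3b9fb1062c29;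
  0x2d14d9052cc4; 0x361969079634; 0x32d90d0625fb; 0x3bfd8f07ec23;
  0x3f6fce067cde; 0x364b4c066a15; 0x48a0000cb6e; 0x4860000a0dc; 0x4840000f493;
  0x48c0000d1b7; 0x86c0242604; 0x8fc02461c2; 0x8d80245c07; 0x8900243105;
  0x240b4000c02e; 0x2406c000a6dc; 0x24048000f013; 0x240d8000ddb7;
  0x48ff820e1fa; 0x486d820a604; 0x48db020d1b7; 0x4892020b805; 0x240db004dd87;
  0x24049004f013; 0x240b6804cb46; 0x240b6804c02e; 0x5964123708d;
  0x5964123f28d; 0x71c4121438a; 0x5144122e08c; 0x8a00044146; 0x8e00046fc2;
  0x8800043105; 0x8c00045d87]%num.

Definition types : seq positive := Eval vm_compute in
  [seq Pos.of_succ_nat b | b <- iota 0 252].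

Definition indices : seq index := Eval vm_compute in
  [seq Rat p | p <- iota 0 63] ++ [seq Irr b i | b <- types, i <- elts3].

Definition irrational_map : PM.t (vec F8 * vec F8) := Eval vm_compute in
  foldr (fun x m => PM.add x.1 x.2 m) (PM.empty _) (zip types irrational_bases).

Definition frob3 (i : Z3) (x : vec F8) : vec F8 :=
  match i with Z0 => x | Z1 => vmap sq8 x | Z2 => vmap sq8 (vmap sq8 x) end.

Definition basis8 (x : index) : vec F8 * vec F8 :=
  let z := Vec A0 A0 A0 A0 A0 A0 A0 A0 in
  match x with
  | Rat p => nth (z, z) rational_bases p
  | Irr b i =>
    if PM.find b irrational_map is Some u then (frob3 i u.1, frob3 i u.2) else (z, z)
  end.

Definition null8 := null A0 eq8.
Definition comb8 := comb add8 mul8.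
Definition incident8 := incident A0 add8 mul8 sq8 eq8.
Definition scale8 := vscale mul8.

(** Coordinates 3 and 7 are skipped because an absolute point has another nonzero coordinate, by
    [absolute_head], and because [turn] permutes the remaining six. *)
Definition pivot (x : vec F8) : F8 :=
  let: Vec x0 x1 x2 x3 x4 x5 x6 x7 := x in
  if ~~ eq8 x0 A0 then x0 else if ~~ eq8 x1 A0 then x1 else
  if ~~ eq8 x2 A0 then x2 else if ~~ eq8 x4 A0 then x4 else
  if ~~ eq8 x5 A0 then x5 else x6.

Definition normalize (x : vec F8) : vec F8 := scale8 (inv8 (pivot x)) x.

Definition veq8 (x y : vec F8) : bool := null8 (vadd add8 x y).

Definition span_points (u : vec F8 * vec F8) : seq (vec F8) :=
  normalize u.2 :: [seq normalize (comb8 A1 c u) | c <- elts8].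

Definition digit_key (a : F8) (k : positive) : positive :=
  match a with
  | A0 => k~0~0~0 | A1 => k~1~0~0 | A2 => k~0~1~0 | A3 => k~1~1~0
  | A4 => k~0~0~1 | A5 => k~1~0~1 | A6 => k~0~1~1 | A7 => k~1~1~1
  end%positive.

Definition vec_key (x : vec F8) : positive :=
  let: Vec x0 x1 x2 x3 x4 x5 x6 x7 := x in
  digit_key x0 (digit_key x1 (digit_key x2 (digit_key x3
    (digit_key x4 (digit_key x5 (digit_key x6 (digit_key x7 xH))))))).

(** Each point collects the indices of the lines through it. As [foldr] treats the last index first,
    triples are in the order of [indices]. The fallback triple would be detected by [blocks_spans],
    which tests that the first two entries differ. *)
Definition block_map : PM.t (vec F8 * (index * index * index)) := Eval vm_compute in
  let insert x m s := let k := vec_key s in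
    PM.add k (s, x :: if PM.find k m is Some t then t.2 else [::]) m in
  PM.map (fun st => (st.1, if st.2 is [:: a; b; c] then (a, b, c) else (Rat 0, Rat 0, Rat 0)))
    (foldr (fun x m => foldl (insert x) m (span_points (basis8 x))) (PM.empty _) indices).

(** Comparing s with the stored vector makes the injectivity of [vec_key] irrelevant to
    correctness. *)
Definition lookup (s : vec F8) : option (index * index * index) :=
  if PM.find (vec_key s) block_map is Some t then
    if veq8 t.1 s then Some t.2 else None
  else None.

Definition blocks : seq (vec F8 * (index * index * index)) :=
  [seq kt.2 | kt <- PM.elements block_map].

Definition on_b (x : index) (t : index * index * index) : bool :=
  [|| eqi x t.1.1, eqi x t.1.2 | eqi x t.2].

Lemma all_In T (P : pred T) l x : all P l -> List.In x l -> P x.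
Proof. by elim: l => //= y l IH /andP[Py /IH IHl] [<- // | /IHl]. Qed.

Lemma add8C a b : add8 a b = add8 b a.
Proof. by case: a b => -[]. Qed.

Lemma add8A a b c : add8 a (add8 b c) = add8 (add8 a b) c.
Proof. by case: a b c => -[] -[]. Qed.

Lemma add8_0 a : add8 a A0 = a.
Proof. by case: a. Qed.

Lemma mul8_1 a : mul8 a A1 = a.
Proof. by case: a. Qed.

Lemma mul8_0 a : mul8 a A0 = A0.
Proof. by case: a. Qed.

Lemma mul8A a b c : mul8 a (mul8 b c) = mul8 (mul8 a b) c.
Proof. by case: a b c => -[] -[]. Qed.

Lemma mul8Dr a b c : mul8 a (add8 b c) = add8 (mul8 a b) (mul8 a c).
Proof. by case: a b c => -[] -[]. Qed.

Lemma add8_eq0 a b : add8 a b = A0 -> a = b.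
Proof. by case: a b => -[]. Qed.

Lemma add8_solve1 a b c : add8 (add8 a b) c = A0 -> b = add8 a c.
Proof. by case: a b c => -[] -[]. Qed.

Lemma mul8_inv a : a != A0 -> mul8 (inv8 a) a = A1.
Proof. by case: a. Qed.

Lemma eq8xx a : eq8 a a.
Proof. by case: a. Qed.

Lemma eq8_mul c a : c != A0 -> eq8 (mul8 c a) A0 = eq8 a A0.
Proof. by case: c a => -[]. Qed.

Lemma inv8_mul c a b : c != A0 -> mul8 (inv8 (mul8 c a)) (mul8 c b) = mul8 (inv8 a) b.
Proof. by case: c a b => -[] -[]. Qed.

Lemma pivot_scale c x : c != A0 -> pivot (scale8 c x) = mul8 c (pivot x).
Proof.
case: x => x0 x1 x2 x3 x4 x5 x6 x7 c0; rewrite /pivot /scale8 /vscale /vmap.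
by rewrite !(eq8_mul _ c0); do 5![case: ifP => // _].
Qed.

Lemma normalize_scale c x : c != A0 -> normalize (scale8 c x) = normalize x.
Proof.
move=> c0; rewrite /normalize pivot_scale //; case: x => x0 x1 x2 x3 x4 x5 x6 x7.
by rewrite /scale8 /vscale /vmap !(inv8_mul _ _ c0).
Qed.

Lemma normalizeE x : exists c, normalize x = scale8 c x.
Proof. by exists (inv8 (pivot x)). Qed.

Lemma veq8P x y : reflect (x = y) (veq8 x y).
Proof.
case: x => ? ? ? ? ? ? ? ?; case: y => ? ? ? ? ? ? ? ?; rewrite /veq8 /null8 /=.
have h a b : eq8 (add8 a b) A0 = eq8 a b by case: a b => -[].
rewrite !h; apply: (iffP idP) => [/and5P[/eq8P-> /eq8P-> /eq8P-> /eq8P->] | [-> -> -> -> -> -> -> ->]].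
  by move=> /and4P[/eq8P-> /eq8P-> /eq8P-> /eq8P->].
by rewrite !eq8xx.
Qed.

Definition in_types (x : index) : bool :=
  match x with
  | Rat p => p < 63
  | Irr b _ => if PM.find b irrational_map is Some _ then true else false
  end.

Lemma in_types_indices x : in_types x -> x \in indices.
Proof.
case: x => [p | b i] /=.
  move=> p63; have : all (fun p => Rat p \in indices) (iota 0 63) by vm_compute.
  by move/allP; apply; rewrite mem_iota.
case E: (PM.find b irrational_map) => [u|//] _.
have h : all (fun bu => all (fun i => Irr bu.1 i \in indices) elts3)
    (PM.elements irrational_map) by vm_compute.
by have /allP := all_In h (PM.elements_correct _ _ E); apply; exact: mem_elts3.
Qed.

Lemma find_elements A (m : PM.t (vec F8 * A)) s t :
  (if PM.find (vec_key s) m is Some x then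
     if veq8 x.1 s then Some x.2 else None else None) = Some t ->
  List.In (s, t) [seq kt.2 | kt <- PM.elements m].
Proof.
case E: (PM.find _ _) => [[s' t']|//]; case: veq8P => //= <- [<-].
exact: (List.in_map snd _ _ (PM.elements_correct _ _ E)).
Qed.

Lemma lookup_blocks s t : lookup s = Some t -> List.In (s, t) blocks.
Proof. exact: find_elements. Qed.

(** * Verification of the tables of T(8, 2) *)

Lemma basis8_spans : all (fun i =>
    absolute_pair A0 add8 mul8 sq8 eq8 (basis8 i) &&
    all (fun a => all (fun b => let x := comb8 a b (basis8 i) in
      if null8 x then eq8 a A0 && eq8 b A0
      else if lookup (normalize x) is Some t then on_b i t else false) elts8) elts8)
  indices.
Proof. vm_cast_no_check (erefl true). Qed.

(** An index whose span contains both basis vectors of i is on both of their triples; these have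
    only i in common. *)
Lemma basis8_distinct : all (fun i =>
    match lookup (normalize (basis8 i).1), lookup (normalize (basis8 i).2) with
    | Some t, Some t' =>
      all (fun j => on_b j t' ==> eqi i j) [:: t.1.1; t.1.2; t.2]
    | _, _ => false
    end) indices.
Proof. vm_cast_no_check (erefl true). Qed.

Lemma blocks_spans : all (fun st : vec F8 * (index * index * index) =>
    let: (s, (i, j, k)) := st in
    [&& ~~ null8 s, veq8 (normalize s) s, ~~ eqi i j &
     all (fun i => in_types i && has (veq8 s) (span_points (basis8 i))) [:: i; j; k]])
  blocks.
Proof. vm_cast_no_check (erefl true). Qed.

(* The 2048 absolute points with first coordinate 1: X_3, X_5 and X_6
   are free and determine the other coordinates up to solving two Artin-Schreier
   equations. *)
Definition roots8 (a : F8) : seq F8 := [seq x <- elts8 | eq8 (add8 (sq8 x) x) a].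

Definition cell_all (P : vec F8 -> bool) : bool :=
  all (fun x3 => all (fun x5 => all (fun x6 =>
    let x7 := add8 (add8 (mul8 x5 (sq8 x6)) (mul8 x6 (sq8 x5))) (sq8 x3) in
    all (fun x2 => all (fun x1 =>
      P (Vec A1 x1 x2 x3
        (add8 (add8 (mul8 x5 (sq8 x1)) (mul8 x6 (sq8 x2))) (mul8 x3 (sq8 x3))) x5 x6 x7))
      (roots8 (add8 (mul8 x3 (sq8 x6)) (mul8 x6 (sq8 x7)))))
      (roots8 (add8 (mul8 x3 (sq8 x5)) (mul8 x5 (sq8 x7))))) elts8) elts8) elts8.

Definition turns (k : nat) : vec F8 -> vec F8 := iter k (@turn F8).

(** Some power of [turn] moves a nonzero coordinate of an absolute point to the front, so six cells
    exhaust the absolute points; [turns (6 - k)] undoes [turns k]. *)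
Lemma cells_listed : all (fun k => cell_all (fun y =>
    if lookup (normalize (turns (6 - k) y)) is Some _ then true else false)) (iota 0 6).
Proof. vm_cast_no_check (erefl true). Qed.

Definition head8 (x : vec F8) : F8 := let: Vec x0 _ _ _ _ _ _ _ := x in x0.

(* For an absolute point u with first coordinate 1, the only candidate for an
   absolute point collinear with u that has coordinates 0, v5, v6 in the given
   places. *)
Definition partner (u : vec F8) (v5 v6 : F8) : vec F8 :=
  let: Vec u0 u1 u2 u3 u4 u5 u6 u7 := u in
  (* Incidence prescribes the square of v3. Squaring twice more recovers v3, since a^8 = a. *)
  let v3 := sq8 (sq8 (add8 (mul8 u5 (sq8 v6)) (mul8 u6 (sq8 v5)))) in
  let v7 := add8 (mul8 v5 (sq8 u6)) (mul8 v6 (sq8 u5)) in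
  Vec A0 (add8 (mul8 v3 (sq8 u6)) (mul8 v6 (sq8 u7)))
    (add8 (mul8 v3 (sq8 u5)) (mul8 v5 (sq8 u7))) v3
    (add8 (add8 (mul8 v5 (sq8 u1)) (mul8 v6 (sq8 u2))) (mul8 v3 (sq8 u3))) v5 v6 v7.

(** A line through u has, up to scalars, one point with first coordinate 0. If it is absolute, its
    coordinates 5 and 6 are not both zero and can be scaled to one of nine pairs, so that nine
    candidates per point suffice instead of all pairs of points. *)
Lemma partners_listed : all (fun st : vec F8 * (index * index * index) =>
    has (fun k => let u := turns k st.1 in
      eq8 (head8 u) A1 &&
      all (fun c => let v := partner u c.1 c.2 in
        if incident8 u v && incident8 v u && incident8 v v then
          if lookup (normalize (turns (6 - k) v)) is Some t then
            has (fun i => on_b i t) [:: st.2.1.1; st.2.1.2; st.2.2]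
          else false
        else true) ((A0, A1) :: [seq (A1, c) | c <- elts8])) (iota 0 6)) blocks.
Proof. vm_cast_no_check (erefl true). Qed.

Notation absolute_pair8 := (absolute_pair A0 add8 mul8 sq8 eq8).
Notation independent8 := (independent A0 add8 mul8 eq8).
Notation in_span8 := (in_span add8 mul8).

(** * The tables list all points and lines of T(8, 2) *)

Section T28Model.

Let dom (i : index) : Prop := i \in indices.
Let block (s : vec F8) t : Prop := lookup s = Some t.

Lemma on_bP i t : reflect (on i t) (on_b i t).
Proof. by apply: (iffP or3P) => -[/eqiP|/eqiP|/eqiP]; constructor. Qed.

Lemma scale_comb k a b u : scale8 k (comb8 a b u) = comb8 (mul8 k a) (mul8 k b) u.
Proof.
case: u => -[? ? ? ? ? ? ? ?] [? ? ? ? ? ? ? ?]; rewrite /scale8 /comb8 /comb /=.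
by rewrite !mul8Dr !mul8A.
Qed.

Lemma comb8_0l c u : comb8 A0 c u = scale8 c u.2.
Proof. by case: u => -[? ? ? ? ? ? ? ?] [? ? ? ? ? ? ? ?]; reflexivity. Qed.

Lemma comb8_0r c u : comb8 c A0 u = scale8 c u.1.
Proof.
case: u => -[? ? ? ? ? ? ? ?] [? ? ? ? ? ? ? ?]; rewrite /scale8 /comb8 /comb /=.
by rewrite !add8_0.
Qed.

Lemma span_points_span u s : has (veq8 s) (span_points u) -> in_span8 u s.
Proof.
case/orP => [/veq8P -> | ].
  have [k ->] := normalizeE u.2; exists A0, k; exact: esym (comb8_0l _ _).
rewrite -[X in is_true X -> _]/(has (veq8 s) [seq normalize (comb8 A1 c u) | c <- elts8]).
rewrite has_map => /hasP[c _ /veq8P ->].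
by have [k ->] := normalizeE (comb8 A1 c u); rewrite scale_comb; do 2!eexists.
Qed.

Lemma basis8_absolute i : dom i -> absolute_pair8 (basis8 i).
Proof. by move/(allP basis8_spans)/andP => []. Qed.

Lemma basis8_comb i a b : dom i ->
  let x := comb8 a b (basis8 i) in
  if null8 x then a = A0 /\ b = A0
  else exists2 t, lookup (normalize x) = Some t & on i t.
Proof.
move=> /(allP basis8_spans)/andP[_ /allP/(_ a (mem_elts8 a))/allP/(_ b (mem_elts8 b))] /=.
case: (null8 _) => [/andP[/eq8P -> /eq8P ->] // | ].
by case E: (lookup _) => [t|//] /on_bP it; exists t.
Qed.

Lemma basis8_independent i : dom i -> independent8 (basis8 i).
Proof.
by move=> di a b nx; have := basis8_comb a b di; rewrite /= /null8 /comb8 nx.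
Qed.

Lemma block_on8 i x : dom i -> in_span8 (basis8 i) x -> ~~ null8 x ->
  exists2 t, lookup (normalize x) = Some t & on i t.
Proof.
by move=> di [a [b ->]] nx; have := basis8_comb a b di; rewrite /= (negPf nx).
Qed.

Lemma null_scale8 c x : null8 x -> null8 (scale8 c x).
Proof.
case: x => ? ? ? ? ? ? ? ? /=; rewrite /null8 /scale8 /=.
by move=> /and5P[/eq8P-> /eq8P-> /eq8P-> /eq8P-> /and4P[/eq8P-> /eq8P-> /eq8P-> /eq8P->]]; rewrite !mul8_0.
Qed.

Lemma null_scale0 x : null8 (scale8 A0 x).
Proof. by case: x. Qed.

Lemma basis8_injective i j : dom i -> dom j ->
  in_span8 (basis8 j) (basis8 i).1 -> in_span8 (basis8 j) (basis8 i).2 -> i = j.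
Proof.
move=> di dj s1 s2.
have n1 : ~~ null8 (basis8 i).1.
  apply/negP => n; have := basis8_comb A1 A0 di.
  by rewrite /= comb8_0r null_scale8 // => -[].
have n2 : ~~ null8 (basis8 i).2.
  apply/negP => n; have := basis8_comb A0 A1 di.
  by rewrite /= comb8_0l null_scale8 // => -[].
have [t1 e1 /on_bP j1] := block_on8 dj s1 n1.
have [t2 e2 /on_bP j2] := block_on8 dj s2 n2.
have /(allP basis8_distinct) := di; rewrite e1 e2 => /allP/(_ j).
rewrite j2 => h; apply/eqiP/h.
by rewrite !inE; exact: j1.
Qed.

Lemma lookupP s t : lookup s = Some t ->
  [/\ ~~ null8 s, normalize s = s, t.1.1 <> t.1.2 &
      forall i, on i t -> dom i /\ in_span8 (basis8 i) s].
Proof.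
move/lookup_blocks => /(all_In blocks_spans); case: t => [[i j] k].
case/and4P => ns /veq8P sE ij /and4P[/andP[di si] /andP[dj sj] /andP[dk sk] _].
split=> // [/eqiP/= | l []/= -> ]; first by rewrite (negPf ij).
all: by split; [exact: in_types_indices | exact: span_points_span].
Qed.

Lemma scale8_neq0 c x : ~~ null8 (scale8 c x) -> c != A0.
Proof. by apply: contra => /eqP ->; exact: null_scale0. Qed.

Lemma lookup_scale c s t t' :
  lookup s = Some t -> lookup (scale8 c s) = Some t' -> t = t'.
Proof.
move=> h h'; have [_ sE _ _] := lookupP h; have [n' sE' _ _] := lookupP h'.
have := normalize_scale s (scale8_neq0 n').
by rewrite sE sE' => E; rewrite E h in h'; case: h'.
Qed.

Lemma incident8_turns k x y : incident8 (turns k x) (turns k y) = incident8 x y.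
Proof.
elim: k => //= k <-; exact: (incident_turn A0 sq8 eq8 emb8_inj emb8_add emb8_mul).
Qed.

Lemma incident8_comb u a b c d : absolute_pair8 u ->
  incident8 (comb8 a b u) (comb8 c d u).
Proof.
exact: (absolute_pair_comb eq8P emb8_inj emb8_surj emb8_0 emb8_add emb8_mul
  emb8_sq (fun _ => erefl) GF8_char2).
Qed.

Lemma null_turns k x : null8 (turns k x) = null8 x.
Proof. by elim: k => //= k <-; exact: null_turn. Qed.

Lemma turns6 k x : k < 6 -> turns (6 - k) (turns k x) = x.
Proof.
move=> k6; rewrite /turns -iterD subnK ?(ltnW k6) //.
by case: x.
Qed.

Lemma turns_scale k c x : turns k (scale8 c x) = scale8 c (turns k x).
Proof. by elim: k => //= k ->; case: (turns k x). Qed.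

Lemma head_turns_add k x y :
  head8 (turns k (vadd add8 x y)) = add8 (head8 (turns k x)) (head8 (turns k y)).
Proof.
have -> : turns k (vadd add8 x y) = vadd add8 (turns k x) (turns k y).
  by elim: k => //= k ->; case: (turns k x) (turns k y) => ? ? ? ? ? ? ? ? [].
by case: (turns k x) (turns k y) => ? ? ? ? ? ? ? ? [].
Qed.

Lemma head_scale c x : head8 (scale8 c x) = mul8 c (head8 x).
Proof. by case: x. Qed.

Lemma incident8P x y : incident8 x y ->
  let: Vec x0 x1 x2 x3 x4 x5 x6 x7 := prod add8 mul8 x (vmap sq8 y) in
  [/\ x0 = A0, x1 = A0, x2 = A0 & x3 = A0] /\ [/\ x4 = A0, x5 = A0, x6 = A0 & x7 = A0].
Proof.
rewrite /incident8 /incident; case: (prod _ _ _ _) => ? ? ? ? ? ? ? ? /=.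
by case/and5P => /eq8P-> /eq8P-> /eq8P-> /eq8P-> /and4P[/eq8P-> /eq8P-> /eq8P-> /eq8P->].
Qed.

(** If the six coordinates other than X_3 and X_7 vanish, self-incidence reduces to x3^3 = x7^3 =
    0. *)
Lemma absolute_head x : incident8 x x -> ~~ null8 x ->
  exists2 k, k < 6 & head8 (turns k x) != A0.
Proof.
move=> xx nx; have [/hasP[k] | /hasPn h] :=
  boolP (has (fun k => head8 (turns k x) != A0) (iota 0 6)).
  by rewrite mem_iota => ?; exists k.
have {}h k : k < 6 -> head8 (turns k x) = A0.
  by move=> k6; apply/eqP/negPn/h; rewrite mem_iota.
case/negP: nx; have := incident8P xx.
case: x {xx} h => x0 x1 x2 x3 x4 x5 x6 x7 h.
have /= -> := h 0 isT; have /= -> := h 1 isT; have /= -> := h 2 isT.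
have /= -> := h 3 isT; have /= -> := h 4 isT; have /= -> := h 5 isT.
case=> [[_ _ _ e3] [_ _ _ e7]].
by case: x3 e3 {h} => //= _; case: x7 e7.
Qed.

(** When the first coordinate is 1, four of the eight equations of self-incidence suffice: one gives
    x7, one gives x4, and two are the Artin-Schreier equations for x1 and x2. *)
Lemma cell_listed P y : cell_all P -> head8 y = A1 -> incident8 y y -> P y.
Proof.
case: y => x0 x1 x2 x3 x4 x5 x6 x7 H /= -> /incident8P /=.
rewrite !mul8_1 => -[[_ e1 e2 e3] [e4 _ _ _]].
move/allP/(_ x3 (mem_elts8 x3))/allP/(_ x5 (mem_elts8 x5))/allP/(_ x6 (mem_elts8 x6)): H.
have r a b c d : add8 (add8 (add8 a b) c) d = A0 -> add8 a b = add8 c d.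
  by move=> h; apply: add8_eq0; rewrite add8A.
rewrite /=; set z7 := add8 _ (sq8 x3) => H.
have z7E : x7 = z7 := add8_solve1 e4.
have m2 : x2 \in roots8 (add8 (mul8 x3 (sq8 x5)) (mul8 x5 (sq8 z7))).
  by rewrite mem_filter mem_elts8 andbT; apply/eq8P; rewrite -z7E; exact: r.
have m1 : x1 \in roots8 (add8 (mul8 x3 (sq8 x6)) (mul8 x6 (sq8 z7))).
  by rewrite mem_filter mem_elts8 andbT; apply/eq8P; rewrite -z7E; exact: r.
have -> : x4 = add8 (add8 (mul8 x5 (sq8 x1)) (mul8 x6 (sq8 x2))) (mul8 x3 (sq8 x3)).
  by apply: add8_eq0; rewrite !add8A.
by rewrite z7E; exact: (allP (allP H x2 m2) x1 m1).
Qed.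

Lemma absolute_listed x : ~~ null8 x -> incident8 x x ->
  exists c t, lookup (scale8 c x) = Some t.
Proof.
move=> nx xx; have [k k6 h0] := absolute_head xx nx.
pose c := inv8 (head8 (turns k x)); pose y := turns k (scale8 c x).
have yE : y = scale8 c (turns k x) by rewrite /y turns_scale.
have hy : head8 y = A1 by rewrite yE head_scale mul8_inv.
have c0 : c != A0 by rewrite /c; case: (head8 _) h0.
have yy : incident8 y y.
  have := @incident8_comb (x, x) c A0 c A0; rewrite !comb8_0r /= => h.
  by rewrite incident8_turns h // /absolute_pair -!/(incident8 _ _) /= xx.
have := cell_listed (allP cells_listed k _) hy yy.
rewrite mem_iota turns6 // normalize_scale // => /(_ k6).
case E: (lookup _) => [t|//] _; have [d dE] := normalizeE x.
by exists d, t; rewrite -dE.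
Qed.

Lemma sq8_3 a : sq8 (sq8 (sq8 a)) = a.
Proof. by case: a. Qed.

Lemma partnerE u v : head8 u = A1 -> head8 v = A0 ->
  incident8 u v -> incident8 v u ->
  let: Vec _ _ _ _ _ v5 v6 _ := v in v = partner u v5 v6.
Proof.
case: u v => u0 u1 u2 u3 u4 u5 u6 u7 [v0 v1 v2 v3 v4 v5 v6 v7] /= -> ->.
move=> /incident8P /= [_ [e4 _ _ _]] /incident8P /= [[_ f1 f2 f3] [f4 _ _ _]].
rewrite !(mul8_0, mul8_1, add8_0) in e4 f1 f2 f3 f4.
have -> : sq8 (sq8 (add8 (mul8 u5 (sq8 v6)) (mul8 u6 (sq8 v5)))) = v3.
  by rewrite (add8_eq0 e4) sq8_3.
have r a b c : add8 (add8 a b) c = A0 -> a = add8 b c.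
  by move=> h; apply: add8_eq0; rewrite add8A.
rewrite -(r _ _ _ f1) -(r _ _ _ f2) (add8_eq0 f4).
by congr Vec; apply: r; rewrite add8A.
Qed.

Lemma add_scale_comb w k u :
  vadd add8 u.2 (scale8 w (scale8 k u.1)) = comb8 (mul8 w k) A1 u.
Proof.
case: u => -[? ? ? ? ? ? ? ?] [? ? ? ? ? ? ? ?].
by rewrite /scale8 /comb8 /comb /= -!mul8A; congr Vec; rewrite add8C.
Qed.

Lemma in_span_scale u c x : in_span8 u x -> in_span8 u (scale8 c x).
Proof. by move=> [a [b ->]]; rewrite scale_comb; do 2!eexists. Qed.

Lemma in_span_add u x y : in_span8 u x -> in_span8 u y -> in_span8 u (vadd add8 x y).
Proof.
move=> [a [b ->]] [c [d ->]]; exists (add8 a c), (add8 b d).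
case: u => -[? ? ? ? ? ? ? ?] [? ? ? ? ? ? ? ?].
by congr Vec; apply: emb8_inj; rewrite !(emb8_add, emb8_mul); ring.
Qed.

Lemma scale8K x k : k != A0 -> scale8 (inv8 k) (scale8 k x) = x.
Proof.
by case: x => ? ? ? ? ? ? ? ? k0; rewrite /scale8 /= !mul8A mul8_inv.
Qed.

Lemma vadd8K x y : vadd add8 (vadd add8 x y) y = x.
Proof.
case: x y => ? ? ? ? ? ? ? ? [? ? ? ? ? ? ? ?] /=.
have h a b : add8 (add8 a b) b = a by case: a b => -[].
by rewrite !h.
Qed.

(** The line is spanned by a listed multiple s of [u.1] and by its point v with first coordinate 0
    after turning. By [partners_listed], a listed line contains both. *)
Lemma lines_listed8 u : independent8 u -> absolute_pair8 u ->
  exists i, [/\ dom i, in_span8 (basis8 i) u.1 & in_span8 (basis8 i) u.2].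
Proof.
move=> ind abs; have inc a b c d := @incident8_comb u a b c d abs.
have n1 : ~~ null8 u.1.
  apply/negP => n; have [] := ind A1 A0 => //.
  by rewrite [comb _ _ _ _ _]comb8_0r; exact: null_scale8.
have i1 : incident8 u.1 u.1 by case/and4P: abs.
have [k [t kt]] := absolute_listed n1 i1.
pose s := scale8 k u.1.
have k0 : k != A0 by have [/scale8_neq0] := lookupP kt.
have := all_In partners_listed (lookup_blocks kt) => /hasP[m m6 /andP[/eq8P hs /allP h]].
rewrite -/s mem_iota /= in m6 hs h.
pose w0 := head8 (turns m u.2).
pose v := vadd add8 u.2 (scale8 w0 s).
have sE : s = comb8 k A0 u by rewrite comb8_0r.
have vE : v = comb8 (mul8 w0 k) A1 u by exact: add_scale_comb.
have hv : head8 (turns m v) = A0.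
  rewrite head_turns_add turns_scale head_scale hs mul8_1 -/w0.
  by case: (w0).
have nv : ~~ null8 v.
  by apply/negP; rewrite vE => /ind[].
(* If coordinates 5 and 6 of the turned v were both zero, [partnerE] would make v null. Hence a
   scalar c brings them to one of the nine tested pairs. *)
have [c c0 cv] : exists2 c, c != A0 &
    let: Vec _ _ _ _ _ v5 v6 _ := turns m (scale8 c v) in
    (v5, v6) \in (A0, A1) :: [seq (A1, c) | c <- elts8].
  have pv := partnerE hs hv; rewrite !incident8_turns sE vE in pv.
  have {pv} := pv (inc _ _ _ _) (inc _ _ _ _); rewrite -sE -vE.
  have := null_turns m v; rewrite (negPf nv).
  case E: (turns m v) => [y0 y1 y2 y3 y4 y5 y6 y7] ny /= pv.
  have [y50 | y50] := eqVneq y5 A0; last first.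
    exists (inv8 y5); first by case: (y5) y50.
    by rewrite turns_scale E /= mul8_inv //; case: (mul8 _ _).
  have [y60 | y60] := eqVneq y6 A0; last first.
    exists (inv8 y6); first by case: (y6) y60.
    by rewrite turns_scale E /= mul8_inv // y50 mul8_0.
  move: ny; rewrite pv y50 y60; case: (turns m s) => ? ? ? ? ? ? ? ?.
  by rewrite /partner !mul8_0.
have v'E : scale8 c v = comb8 (mul8 c (mul8 w0 k)) c u.
  by rewrite vE scale_comb mul8_1.
have hv' : head8 (turns m (scale8 c v)) = A0.
  by rewrite turns_scale head_scale hv mul8_0.
have iv : incident8 (turns m (scale8 c v)) (turns m (scale8 c v)).
  by rewrite incident8_turns v'E.
have isv : incident8 (turns m s) (turns m (scale8 c v)) by rewrite incident8_turns v'E sE.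
have ivs : incident8 (turns m (scale8 c v)) (turns m s) by rewrite incident8_turns v'E sE.
have := partnerE hs hv' isv ivs; have := turns6 (scale8 c v) m6.
move: cv iv isv ivs; case E: (turns m (scale8 c v)) => [y0 y1 y2 y3 y4 y5 y6 y7] cv iv isv ivs tE pv.
have := h _ cv; rewrite /= -pv isv ivs iv tE normalize_scale //=.
case vt: (lookup (normalize v)) => [t'|//] it.
have [i it1 it2] : exists2 i, on i t & on i t'.
  by case/or4P: it => // /on_bP it; eexists; try exact: it; constructor.
have [_ _ _ /(_ i it1)[di si]] := lookupP kt.
have [_ _ _ /(_ i it2)[_ vi]] := lookupP vt.
have {}vi : in_span8 (basis8 i) v.
  have [d dE] := normalizeE v; have [_ _ _ /(_ i it2)[_ _]] := lookupP vt.
  have d0 : d != A0 by move: vt; rewrite dE => /lookupP[/scale8_neq0].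
  by rewrite -(scale8K v d0) -dE; exact: in_span_scale.
exists i; split => //; first by rewrite -(scale8K u.1 k0); exact: in_span_scale.
rewrite -(vadd8K u.2 (scale8 w0 s)); apply: in_span_add => //.
exact: in_span_scale.
Qed.

Lemma T28_models : extensional_lines T28 /\
  exists r : index -> point T28 -> Prop, models dom (fun t => exists s, block s t) r.
Proof.
apply: (@dual_triality_coded _ _ _ _ _ _ _ _ _ eq8P emb8_inj emb8_surj emb8_0
  emb8_add emb8_mul emb8_sq (fun _ => erefl) GF8_char2 _ dom basis8 block).
- exact: basis8_absolute.
- exact: basis8_independent.
- exact: basis8_injective.
- move=> s t /lookupP[ns _ nt it]; have [d1 _] := it _ (Or31 _ _ erefl).
  have [d2 _] := it _ (Or32 _ _ erefl); have [d3 _] := it _ (Or33 _ _ erefl).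
  by split=> //; split=> // i /it[].
- move=> i x di xi nx; have [t ht it] := block_on8 di xi nx.
  by have [c cE] := normalizeE x; exists c, t; rewrite /block -[vscale _ _ _]cE.
- exact: lookup_scale.
- exact: absolute_listed.
- exact: lines_listed8.
Qed.
End T28Model.

(** * The points and lines of the dual of H(2) *)

Section F2Code.
Local Open Scope ring_scope.

Definition emb2 (b : bool) : 'F_2 := b%:R.

Lemma emb2_inj : injective emb2.
Proof. by case=> -[]. Qed.

Lemma emb2_surj (x : 'F_2) : exists b, x = emb2 b.
Proof. by case: x => -[|[|//]] ?; [exists false | exists true]; apply: val_inj. Qed.

Lemma emb2_add : {morph emb2 : a b / a (+) b >-> a + b}.
Proof. by case=> -[]; apply: val_inj. Qed.

Lemma emb2_mul : {morph emb2 : a b / a && b >-> a * b}.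
Proof. by case=> -[]; apply: val_inj. Qed.

Lemma F2_sq (x : 'F_2) : x = x ^+ 2.
Proof. by have [b ->] := emb2_surj x; case: b; apply: val_inj. Qed.
End F2Code.

Notation incident2 := (incident false addb andb id eqb).
Notation comb2 := (comb addb andb).
Notation null2 := (null false eqb).
Notation absolute_pair2 := (absolute_pair false addb andb id eqb).
Notation in_span2 := (in_span addb andb).

Definition veq2 (x y : vec bool) : bool := null2 (vadd addb x y).

Definition bases2 : seq (vec bool * vec bool) := Eval vm_compute in
  let f := vmap (eq8 A1) in [seq (f u.1, f u.2) | u <- rational_bases].

Definition basis2 (p : nat) : vec bool * vec bool :=
  let z := Vec false false false false false false false false in nth (z, z) bases2 p.

Definition blocks2 : seq (vec bool * (nat * nat * nat)) := Eval vm_compute in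
  pmap (fun st : vec F8 * (index * index * index) =>
    if st.2 is (Rat p, Rat q, Rat r) then Some (vmap (eq8 A1) st.1, (p, q, r)) else None)
  blocks.

Definition bools := [:: false; true].

Definition span2 (u : vec bool * vec bool) := [seq comb2 a b u | a <- bools, b <- bools].

Definition on2 (p : nat) (t : nat * nat * nat) := [|| eqn p t.1.1, eqn p t.1.2 | eqn p t.2].

Definition all_vec2 (P : pred (vec bool)) : bool :=
  all (fun a => all (fun b => all (fun c => all (fun d =>
  all (fun a' => all (fun b' => all (fun c' => all (fun d' =>
    P (Vec a b c d a' b' c' d')) bools) bools) bools) bools) bools) bools) bools) bools.

Lemma all_vec2P (P : pred (vec bool)) x : all_vec2 P -> P x.
Proof.
have mb b : b \in bools by case: b.
by case: x => a b c d a' b' c' d' /allP/(_ a (mb _))/allP/(_ b (mb _))/allP/(_ c (mb _))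
  /allP/(_ d (mb _))/allP/(_ a' (mb _))/allP/(_ b' (mb _))/allP/(_ c' (mb _))/allP/(_ d' (mb _)).
Qed.

Lemma veq2P x y : reflect (x = y) (veq2 x y).
Proof.
case: x y => ? ? ? ? ? ? ? ? [? ? ? ? ? ? ? ?]; rewrite /veq2 /=.
have h a b : eqb (a (+) b) false = (a == b) by case: a b => -[].
rewrite !h; apply: (iffP idP) => [/and5P[/eqP-> /eqP-> /eqP-> /eqP->] | [-> -> -> -> -> -> -> ->]].
  by move=> /and4P[/eqP-> /eqP-> /eqP-> /eqP->].
by rewrite !eqxx.
Qed.

Lemma in_span2P u x : reflect (in_span2 u x) (has (veq2 x) (span2 u)).
Proof.
rewrite /span2 /= orbF; apply: (iffP or4P).
  by case=> /veq2P ->; do 2!eexists.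
by case=> -[] [[] ->]; [apply: Or44 | apply: Or43 | apply: Or42 | apply: Or41]; exact/veq2P.
Qed.

Lemma bases2_spans : all (fun p => let u := basis2 p in
    [&& absolute_pair2 u,
      all (fun a => all (fun b => let x := comb2 a b u in
        if null2 x then ~~ a && ~~ b
        else has (fun st => veq2 x st.1 && on2 p st.2) blocks2) bools) bools &
      all (fun q => if has (veq2 u.1) (span2 (basis2 q)) && has (veq2 u.2) (span2 (basis2 q))
        then eqn p q else true) (iota 0 63)]) (iota 0 63).
Proof. vm_cast_no_check (erefl true). Qed.

Lemma blocks2_spans : all (fun st : vec bool * (nat * nat * nat) =>
    let: (s, (p, q, r)) := st in
    [&& ~~ null2 s, ~~ eqn p q,
      all (fun i => (i < 63) && has (veq2 s) (span2 (basis2 i))) [:: p; q; r] &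
      all (fun st' => if veq2 s st'.1 then [&& eqn p st'.2.1.1, eqn q st'.2.1.2 & eqn r st'.2.2] else true)
        blocks2]) blocks2.
Proof. vm_cast_no_check (erefl true). Qed.

(** With only 256 vectors, points and lines over the field of order 2 are found by exhaustion,
    without the normal forms needed for order 8. *)
Lemma points2_listed : all_vec2 (fun x =>
  if ~~ null2 x && incident2 x x then has (fun st => veq2 x st.1) blocks2 else true).
Proof. vm_cast_no_check (erefl true). Qed.

Lemma lines2_listed : all (fun st => all (fun st' => let s := st.1 in let s' := st'.1 in
    if [&& ~~ veq2 s s', incident2 s s' & incident2 s' s] then
      has (fun p => has (veq2 s) (span2 (basis2 p)) && has (veq2 s') (span2 (basis2 p)))
        (iota 0 63)
    else true) blocks2) blocks2.
Proof. vm_cast_no_check (erefl true). Qed.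

Lemma has_In T (P : pred T) l : has P l -> exists2 x, List.In x l & P x.
Proof.
elim: l => //= y l IH /orP[Py | /IH[x xl Px]]; first by exists y => //; left.
by exists x => //; right.
Qed.

Lemma vscale2 x : vscale andb true x = x.
Proof. by case: x. Qed.

Lemma HD2_models : exists r : nat -> point HD2 -> Prop,
  models (fun p => p < 63) (fun t => exists s, List.In (s, t) blocks2) r.
Proof.
have chk p : p < 63 -> _ := fun p63 => allP bases2_spans p (etrans (mem_iota 0 63 p) p63).
have incid x y : ~~ null2 (vscale andb x y) -> x = true /\ vscale andb x y = y.
  by case: x => [_ | ]; [rewrite vscale2 | case: y].
have pts x : ~~ null2 x -> incident2 x x -> exists t, List.In (x, t) blocks2.
  move=> nx xx; have := all_vec2P x points2_listed; rewrite nx xx => /has_In[[s t] st /veq2P E].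
  by exists t; rewrite E.
apply: proj2 (@dual_triality_coded _ false addb andb id eqb _ (fun a => a) emb2 _ emb2_inj
  emb2_surj erefl emb2_add emb2_mul (fun _ => erefl) F2_sq _ _ (fun p => p < 63) basis2
  (fun s t => List.In (s, t) blocks2) _ _ _ _ _ _ _ _).
- by move=> a b; apply: (iffP eqP).
- exact: val_inj.
- by move=> p /chk/and3P[].
- move=> p /chk/and3P[_ h _] a b n; have mb c : c \in bools by case: c.
  by have := allP (allP h a (mb a)) b (mb b); rewrite /= n; case: a b {n} => -[].
- move=> p q /chk/and3P[_ _ h] q63 /in_span2P h1 /in_span2P h2.
  by have := allP h q (etrans (mem_iota 0 63 q) q63); rewrite h1 h2 => /eqnP.
- move=> s [[p q] r] /(all_In blocks2_spans)/and4P[ns pq /and4P[/andP[-> /in_span2P hp]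
    /andP[-> /in_span2P hq] /andP[-> /in_span2P hr] _] _].
  split=> //; split; first exact/eqnP.
  by move=> i []/= ->.
- move=> p x /chk/and3P[_ h _] [a [b ->]] n; have mb c : c \in bools by case: c.
  have : if null2 (comb2 a b (basis2 p)) then ~~ a && ~~ b else
    has (fun st => veq2 (comb2 a b (basis2 p)) st.1 && on2 p st.2) blocks2.
    exact: (allP (allP h a (mb a)) b (mb b)).
  rewrite (negPf n) => /has_In[[s t] st /andP[/veq2P E pt]].
  exists true, t; rewrite vscale2 E.
  by split=> //; case/or3P: pt => /eqnP; constructor.
- move=> c s t t' st st'.
  have ns : ~~ null2 (vscale andb c s).
    by case: t' st' => [[p q] r] /(all_In blocks2_spans)/and4P[].
  have [_ cs] := incid _ _ ns; rewrite cs in st'.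
  case: t st => [[p q] r] /(all_In blocks2_spans)/and4P[_ _ _ h].
  have := all_In h st'; rewrite (introT (veq2P _ _) erefl).
  by case: t' {st' h} => [[p' q'] r'] /and3P[/eqnP/= -> /eqnP/= -> /eqnP/= ->].
- by move=> x nx xx; have [t st] := pts x nx xx; exists true, t; rewrite vscale2.
move=> u ind /and4P[i11 i12 i21 i22].
have n1 : ~~ null2 u.1.
  apply/negP => n; have [] := ind true false => //.
  by case: u n {ind i11 i12 i21 i22} => -[? ? ? ? ? ? ? ?] [? ? ? ? ? ? ? ?]; rewrite /= !addbF.
have n2 : ~~ null2 u.2.
  apply/negP => n; have [] := ind false true => //.
  by case: u n {ind i11 i12 i21 i22 n1} => -[? ? ? ? ? ? ? ?] [? ? ? ? ? ? ? ?].
have n12 : ~~ veq2 u.1 u.2.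
  apply/negP => /veq2P n; have [] := ind true true => //.
  by rewrite /comb n !vscale2; apply/veq2P.
have [t1 b1] := pts _ n1 i11; have [t2 b2] := pts _ n2 i22.
have : if [&& ~~ veq2 u.1 u.2, incident2 u.1 u.2 & incident2 u.2 u.1] then
    has (fun p => has (veq2 u.1) (span2 (basis2 p)) && has (veq2 u.2) (span2 (basis2 p)))
      (iota 0 63) else true := all_In (all_In lines2_listed b1) b2.
rewrite n12 i12 i21 => /hasP[p]; rewrite mem_iota => p63 /andP[/in_span2P h1 /in_span2P h2].
by exists p.
Qed.

(** * Near hexagons *)

Lemma least_nat (P : nat -> Prop) : (exists n, P n) ->
  exists n, P n /\ forall m, P m -> n <= m.
Proof.
case=> n; elim/ltn_ind: n => n IH Pn.
have [[m [mn Pm]] | h] := excluded_middle_informative (exists m, m < n /\ P m).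
  exact: IH mn Pm.
exists n; split=> // m Pm; rewrite leqNgt; apply/negP => mn.
by apply: h; exists m.
Qed.

Section Walks.
Variable G : geometry.
Implicit Types x y z : point G.

Lemma collinear_sym x y : collinear x y -> collinear y x.
Proof. by case=> xy [l [xl yl]]; split; [exact: nesym | exists l]. Qed.

Lemma walk_trans m n x y z : walk m x y -> walk n y z -> walk (m + n) x z.
Proof.
elim: m x => [|m IH] x /=; first by move=> ->.
by case=> w xw wy yz; exists w => //; exact: IH.
Qed.

Lemma walk_sym n x y : walk n x y -> walk n y x.
Proof.
elim: n x y => [|n IH] x y /=; first by move=> ->.
case=> z xz /IH yz; have : walk (n + 1) y x.
  by apply: walk_trans yz _; exists x => //; exact: collinear_sym.
by rewrite addn1.
Qed.

Lemma distance_fun x y m n : distance x y m -> distance x y n -> m = n.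
Proof. by move=> [wm lm] [wn ln]; apply/eqP; rewrite eqn_leq lm ?ln. Qed.

Lemma distance_ex n x y : walk n x y -> exists m, distance x y m.
Proof. by move=> w; apply: least_nat; exists n. Qed.
End Walks.

Section NearHexagon.
Variables (N : geometry) (hN : near_hexagon N) (h3 : three_points_per_line N).
Implicit Types (x y z w : point N) (l m : line N).

Lemma dist_ex x y : exists n, distance x y n.
Proof. by case: hN => _ conn _ _; have [n /distance_ex] := conn x y. Qed.

Definition dist x y : nat := proj1_sig (constructive_indefinite_description _ (dist_ex x y)).

Lemma distP x y : distance x y (dist x y).
Proof. exact: (proj2_sig (constructive_indefinite_description _ (dist_ex x y))). Qed.

Lemma distE x y n : distance x y n -> dist x y = n.
Proof. exact: distance_fun (distP x y). Qed.

Lemma dist_le x y n : walk n x y -> dist x y <= n.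
Proof. by have [_] := distP x y; apply. Qed.

Lemma dist_walk x y : walk (dist x y) x y.
Proof. by have [] := distP x y. Qed.

Lemma distC x y : dist x y = dist y x.
Proof.
by apply/eqP; rewrite eqn_leq !dist_le //; apply: walk_sym; exact: dist_walk.
Qed.

Lemma distxx x : dist x x = 0.
Proof. by apply/eqP; rewrite -leqn0; exact: dist_le. Qed.

Lemma dist0 x y : dist x y = 0 -> x = y.
Proof. by move=> d0; have := dist_walk x y; rewrite d0. Qed.

Lemma dist_triangle x y z : dist x z <= dist x y + dist y z.
Proof. by apply/dist_le/walk_trans; exact: dist_walk. Qed.

Lemma dist3 x y : dist x y <= 3.
Proof. by case: hN => _ _ [h _] _; apply: h (distP x y). Qed.

Lemma dist1P x y : dist x y = 1 <-> collinear x y.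
Proof.
split=> [d1 | xy].
  by have := dist_walk x y; rewrite d1 /= => -[z xz <-].
have : dist x y <= 1 by apply: dist_le; exists y.
have : dist x y <> 0 by have [ne _] := xy; move=> /dist0.
by case: (dist x y) => [|[|]].
Qed.

Lemma dist_step x y n : dist x y = n.+1 -> exists2 z, dist x z = 1 & dist z y = n.
Proof.
move=> dn; have := dist_walk x y; rewrite dn /= => -[z /dist1P xz w]; exists z => //.
apply/eqP; rewrite eqn_leq dist_le //= -ltnS -dn.
by apply: leq_trans (dist_triangle x z y) _; rewrite xz.
Qed.

Lemma line_unique x y l m : x <> y -> inc x l -> inc y l -> inc x m -> inc y m -> l = m.
Proof. by case: hN => -[_ h] _ _ _; exact: h. Qed.

Lemma near_extensional : extensional_lines N.
Proof.
move=> l m lm; case: hN => -[/(_ l)[x [y [xy xl yl]]] _] _ _ _.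
by apply: (line_unique xy) => //; apply/lm.
Qed.

Definition line3 x y z : Prop := [/\ x <> y, x <> z, y <> z &
  exists l, forall p, inc p l <-> [\/ p = x, p = y | p = z]].

Lemma line3C x y z : line3 x y z -> line3 y x z.
Proof.
case=> xy xz yz [l lE]; split=> //; first exact: nesym.
by exists l => p; rewrite lE; split=> -[] ->; constructor.
Qed.

Lemma line3R x y z : line3 x y z -> line3 y z x.
Proof.
case=> xy xz yz [l lE]; split=> //; try exact: nesym.
by exists l => p; rewrite lE; split=> -[] ->; constructor.
Qed.

Lemma line3S x y z : line3 x y z -> line3 x z y.
Proof. by move=> h; exact: line3C (line3R (line3R h)). Qed.

Lemma line3_fun x y z z' : line3 x y z -> line3 x y z' -> z = z'.
Proof.
move=> [xy xz yz [l lE]] [_ xz' yz' [l' lE']].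
have ll : l = l' by apply: (line_unique xy); rewrite ?lE ?lE'; constructor.
have : inc z l' by rewrite -ll lE; constructor.
by rewrite lE' => -[] // E; [case: xz | case: yz].
Qed.

Lemma line_points l : exists x y z, line3 x y z /\ forall p, inc p l <-> [\/ p = x, p = y | p = z].
Proof.
by have [x [y [z [xy xz yz lE]]]] := h3 l; exists x, y, z; split=> //; split=> //; exists l.
Qed.

Lemma line3_inc x y l : x <> y -> inc x l -> inc y l ->
  exists z, line3 x y z /\ forall p, inc p l <-> [\/ p = x, p = y | p = z].
Proof.
move=> xy xl yl; have [a [b [c [abc lE]]]] := line_points l.
have : exists z, [/\ [\/ z = a, z = b | z = c], z <> x, z <> y &
    forall p, [\/ p = a, p = b | p = c] -> [\/ p = x, p = y | p = z]].
  case: abc => ab ac bc _; move: xl yl; rewrite !lE.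
  move=> [] xE [] yE; rewrite {}xE {}yE in xy *; try (by case: xy);
    [exists c|exists b|exists c|exists a|exists b|exists a];
    split; try (by constructor); try (by apply/nesym); try by [];
    by move=> p []->; constructor.
case=> z [zl zx zy h]; exists z; have lz p : inc p l <-> [\/ p = x, p = y | p = z].
  rewrite lE; split=> [/h // | [] ->] //; by apply/lE.
by split=> //; split=> //; [exact: nesym | exact: nesym | exists l].
Qed.

Lemma dist1_line3 x y : dist x y = 1 -> exists z, line3 x y z.
Proof.
by case/dist1P=> xy [l [xl yl]]; have [z [h _]] := line3_inc xy xl yl; exists z.
Qed.

Lemma line3_dist x y z : line3 x y z -> dist x y = 1.
Proof.
by case=> xy _ _ [l lE]; apply/dist1P; split=> //; exists l; rewrite !lE; split; constructor.
Qed.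

(** The near polygon axiom for a line of three points; the disjuncts tell which of them is the
    nearest. *)
Definition near_rule (a b c : nat) : Prop :=
  [\/ b = a.+1 /\ c = a.+1, a = b.+1 /\ c = b.+1 | a = c.+1 /\ b = c.+1].

Lemma near_rule3 a b : near_rule a b 3 -> a <= 3 -> b <= 3 -> a = 2 \/ b = 2.
Proof. by case=> -[]; lia. Qed.

(** Distances to collinear points differ by at most 1, and by uniqueness the other two points are
    strictly farther than the nearest one. *)
Lemma line3_near w x y z : line3 x y z -> near_rule (dist w x) (dist w y) (dist w z).
Proof.
move=> h; have [xy xz yz [l lE]] := h.
have bound p q : inc p l -> inc q l -> p <> q -> dist w p <= (dist w q).+1.
  move=> pl ql pq; have : dist q p = 1 by apply/dist1P; split; [exact: nesym | exists l].
  by move=> qp; have := dist_triangle w q p; rewrite qp addn1.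
case: hN => _ _ _ /(_ w l)[p [[pl pmin] puniq]].
have strict q : inc q l -> q <> p -> dist w q = (dist w p).+1.
  move=> ql qp; apply/eqP; rewrite eqn_leq bound //= ltn_neqAle.
  rewrite (pmin q _ _ ql (distP w p) (distP w q)) andbT; apply/eqP => E.
  apply: qp; symmetry; apply: puniq; split=> // r m n rl dm dn.
  by apply: pmin rl _ dn; rewrite -(distE dm) -E; exact: distP.
have [xl yl zl] : [/\ inc x l, inc y l & inc z l] by split; apply/(lE _); constructor.
have [] := (lE p).1 pl => pE; rewrite {}pE in strict.
- by apply: Or31; split; apply: strict => //; exact: nesym.
- by apply: Or32; split; apply: strict => //; exact: nesym.
- by apply: Or33; split; exact: strict.
Qed.
End NearHexagon.

(** * Valuations of the dual of H(2) *)

Definition hlines : seq (nat * nat * nat) := Eval vm_compute in [seq st.2 | st <- blocks2].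

Definition hdist_table : seq (seq nat) := Eval vm_compute in
  let coll p q := has (fun t => on2 p t && on2 q t) hlines in
  let nbrs := [seq [seq q <- iota 0 63 | coll p q] | p <- iota 0 63] in
  let nbr p := nth [::] nbrs p in
  [seq [seq if eqn p q then 0 else if coll p q then 1
            else if has (fun r => coll r q) (nbr p) then 2 else 3
       | q <- iota 0 63] | p <- iota 0 63].

Definition hrow (p : nat) : seq nat := nth [::] hdist_table p.
Definition hdist (p q : nat) : nat := nth 0 (hrow p) q.

(* The distance to the third point of a line whose other points are at distance
   a and b. *)
Definition third (a b : nat) : option nat :=
  if eqn a b then if a is c.+1 then Some c else None
  else if eqn a b.+1 then Some a else if eqn b a.+1 then Some b else None.

Fixpoint third_row (f g : seq nat) : option (seq nat) :=
  match f, g with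
  | a :: f', b :: g' =>
    if third a b is Some c then omap (cons c) (third_row f' g') else None
  | _, _ => Some [::]
  end.

Fixpoint eqrow (f g : seq nat) : bool :=
  match f, g with
  | [::], [::] => true
  | a :: f', b :: g' => eqn a b && eqrow f' g'
  | _, _ => false
  end.

Fixpoint ones (f : seq nat) : nat :=
  if f is a :: f' then (if eqn a 1 then 1 else 0) + ones f' else 0.

(* For distinct lines of T(8, 2), the rank of the Gram matrix of their bases plus
   one, which is their distance in the dual. *)
Definition gram8 (u v : vec F8 * vec F8) : nat :=
  let form (x y : vec F8) :=
    let: Vec x0 x1 x2 x3 x4 x5 x6 x7 := x in let: Vec y0 y1 y2 y3 y4 y5 y6 y7 := y in
    foldr add8 A0 [:: mul8 x0 y4; mul8 x4 y0; mul8 x1 y5; mul8 x5 y1;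
                      mul8 x2 y6; mul8 x6 y2; mul8 x3 y7; mul8 x7 y3] in
  let a := form u.1 v.1 in let b := form u.1 v.2 in
  let c := form u.2 v.1 in let d := form u.2 v.2 in
  if ~~ eq8 (add8 (mul8 a d) (mul8 b c)) A0 then 3
  else if [&& eq8 a A0, eq8 b A0, eq8 c A0 & eq8 d A0] then 1 else 2.

Definition row_map : PM.t (seq nat) := Eval vm_compute in
  PM.map (fun u => [seq gram8 u v | v <- rational_bases]) irrational_map.

Definition row (b : positive) : seq nat := if PM.find b row_map is Some f then f else [::].

(** The irrational bases are listed in pairs of mates, numbered 2k - 1 and 2k; [types_spec] confirms
    this. *)
Definition foot_map : PM.t (nat * positive) := Eval vm_compute in
  PM.mapi (fun b f => (find (eqn 1) f,
      match b with xI _ => Pos.succ b | xO _ => Pos.pred b | xH => 2%positive end)) row_map.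

Definition foot (b : positive) : nat := if PM.find b foot_map is Some x then x.1 else 63.
Definition mate (b : positive) : positive := if PM.find b foot_map is Some x then x.2 else b.

(* [link b c = Some (s, o)]: the points [Irr b i] and [Irr c (i + s)] are
   collinear; the third point of their line is over e if [o = Some e] and in H if
   [o = None]. *)
Definition link_map : PM.t (PM.t (Z3 * option positive)) := Eval vm_compute in
  let add b c v d m :=
    PM.add b (PM.add c (v, d) (if PM.find b m is Some n then n else PM.empty _)) m in
  let link b i c j d m := add b c (add3 j (opp3 i)) d (add c b (add3 i (opp3 j)) d m) in
  foldr (fun st m => match st.2 with
    | (Rat _, Irr b i, Irr c j) => link b i c j None m
    | (Irr b i, Irr c j, Irr d k) =>
      link b i c j (Some d) (link b i d k (Some c) (link c j d k (Some b) m))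
    | _ => m end) (PM.empty _) blocks.

Definition links (b : positive) : PM.t (Z3 * option positive) :=
  if PM.find b link_map is Some n then n else PM.empty _.
Definition link (b c : positive) : option (Z3 * option positive) := PM.find c (links b).
Definition linked (b c : positive) : bool := if link b c is Some _ then true else false.
Definition shift (b c : positive) : Z3 := if link b c is Some x then x.1 else Z0.
Definition nbrs (b : positive) : seq positive := [seq x.1 | x <- PM.elements (links b)].

Definition close (a b : nat) : bool := (a <= b.+1) && (b <= a.+1).

(** A line gives its full condition when the search reaches its largest point; already at its middle
    point it gives the weaker condition that distances to collinear points differ by at most 1,
    which prunes earlier. *)
Definition search_steps : seq (seq (nat * nat) * seq nat) := Eval vm_compute in
  let sorted := [seq sort leq [:: t.1.1; t.1.2; t.2] | t <- hlines] in
  [seq (pmap (fun s => if eqn (nth 0 s 2) i then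
                 Some (i.-1 - nth 0 s 0, i.-1 - nth 0 s 1) else None) sorted,
        pmap (fun s => if eqn (nth 0 s 1) i then Some (i.-1 - nth 0 s 0) else None) sorted)
  | i <- iota 0 63].

Definition third_is (a b c : nat) : bool := if third a b is Some d then eqn c d else false.

Definition consistent (pre : seq nat) (st : seq (nat * nat) * seq nat) (a : nat) : bool :=
  all (fun ij => third_is (nth 0 pre ij.1) (nth 0 pre ij.2) a) st.1 &&
  all (fun i => close (nth 0 pre i) a) st.2.

(* Runs through the functions with values 1, 2 and 3 that satisfy the constraints
   [steps], of which the n-th one relates the n-th value to earlier ones, counted
   backwards. *)
Fixpoint search (P : pred (seq nat)) (pre : seq nat) steps : bool :=
  if steps is st :: steps' then
    all (fun a => if consistent pre st a then search P (a :: pre) steps' else true)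
      [:: 1; 2; 3]
  else P (rev pre).

Definition valuation (f : seq nat) : bool :=
  all (fun t => third_is (nth 0 f t.1.1) (nth 0 f t.1.2) (nth 0 f t.2)) hlines.

(** If x is collinear with p in H, the third point of their line is outside H, and its distances are
    forced by those of x and p. They must again satisfy all line conditions with values from 1 to 3,
    which rejects the solutions of the search that are not among the 252. *)
Definition admissible (f : seq nat) : bool :=
  all (fun p => if eqn (nth 0 f p) 1 then
      if third_row f (hrow p) is Some g then
        valuation g && all (fun a => (0 < a) && (a < 4)) g else false
    else true) (iota 0 63).

(** * Computations with valuations and their graph *)

Lemma valuations_classified : search (fun f =>
  if has (fun b => eqrow (row b) f) types then true else ~~ admissible f) [::] search_steps.
Proof. vm_cast_no_check (erefl true). Qed.

Lemma hdist_spec : all (fun p => all (fun q =>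
  [&& eqn (hdist p q) 0 == eqn p q,
      eqn (hdist p q) 1 == ~~ eqn p q && has (fun t => on2 p t && on2 q t) hlines,
      hdist p q < 4,
      (if hdist p q is k.+1 then
         has (fun r => eqn (hdist p r) 1 && eqn (hdist r q) k) (iota 0 63) else true),
      (if eqn (hdist p q) 1 then all (fun r => hdist p r <= (hdist q r).+1) (iota 0 63)
       else true) &
      (if eqn (hdist p q) 2 then
        size [seq r <- iota 0 63 | eqn (hdist p r) 1 && eqn (hdist r q) 1] < 2 else true)])
  (iota 0 63)) (iota 0 63).
Proof. vm_cast_no_check (erefl true). Qed.

Lemma types_spec : all (fun b =>
  [&& size (row b) == 63, foot b < 63,
     all (fun a => (0 < a) && (a < 4)) (row b), eqn (ones (row b)) 1,
     all (fun p => eqn (nth 0 (row b) p) 1 == eqn p (foot b)) (iota 0 63),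
     mate b \in types, eqn (foot (mate b)) (foot b), ~~ Pos.eqb (mate b) b,
     (if third_row (row b) (hrow (foot b)) is Some g then eqrow g (row (mate b)) else false) &
     (if link b (mate b) is Some (_, None) then true else false)]) types.
Proof. vm_cast_no_check (erefl true). Qed.

Lemma rows_distinct : all (fun b => all (fun c =>
   if eqrow (row b) (row c) then Pos.eqb b c else true) types) types.
Proof. vm_cast_no_check (erefl true). Qed.

(** The third point of a line outside H has again a valuation that takes the value 1 exactly once;
    the cheap test by [ones] discards the other pairs b, c. *)
Lemma links_complete : all (fun b => all (fun c =>
   if third_row (row b) (row c) is Some g then
     if eqn (ones g) 1 then
       if link b c is Some (_, Some d) then eqrow (row d) g else false
     else true
   else true) types) types.
Proof. vm_cast_no_check (erefl true). Qed.

(** For a line of three types b, c, d: the distance 2, the feet not being collinear and the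
    uniqueness of c among the neighbours with its foot make the edge lift ([step]), and d not being
    linked to [mate c] makes the lift unique ([step_unique]). *)
Lemma links_spec : all (fun b => all (fun c =>
   [&& c \in types, linked c b, eq3 (shift c b) (opp3 (shift b c)) &
    if link b c is Some (_, Some d) then
      [&& eqn (nth 0 (row b) (foot c)) 2, ~~ eqn (hdist (foot b) (foot c)) 1,
         ~~ eqn (foot b) (foot c),
         all (fun c' => if eqn (foot c') (foot c) then Pos.eqb c' c else true) (nbrs b),
         ~~ linked d (mate c), ~~ Pos.eqb c d &
         (if link b d is Some (_, Some c') then Pos.eqb c c' else false)]
    else Pos.eqb c (mate b)]) (nbrs b)) types.
Proof. vm_cast_no_check (erefl true). Qed.

(** The bound 3 is what [no_quadrangle] contradicts: the walks of length 2 from b to e or [mate e]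
    must serve all three lifts of the line through e, [mate e] and their foot. *)
Lemma quadrangles_spec : all (fun b => let l := nbrs b in all (fun v => all (fun e =>
   if Pos.eqb e b then true else
   ~~ eqn (foot e) (foot b) &&
   let k := size [seq c <- l | linked c e] in
   if 1 < k then
     eqn (nth 0 (row b) (foot e)) 3 &&
     (k + size [seq c <- l | linked c (mate e)] <= 3)
   else true) (nbrs v)) l) types.
Proof. vm_cast_no_check (erefl true). Qed.

(** * The graph of adjacent valuations *)

(* Edges of a breadth-first spanning tree of the graph of [link]s, rooted at 1;
   a byte for the parent and a byte for the child. *)
Definition tree : seq (positive * positive) := Eval vm_compute in
  let dec n := if digits 256 2 n is [:: Npos b; Npos c] then (b, c) else (1%positive, 1%positive) in
  map dec [::
  0x102; 0x123; 0x12e; 0x14b; 0x157; 0x15f; 0x16c; 0x16d; 0x17d; 0x185; 0x1a2;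
  0x1a5; 0x1b9; 0x1c6; 0x1d4; 0x1f3; 0x1f6; 0x21f; 0x22a; 0x241; 0x250; 0x259;
  0x263; 0x265; 0x275; 0x289; 0x299; 0x2ab; 0x2b4; 0x2ca; 0x2d5; 0x2e0; 0x2e3;
  0x230e; 0x2324; 0x2342; 0x2354; 0x2367; 0x2376; 0x2383; 0x238b; 0x2395;
  0x23a0; 0x23ae; 0x23cc; 0x23cd; 0x23f0; 0x23fb; 0x2e1a; 0x2e2d; 0x2e34;
  0x2e73; 0x2e81; 0x2e8d; 0x2e9a; 0x2e9e; 0x2ead; 0x2eb1; 0x2ebe; 0x2ec9;
  0x2ed9; 0x2ee1; 0x4b17; 0x4b25; 0x4b4c; 0x4b64; 0x4b78; 0x4b79; 0x4b94;
  0x4b96; 0x4baa; 0x4bb5; 0x4bd6; 0x4bec; 0x4bee; 0x4bfa; 0x5712; 0x573d;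
  0x5745; 0x5758; 0x5761; 0x5771; 0x577c; 0x578e; 0x57b6; 0x57db; 0x57df;
  0x57e4; 0x57e9; 0x5f13; 0x5f48; 0x5f4f; 0x5f5c; 0x5f60; 0x5f92; 0x5f97;
  0x5fac; 0x5fb8; 0x5fd8; 0x5fde; 0x6c19; 0x6c2c; 0x6c43; 0x6c47; 0x6c6b;
  0x6c82; 0x6c93; 0x6c9d; 0x6ccf; 0x6ced; 0x6d14; 0x6d16; 0x6d26; 0x6d52;
  0x6d6e; 0x6d8a; 0x6db0; 0x6dc0; 0x6dce; 0x6dda; 0x6dea; 0x7d20; 0x7d27;
  0x7d4d; 0x7d66; 0x7d7e; 0x7d98; 0x7dd0; 0x8511; 0x8528; 0x8572; 0x8584;
  0x8586; 0x859c; 0x85dc; 0xa20d; 0xa21d; 0xa232; 0xa23e; 0xa27b; 0xa291;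
  0xa2a1; 0xa2ef; 0xa2fc; 0xa51b; 0xa546; 0xa55a; 0xa574; 0xa5a6; 0xb918;
  0xb940; 0xb97a; 0xb9ba; 0xb9bd; 0xb9eb; 0xc61c; 0xc631; 0xc63f; 0xc690;
  0xc6b3; 0xc6b7; 0xc6c5; 0xd40f; 0xd429; 0xd451; 0xd48f; 0xd4af; 0xd4bf;
  0xd4d3; 0xf315; 0xf353; 0xf3f4; 0xf3f9; 0xf610; 0xf633; 0xf69f; 0xf6f5;
  0x1fa4; 0x1fbb; 0x1fd2; 0x2a6a; 0x2ac8; 0x417f; 0x5088; 0x595e; 0x6356;
  0x636f; 0x63f1; 0x6522; 0x654a; 0x75f8; 0x892f; 0xaba8; 0xe37; 0xe62; 0xe87;
  0xee7; 0xef2; 0x2408; 0x2439; 0x2469; 0x2480; 0x24d1; 0x24e8; 0x4205;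
  0x423c; 0x42a9; 0x42b2; 0x42e5; 0x540a; 0x54a7; 0x54bc; 0x54c1; 0x54dd;
  0x6709; 0x675b; 0x6768; 0x67c7; 0x7635; 0x764e; 0x769b; 0x76c4; 0x8330;
  0x83c2; 0x83e2; 0x8b07; 0x8b36; 0x8b5d; 0x8b8c; 0x9538; 0xa00c; 0xa070;
  0xcc3a; 0xccc3; 0xcccb; 0xcd0b; 0xf0f7; 0xfb49; 0x1a77; 0x2de6; 0x34a3;
  0x34d7; 0x7306; 0x9e21; 0xad55; 0xb11e; 0xb13b; 0x642b; 0x6444; 0x6203;
  0x8704]%num.

(* The bytes b, v, e, s, t, c of a number describe the three walks b v e c, b s c
   and b t c, no two of which have lifts with common ends.  A leading byte 1 says
   that the last edge of the first walk is deduced, otherwise it is that of the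
   third walk. *)
Definition deductions : seq N := [::
  0xb901236c180e; 0x1012ed96c230e; 0x1015fb86c230e; 0x101573d6c230e;
  0x1016d6e6c230e; 0x10102b46c230e; 0x101a20d6c230e; 0x2301b90e4218;
  0x2ed90e01c96c; 0x23015f0e83b8; 0x5fb80e015c6c; 0x6c01570e823d;
  0x230e6e01676d; 0x2301020eaeb4; 0x6c01020e19b4; 0x230e0d0176a2;
  0x6c0e0d012ca2; 0x12324800e4218; 0x12354c10e4218; 0x1b918238542;
  0x10157b66c2ec9; 0x101a2a16c2ec9; 0x1015f606c2ec9; 0x101f3f96c2ec9;
  0x1017d7e6c2ec9; 0x1016d266c2ec9; 0x10102ca6c2ec9; 0x123cccb0e83b8;
  0x57016c3ddb82; 0x123576167016d; 0xe6e6d23e767; 0x20123b450ae;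
  0x2016cb45019; 0x76230ea2c40d; 0x101c6c5a22376; 0x101b9baa22376;
  0x1015f60a22376; 0x1012e8da22376; 0x1016deaa22376; 0x101a546a22376;
  0x1010275a22376; 0xe2324186e80; 0x1015f92852342; 0x101c631852342;
  0x1014b4c852342; 0x101f6f5852342; 0x101f3f4852342; 0x1010241852342;
  0x2ec9b601b157; 0x2e01a2c973a1; 0x2e015fc9ad60; 0x6c01f3c993f9;
  0x16cc97e0e19b4; 0x6cc97e01437d; 0x2e017dc9347e; 0x6c016dc9ed26;
  0x2ec92601e16d; 0x16cc9ca0e823d; 0xe23ccb862cb; 0x16c8257c6db;
  0x6d26c961c0b6; 0x1b6574561c926; 0x1235758670ee7; 0x12324e8670ee7;
  0x1676dce83e7b8; 0x230102ae9550; 0x230e0d7695c4; 0xd0e6ca2c42c;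
  0x2301c67695c5; 0xa276c5012cc6; 0x2301b976a0ba; 0xa276ba011db9;
  0x23015f765460; 0x5f607601d8a2; 0x76a2a1604ec9; 0x23768d018b2e;
  0x12376ea0eaeb4; 0xa2016d763eea; 0x23764601cca5; 0x12376460e4218;
  0x1237646670ee7; 0xa201a5767b46; 0x12376750e83b8; 0x870e186e0480;
  0x23015f42fb92; 0x5f9242015c85; 0x76605f428d92; 0x2301c642f031;
  0x76c5c642ea31; 0x854231019cc6; 0x23424c01674b; 0x422324184c80;
  0x4218b9764cba; 0x2342f501ccf6; 0x8501f64228f5; 0x42925f76f560;
  0x2342f4018bf3; 0x42235418f4c1; 0x4231c676f4c5; 0x4b2eb101aa57;
  0x1a2a12ec673; 0x17660ada24285; 0x12e2de6adc960; 0xf3016cf9a593;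
  0x16c0e3793c9f9; 0x16c82db93c9f9; 0x2cac9b4597e; 0xe6cc9b4e77e;
  0x16c0e5401437d; 0x17d7e2ed434; 0x12e9e2134c97e; 0x6d016c26f6ed;
  0x16c0e0dedc926; 0x6dea76e1168d; 0x18d2e8176e1ea; 0x20157ca1f3d;
  0x5701023d71ca; 0x23cccb0e4262; 0x2301c657aedb; 0x1014b4c57c6db;
  0x1017d2757c6db; 0x101028957c6db; 0x10185dc57c6db; 0x157b66d85c0;
  0x16d2657c645; 0x672357e7c758; 0x6dceb867da83; 0x5fb8ce014f6d;
  0x15fb86d85ce; 0xe6e6db837ce; 0x12342f595ae50; 0x10250236c95;
  0x12357619576c4; 0x12342f59576c4; 0x123ccc39576c4; 0x176423ca2c42c;
  0x123f0f79576c5; 0x12324e89576c5; 0x1230ef276a0ba; 0x123243976a0ba;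
  0x1b9ba23d4a0; 0xbab96cc4702c; 0x76bab9a2351d; 0x123fb49765460;
  0x1230e6e765460; 0x1232408765460; 0x540e6c60ddc9; 0x10e0dd862b8cb;
  0xa2a1c9763e4e; 0x176423c604ec9; 0x1c96ccf4e2e8d; 0x768d2e234e8b;
  0x123a00c8b0ed9; 0x123ccc38b0ed9; 0x6d0102eac0b4; 0x7576ea02f8b4;
  0x2016db4d5ea; 0xe6e6db493ea; 0x6d016ceada19; 0x6d01a2eaf63e;
  0x7646a5239bcc; 0xb901a5184046; 0x67e746235b76; 0x1a546a2f37b;
  0xa20d0e7befe7; 0xe0da2e7d97b; 0x5f0102b89775; 0xe74676b85875;
  0x7675b8234e83; 0x2b40e7599b8; 0x123953842fb92; 0x123246942fb92;
  0x5f012392d4fb; 0x42925f85b25c; 0x176a2918d4292; 0x2e015f8d9e92;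
  0x12324d1f04231; 0x123a00cf04231; 0x1c631237df0; 0x6d01c6ea5231;
  0x176a232ea4231; 0xc6016d31b7ea; 0x1c67d4d9c0185; 0x424c4b233c67;
  0x14c4b17804218; 0x142417f4c1880; 0xb9ba4c184080; 0x4b4cba0164b9;
  0x1428584764cba; 0x12357b1cc01f6; 0x6df6cc01e1a5; 0x42f5f62305cc;
  0x1f6f528cc01a5; 0x5f60f501acf6; 0x12357618b01f3; 0x4b2e8b0178f3;
  0x42f4f323e58b; 0x1428586f418c1; 0x542342c1bcf4; 0xc6c5f401b3f3;
  0x12357aacc01a5; 0x101b918c62e73; 0x1014b94c62e73; 0x1010250c62e73;
  0x10123cdc62e73; 0x1017d27c62e73; 0x101a574c62e73; 0x1c673812cdb82;
  0xa2012e85fcad; 0x101f610852ead; 0x1014b96852ead; 0x101021f852ead;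
  0x101b97a852ead; 0x10123ae852ead; 0x185ad9e9c01c6; 0x14285ad4c1880;
  0x1ad2e9a6028f5; 0xc92e2d60b6e6; 0xb901a56c7a93; 0x101c6906ca593;
  0x101d4d36ca593; 0x10102e06ca593; 0x1014b946ca593; 0xc96c0ef9a137;
  0x1b40e0d7e0259; 0x5f605401d87d; 0x1018572237d54; 0x1010299237d54;
  0x101577c237d54; 0x101c690237d54; 0x101f633237d54; 0x101f353237d54;
  0x5f012ed4b834; 0x10102e0d42e34; 0x101b9ebd42e34; 0x101a546d42e34;
  0x1014beed42e34; 0x101f633d42e34; 0x7d7e340143d4; 0xc92e9e7ef921;
  0x16d6e8026f6ed; 0x1f6edcfcc01a5; 0x10185866cf6ed; 0x101577c6cf6ed;
  0x101021f6cf6ed; 0x101d4bf6cf6ed; 0x1014bee6cf6ed; 0x6d01a226b00d;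
  0xa2a1c90d9126; 0xc9a1a2269a0d; 0x76ea6d8d3516; 0x12e8d6d7d16;
  0x16dea2ed481; 0x12e8b0781e1ea; 0x5701023de91f; 0x2016c1fe382;
  0x102ca575f71; 0x123768d0e4262; 0x12357610e4262; 0x4231c685629c;
  0xe62312387f0; 0x1232408ae57db; 0x12354c1ae57db; 0x1236768ae57db;
  0xc60123db3fae; 0x4c4223dbe5ae; 0x157db4c3d71ca; 0x57db4c23e442;
  0x6c82db434727; 0x57017ddbdf27; 0x89dbae022fb4; 0xc60102db3189;
  0x570102db7c89; 0x424cdb85a9dc; 0x1aedbdc502395; 0xa2016d85fcc0;
  0xf601856d33c0; 0x1014b4c856dc0; 0x1016c9d856dc0; 0x101d4bf856dc0;
  0x2301c6578345; 0x1017d9857c645; 0x101d4d357c645; 0x101a2fc57c645;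
  0x10102d557c645; 0x101a54657c645; 0xc6016d453f26; 0x23575867a0c7;
  0x1676db0e7c758; 0x12383da42fb92; 0x12383da8b0ed9; 0x16dc08467da83;
  0x123836db9da; 0x101f3f46d5f4f; 0x101a2fc6d5f4f; 0x101c6906d5f4f;
  0x1012e2d6d5f4f; 0x1016c826d5f4f; 0x10123246d5f4f; 0x10102506d5f4f;
  0xb8ce6d5fcb4f; 0xa2016d85efce; 0xf601856d9fce; 0x101c6c5856dce;
  0x10102d5856dce; 0x10123cd856dce; 0x6d6e0ece8a37; 0x854218ce9c37;
  0x85dcdbce11f9; 0x241425089f5; 0x4142f5027f50; 0xb9bac46ceb95;
  0x6c0157c995b6; 0x101f3156c2395; 0x1014b966c2395; 0x10e54dd6c2395;
  0x12395470e4262; 0x1239547cc01f6; 0x952342c547f4; 0x16157e926c40d;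
  0x1c47675610d26; 0x5761c423df76; 0x2ca2a1c63c73; 0x85a22c42c03c;
  0x7623f0c546f7; 0x762324c58de8; 0xf20e23ba3da0; 0x6cb9ba0e5cf2;
  0x76230eba8df2; 0x762324baea39; 0x5f0123d448a0; 0xb9baa0011dd4;
  0x1014b94d423a0; 0x1010259d423a0; 0x1018511d423a0; 0x101f69fd423a0;
  0x123a08f0e83b8; 0x123a08f8b01f3; 0xa02342ba8f4c; 0x12cc61c70c4ba;
  0x1baa00c70c42c; 0x6cb9ba2ccf70; 0x6076a235a71d; 0xbab91d76a035;
  0x176420535a21d; 0x17675f835a21d; 0x6076a2c949a1; 0x60547dc9497e;
  0x7623fb60ea49; 0x606e6dc9a726; 0x762324604608; 0xc9266df908ce;
  0xc97e7d6c0843; 0x1605fde54c9dd; 0xc9266d2edde1; 0x7d7ec95466dd;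
  0x1b88330cb5fd8; 0xc9a1a24e7e3e; 0x1605f97f5c93c; 0x2cc67d3c707e;
  0x13c7e34f52cc4; 0x6ccf8dc9ed4e; 0x17675f84e238b; 0xe23ccd96ec3;
  0xb47ec9c065b6; 0x850102c072b4; 0xe6e6db4f2c0; 0xb40e3d02f8ca;
  0xb47e7d19f843; 0x1b4654af80275; 0x767502eabad5; 0x414231027fd5;
  0x10e18a993b4ea; 0x193a5a60eeab4; 0x1b419da7e0259; 0x101d4afa2f63e;
  0x101a574a2f63e; 0x10185dca2f63e; 0x1010299a2f63e; 0x101573da2f63e;
  0x1aecc9b50b419; 0x1a546b9f340; 0xe74676677b5b; 0x76eab4235bae;
  0x1016c6ba2f37b; 0x1018511a2f37b; 0x1017dd0a2f37b; 0x1010250a2f37b;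
  0x101577ca2f37b; 0xa2012e7bfcd9; 0x1767597424618; 0x102755fa597;
  0x1b8cef9755f97; 0x757642025841; 0x17642054e2383; 0x5f0102b81399;
  0x2012399ab83; 0x422395924c38; 0x42232492f569; 0x1016d14d423fb;
  0x1010263d423fb; 0x101c63fd423fb; 0x101577cd423fb; 0x101a5a6d423fb;
  0x101a2fcd423fb; 0x5cdcdb6cb282; 0x142417f85b25c; 0x142765b85b25c;
  0x15f92a2f691; 0x854292a27291; 0x9291a25f38d8; 0x15f929e97b875;
  0x605f92ad6e9e; 0x4285ad92059e; 0x12ec9ca9e8d92; 0x42232431f4d1;
  0x16242f531d90c; 0x101a574237df0; 0x10102ab237df0; 0x101b97a237df0;
  0x10157b6237df0; 0x1012e2d237df0; 0x101a2ef237df0; 0x7dc6c5f04df7;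
  0x1ea76756d3152; 0x1c6316db952; 0x4285ce31e552; 0x1c631522cdb82;
  0x1c631a2f332; 0x854231a2dc32; 0x14231324c1880; 0x6d01c6eaf6b7;
  0x76c5c6ea35b7; 0x1c6dbe931b7ea; 0x1a2854d011db9; 0x1a2854d763e4e;
  0x4b673c2ed6c9; 0x673cc96d0926; 0x676df63cc7f5; 0x13cf528677ee7;
  0x83673c4ec2c9; 0x1b91817011da2; 0x10e181723b883; 0x101c6c5b94b64;
  0x101f633b94b64; 0x101d4d3b94b64; 0x10123aeb94b64; 0x1018586b94b64;
  0x101a574b94b64; 0x1010263b94b64; 0xba76a2c4840d; 0x1b9ba85a584;
  0x4b2eb10178f6; 0x157db1c01b1f6; 0x6d67e7e1b046; 0x7bd92e460ce1;
  0x18d92b276e146; 0xf5f6cc422805; 0x142417f0523cc; 0xf30185a51528;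
  0x101573d85a528; 0x101d45185a528; 0x101026385a528; 0x1017d2785a528;
  0x16d67e74ff6ac; 0x101b9baf65fac; 0x1018586f65fac; 0x1012ed9f65fac;
  0x101f315f65fac; 0x10123cdf65fac; 0x10102abf65fac; 0x8b2e4be55d4c;
  0x2e4b4c8b1ae5; 0x2342f454ccbc; 0x1546035bcc1f4; 0x1547d7ebcc1f4;
  0xf9dbc6f34eb3; 0x1015f60f3c6b3; 0x1014b94f3c6b3; 0x1018586f3c6b3;
  0x1016d14f3c6b3; 0x1016c6bf3c6b3; 0x10102b4f3c6b3; 0xe93a53df8aa;
  0xed92e18f273; 0x2e7318019ab9; 0x2e73184bbe17; 0x18732e46c1e1;
  0x50f542732a18; 0x2e010273be50; 0xc601237390cd; 0x735019278843;
  0x2e017d738d27; 0xa57473015ac6; 0xcc7473239bcd; 0x6076a2ad35fc;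
  0x60f5f6ad3510; 0x9e2eb1ad2110; 0x8501f6addc10; 0x12e8b8cadb110;
  0x1fadfc82d22c; 0x850102ad111f; 0x2e8182ad8d1f; 0xad1f822e9681;
  0xad28a52ed2e1; 0x12ead7a8b73cd; 0xad2e2d607ae6; 0x1fadae02bb50;
  0x50aeadf52a60; 0xccaeadf69b10; 0xadae2360d254; 0x5f929e01dec6;
  0x1017dd0c62e9e; 0x101f315c62e9e; 0x1014beec62e9e; 0x1016c9dc62e9e;
  0x2408608039ad; 0x2e7318adb180; 0xdbaead4ce980; 0xad7ab9809640;
  0x1600824f5c99a; 0x1605f48f5c99a; 0x423cc9f5a99a; 0x13c6768f5c99a;
  0x1c96c4760b6e6; 0x128a51bad937a; 0x10e937af8b875; 0x16c93d3951950;
  0x93ea6d0ed36e; 0x6c0102939de0; 0xeb40293d9e0; 0xa501029374e0;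
  0x6dea93675294; 0x10e939462b8cb; 0x1732e2da11837; 0x17350aea11837;
  0x11880247337a1; 0x11842417337a1; 0x201a259890d; 0x10d595ea2c42c;
  0x54605f7d0ad8; 0x12354720e4262; 0x60ad85540872; 0x547285c1a786;
  0x123424c548399; 0x1605499f5c99a; 0x10e6c6b54b899; 0x1547d200e99b8;
  0x7d0102542799; 0x7d015754667c; 0x10e1817549390; 0xc6c5f4909ebc;
  0x1238b8ccc5433; 0x12383dacc5433; 0x60f5f654e633; 0x5433f67c0ab1;
  0x7d01f654d033; 0x1cc330a9b2376; 0x123545395ae50; 0x123545342fb92;
  0x8b2354f30753; 0x7d54530120f3; 0xeb8342387fb; 0x1b834d7cb5fd8;
  0x2ed90e34beb8; 0xb8cef90ea393; 0x597e34025ee0; 0xd401023451e0;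
  0x34fb23b8eb83; 0x12e34ebadb110; 0xeb3446b9d718; 0xd401a534bf46;
  0x34e0027eeeb4; 0x1b83433755f97; 0xcc3334233afb; 0x3433cc46d79b;
  0x3433ccb8eecb; 0xd434330129f6; 0xc67d43019cd4; 0x1c960557ef921;
  0x1c96c6b7ef921; 0xed6c2c80cffc; 0x6ced80b99d40; 0xf601b9ed9f18;
  0x42f5f618e5ed; 0x180e0deda926; 0xb901a56cebcf; 0xf3016ca553cf;
  0x10157586ca5cf; 0x10102896ca5cf; 0x1017dd06ca5cf; 0x1a5cc3acfe18d;
  0x1188024edc186; 0x6c0157ed9d7c; 0x17c5758edc186; 0xed7c54f61f33;
  0x16c95c5ed821f; 0xedcfa5f6a4cc; 0x16c0e37ed43bf; 0x1fedee3dbbaa;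
  0x16cedee2c9390; 0x577cedaa12ee; 0x126c9ca6d0db0; 0x1a20db0d8017d;
  0x10e0db0549390; 0xf6f5c46d9fb0; 0x9291269e6945; 0x1c92e1a9a260d;
  0x60768d35a716; 0x1016c6b6d7d16; 0x1015f486d7d16; 0x10102e06d7d16;
  0x101c63f6d7d16; 0x101f3156d7d16; 0x7d5460169835; 0x6dea81018ad4;
  0x5f012ed44881; 0x1010265d42e81; 0x101a2efd42e81; 0x1015758d42e81;
  0x134330ad42e81; 0xd481ea438f19; 0xd48173430f27; 0x12e810f8b01f3;
  0x12e810f9e8d92; 0x12e810fadb110; 0x2376ea8bf007; 0xea81d49307d3;
  0x14ec9088b3e07; 0x1021f575fe9; 0x1826c6b1fdbe9; 0x6c01028247e3;
  0x89db82022fe3; 0x23015f578371; 0x101f3f4575f71; 0x101d4bf575f71;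
  0x101f610575f71; 0x1017dd0575f71; 0x1018572575f71; 0xa5930ecf5a62;
  0x142769b85629c; 0x7d540ef0d087; 0xdb4c4b5708aa; 0x1c1dbdc54f4bc;
  0xdbaeadc6689e; 0x572367dbdf68; 0x939467f97a68; 0x85adae9c843f;
  0x1429291e523ae; 0x4b4ccaaafa3d; 0x60c9ca7655ba; 0x1ca63f13dbaf2;
  0x123ccc35742e4; 0x12367095742e4; 0x1238b365742e4; 0x12354535742e4;
  0x1016c6b8557e4; 0x101f69f8557e4; 0x1017d7e8557e4; 0x1014b968557e4;
  0x101d4d38557e4; 0x10102e38557e4; 0x27735043df19; 0x1b465222f0289;
  0x85dcdbc04d2f; 0xb657dbc0612f; 0x1c6737431db89; 0x99028954d57c;
  0x1c118177cdb89; 0x2395dc42fba9; 0x952324c5dce8; 0x16c9394955cdc;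
  0x50aedb952adc; 0xb4aeadc065fc; 0xb4c033ae2fcc; 0x1f63e076d33c0;
  0x14c4beec0ba84; 0x6d016cc0149d; 0x266dc0ed59bf; 0x1230ef2835745;
  0x15745c27cdbc1; 0x57017d453d98; 0x9e45462e38e1; 0x14645124018b9;
  0x145464026c63f; 0x503f26028859; 0x123547267a0c7; 0x12383da67a0c7;
  0x123248067a0c7; 0xfb23839249da; 0x8384c04599fc; 0x838485b8c25c;
  0x5f92da01deb9; 0x1c14f8a7cdb89; 0x605f4f54e690; 0x1f442414fbc90;
  0x14f5f13f490bc; 0x4f90c6f48ac5; 0x5f60e64f972d; 0x14f8281f490bc;
  0x14f2469f490bc; 0x6723246d094f; 0x4ff4f36d3961; 0x4f50028224e3;
  0x2423cc4f40cb; 0x4f5073c1cb27; 0x4fcbccf48a05; 0x6d67e7ce14ef;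
  0x16d4f2dceead5; 0x854231ce72d5; 0x1d5eab7ce99b8; 0xcdce37730ba1;
  0x83b8ce23e2cd; 0xe6e6d373d8a; 0x26c9a16ddd8a; 0x1854241ce11f9;
  0xc6dbf99cb711; 0x13718179cf911; 0x8960c9dbabf9; 0xad1f02609689;
  0x2a507f026a41; 0x1fb92919534eb; 0x9550027feb41; 0x195ebd7b6c461;
  0x4557b69e1238; 0x1c9b638f9a137; 0x123fb498b9515; 0x12354728b9515;
  0x95dcdb6c1582; 0x1239596670ee7; 0x16c9596ed43bf; 0x1fb95ddd423a0;
  0x6d6162f61447; 0xf6017d479f27; 0x1012ebe6cf647; 0x1015f486cf647;
  0x230e0d57cde9; 0x3faeb4759cf8; 0x1230e6e7657df; 0x1238b8c7657df;
  0x14241e076e4df; 0x73a1a22706df; 0x101a5a6a257df; 0x101d4bfa257df;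
  0x1012e2da257df; 0x12e810f73c93c; 0x12eb13b73c93c; 0x13c7388f52cc4;
  0x14231323c23cd; 0x1c93ccd7e2659; 0x13cc02f677ee7; 0x176a2a1c546f7;
  0x176ba70c546f7; 0x17675f8c546f7; 0x146a5a676f7c5; 0x176ba848dc5e8;
  0x16c0bf7de843; 0x13da0705782db; 0x3da0f00e8287; 0x1b8cb030e5cf2;
  0x17660a78dbaf2; 0x19504fea4339; 0xea762339b724; 0x932885f93911;
  0x930e2339e024; 0x23015fa0ae48; 0x95fbd4eb7f1d; 0x123f0f767a094;
  0x4b94a067b5c7; 0xd48173a0af94; 0x944b4ca006ba; 0xa094931148f9;
  0x4223a085b211; 0xcc23a0f63a9f; 0x15f6055d4b88f; 0x15f4f90d4b88f;
  0xb80e0d758f26; 0x8323a0b8c28f; 0xf38fa07bb30c; 0x10102e3d4f38f;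
  0x101a574d4f38f; 0xd48f7ba0bf0c; 0x1a0d4298fba4c; 0xd4bfed8f5180;
  0x18f807f7ba00c; 0xbacac9761c4e; 0x14c4b96badb1c; 0x14c4241badb1c;
  0xed6c2ccf8670; 0x11db9bd35a760; 0x16054c135a71d; 0xd45f601d81a7;
  0x12357aa76a035; 0x1238b3676a035; 0xa276751d32f8; 0x1605f1349c9a1;
  0xa1a28537499c; 0x17e7d6649c9a1; 0x1b4654a7eea49; 0xea49a16d5b8a;
  0x1c93ccd6026a7; 0x3408602ed7ad; 0x244f6d0869ce; 0x60c9f90855ce;
  0x1c92e1a08f9ce; 0x1ceb8a308f9db; 0x60c96c085543; 0x1821fa46c0843;
  0x1c9ddde7ef921; 0xcbb883d80330; 0x1c9b6387e4e3e; 0x1ea3e216d3152;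
  0x93ea3ef9d321; 0x2e8dcf34be70; 0x1fbd4519534c4; 0x347e3cc4a3f5;
  0x134c4c3d42e81; 0x4b4cbaee79c4; 0x764eedc45bee; 0x8345264e30ed;
  0x12367098b0ef8; 0xf80ee7755d58; 0x10ef85de7d97b; 0x10ef85d6c2395;
  0x16e60550ec3d9; 0x1b4022ac065b6; 0x955002b6c565; 0x65b6c90222ca;
  0x570102b61265; 0x14c4b79c0baf2; 0x1f2330ac0ba4c; 0x1f2330a5cc09d;
  0x1db9baf8efca; 0x63caf802f175; 0x63caf80256b4; 0x1b4654a19f843;
  0x7576a2264a91; 0x7576c4264a61; 0x176754a9b23cc; 0x176754aa2c42c;
  0x973c9d5f4a5c; 0x59a0ba025ed5; 0x1d5ceef7f0250; 0xce6d67f97f68;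
  0x6231ea4203a9; 0xb4eaa90e6518; 0x1eab4a66d3152; 0x13c7ea6f5c99a;
  0x7d7ea60166a5; 0x1a22c3c1d3eaf; 0x1a20db01d3eaf; 0xea81d43ed5af;
  0x3eea3147af62; 0x1764eaf8dc5e8; 0xb1f63e573b3d; 0x13e3daadceaa9;
  0x1943086c9b82; 0x19b4c06c9b9d; 0x1018572b9f340; 0x10102abb9f340;
  0x8b2324f33640; 0x1a2df27767b5b; 0x1464598767b5b; 0x16783e25b23ae;
  0x1aeadd25b2367; 0xd9629c7bc311; 0x1a20d9ad87bd0; 0x1765bd0eaba39;
  0xb17c7b2e1ed9; 0x2ed97bb11a7c; 0x459e2efc98d9; 0x1d98b8c0cfc2c;
  0x1017d985fa597; 0xa5a67e971b3c; 0x1c1540a97dbf9; 0x6768f93cc797;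
  0x13c7388977e21; 0x1b96c6bda1d05; 0x990289d51331; 0x102995fa513;
  0x102991350b4ae; 0x75b883024aab; 0x45d50283d3ab; 0x83da924eab8d;
  0x14c4bb538c0b6; 0x14285864c9238; 0x1c0b419b64c38; 0xf53cc089692f;
  0x1421817f59269; 0x1238b3667fb14; 0x12354c167fb14; 0x230102fbcd63;
  0xfb2376346346; 0x955002fbdc63; 0xfb956cd4f143; 0x1238b8caefb3f;
  0xfb3fc64963b7; 0xb834fb75a33f; 0x63fb7c02f189; 0xfb342e7cf1b1;
  0xfb232492a669; 0x134d4297efba6; 0x1fcfbf1a2cbd8; 0xdb4c428268b2;
  0x23244f42f0b2; 0x62cb4f4203b2; 0xb6c0f295e67f; 0x16d4f2d26f691;
  0xb17c7bf63b91; 0xd80dc4383095; 0x19242e5385fd8; 0x19ef85dc62e73;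
  0x2ed9da9ebe05; 0x1423c9d31f4d1; 0x142858431f4d1; 0x142929131f4d1;
  0x13ccd0bf52c0c; 0x8bd90c2e369a; 0x1236709ccf074; 0xd87df038d0b6;
  0x15745c2b623f0; 0x1956c6bb6c5f7; 0x7d012ef0202d; 0xf81db9755d52;
  0x101d4516db952; 0x13d578e820c52; 0x14c4bb5e5db82; 0x1015f48a2f332;
  0x101a51ba2f332; 0x8032312404d1; 0x73b7f62e88b1; 0x16d6768eaf6b7;
  0x101f353c6f6b7; 0x1eab42f76b735; 0x1fe9ea02a4d5; 0x1eae9bb5b6d67;
  0x57e9ea7c8e49; 0x4218b985a94d; 0x834e4d45e298; 0xc92e9e60d66e;
  0xc93c677ed6e7; 0x1cac9d6ba02d5; 0x12e8b8c4bc9d6; 0x1b91d35646cd6;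
  0x101d4516c4bd6; 0x10185116c4bd6; 0x266162ed09cf; 0x1674b256d0926;
  0x1674bec3cc7f5; 0xa501a2285aef; 0x9e2ec945adc2; 0x149a1c27efba6;
  0x1a21725d8015f; 0x1a217257bfcd9; 0x1a217251d3eaf; 0xa21783d83230;
  0x64b952c52bce; 0x64c5954b2b96; 0x4b96956425c5; 0x33cccbc044fc;
  0x1343344d40843; 0x64d3934b4494; 0x4b949364b5d3; 0x64b952aed3e5;
  0xb9ba7664bd5b; 0x186642bedc17c; 0x4beeed64fa86; 0x1644bec33c154;
  0x4b171864b5c1; 0x6474a54b2baa; 0xb97af064bd74; 0x173742b3cc62c;
  0x163642bcafb92; 0x16463f15b4b67; 0xd8483d8b030; 0xf30185a55384;
  0x101022a85a584; 0x184a55ac0ba4c; 0x13ccd0b97c084; 0x16df678ce8a37;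
  0x6433f64b4478; 0x4b94a078799f; 0x6d01c6f6141c; 0x101d451f6c61c;
  0x1017dd0f6c61c; 0x101a51bf6c61c; 0x16df6b14fb0b2; 0x12357aacc957f;
  0x1d57f3aeaba39; 0x13d5712280cf5; 0x283df2856f5c; 0x28ad2e156f8b;
  0x33347ef644ac; 0x17e7d66ac70ba; 0x5f01f3ac1315; 0xabacba02a8ca;
  0xabace783a867; 0x1acaba8ba15c4; 0x1424c5d31f4d1; 0xe5824f421af4;
  0x4b4ce52e941a; 0x12e2de68b1ae5; 0x1aee51a50b419; 0x133c0bfcc54bc;
  0x13594061df405; 0xb38685c6e69c; 0x1b394064e86ed; 0x186642bedb34e;
  0x6049fbb35514; 0x183991367b314; 0x65b4b3b622e6; 0x1ca636f3df8aa;
  0x733c9df2065c; 0x12eb13b9a4b64; 0x1c1644454e1dd; 0x11817e2c146e1;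
  0x2a504f186ac1; 0x1fed1802a42a; 0x1182ac84246b2; 0x503f2695bedd;
  0x1238b3654cd90; 0x1c645127390cd; 0x1d443881da035; 0x1df578e27768d;
  0x1012324c6a55a; 0x101b9ebc6a55a; 0x1016d6ec6a55a; 0x1010259c6a55a;
  0x1f38b8cb3a55a; 0x1a5cc3a5af3b3; 0x8d16102ee8b1; 0x7d01f6166610;
  0x1035a0f68c9f; 0x85a22cad4dd2; 0x13d57121fa011; 0x1fad108dbb16;
  0x1f3d0e8dbb62; 0x18d1fa44e2e8b; 0x1f924202d241; 0x1921fbb385fd8;
  0xe1a5f36dd261; 0x12e7306ade1d2; 0x10c31d12ce1d2; 0xcdce857a0b4d;
  0x14f50bbf490bc; 0x50aedbbbbee9; 0x7b91f6f3bb78; 0x2a605402c899;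
  0xc6b3b4dbde2f; 0xeae1dd3107de; 0x75765b9ee3d0; 0x12eb13b8b9e15;
  0xb12e9e803b6e; 0xb17c7b803b8f; 0x1964b79394024; 0x12e8b8c819aa9;
  0xe6476cb32d6b; 0xcdacf67a0b47; 0xad28a57afc1b; 0x176751b4246b2;
  0x575875aa8e1b; 0x1d3d429506e2a; 0x75763552e394; 0x94cbd8a00648;
  0x1a023cc59705e; 0x1a09f7859705e; 0x17e7d4d59705e; 0x17ee7e859705e;
  0x50f59a028899; 0x999a64026b63; 0xe77e7db85820; 0x199b820d2021f;
  0xb875763420c4; 0xb8993e5c20dc; 0xb834e05c209d; 0x870e546e04bc;
  0x1da334459b00d; 0x123670976540a; 0x164636fc5330a; 0x4b4cca782553;
  0x53547df30720; 0x1b834d78320b3; 0xb834fb0ea387; 0xd4d36efbaf87;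
  0x1a2d8d785dfe4; 0x8bf8752e36be; 0x1beb11e50753f; 0x46a59334e1a3;
  0x1b883300ea393; 0x19093a34fbcf4; 0x201d4e06551; 0x34e002eb1aab;
  0x110b11e35eb1d; 0x2a18d746c834; 0xeb834183dd7; 0x180e8780d704;
  0x1b465227eee21; 0x4b4cc0ee79b4; 0x134d42908ee72; 0x1235758ccfb3a;
  0x1230e0dccfb3a; 0xfb3fc6923ade; 0x1181725d7469b; 0xf6accd47297a;
  0x1015758d4f629; 0x1017d98d4f629; 0x1fccb032ccf70; 0xb952ce18bd9f;
  0xb18018f61e9f; 0xed26dd7ce566; 0x14e4d988bede5; 0x1182ac8ed42e5;
  0x1ca636f53ba70; 0x57016c7c8e9d; 0x1fc5c692a4de; 0x1f66d67cceda4;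
  0x13334a3cc1fa4; 0x15745c2e9aabb; 0x1ee4bfac490b0; 0x101a51b6dd48a;
  0x812ec9650fb6; 0x816502ea0fd5; 0x18281226cb25c; 0x158578e81e7ef;
  0x1c56444ce0aef; 0x272885c10f86; 0x810ff3962278; 0x1502a6a53d307;
  0x1644b79b9077a; 0x189aba82f02e3; 0x15f6049d87130; 0x17d4388f0d087;
  0x24235708d1aa; 0x172718e91b4ae; 0x1a03dfaf00c31; 0x10e3dfa6e182a;
  0x10e3dfa6cb419; 0x10e3dfa3793f9; 0x173e3d4bbefa; 0x10ef2f16ed9c3;
  0x5723cce48ec3; 0xe442a98509dc; 0xe442b285365c; 0xe47e7d85c34d;
  0x4b96e4677909; 0xea318981e122; 0x1897c66220265; 0x17271304db42f;
  0x1b46522722f4d; 0x10d742bd89a48; 0x17cb11ed58931; 0x2a504f946acb;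
  0x2a189f946aa0; 0x1942ac867a0c7; 0x63fbfc026f65; 0x1ee4bec842155;
  0x16783e23c149d; 0x164b9129ac5e8; 0x1cb12bd4f5282; 0x15712bd6101f3;
  0xc7cfd067045b; 0x1cfc704ed8d4e; 0x17a2a1902541; 0x125758eebd41;
  0x2324a1cdfb0b; 0x1f2a10b0ed36e; 0x731817cd88e2; 0xabf02df9a837;
  0x1f9416a37119c; 0x142416af59269; 0x1ebaba8911da7; 0x1ee4bec4134eb;
  0x10dc2a41b16a; 0x2849a1156fe3; 0x4b01d496ecbf; 0x4b94a096b559;
  0xa0f087c7dd04; 0x17ab9bd4775be; 0x5019df733f06; 0xb13b3c2e1ec9;
  0x1c03c3b852f4d; 0x10e870462f203; 0xf2a760ba0355; 0x128c7b585efa2;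
  0xc74816cfb58d; 0x1942ac835af1d; 0x4b4cba94ec06; 0x127286f8d9f3a;
  0x8018173251e2; 0x1646356b9c11d; 0x164635674c555; 0x1ce1a7785ef28;
  0x1ce1a77856dc0; 0x8345f230e203; 0x10dc479e9d85f; 0x186585de0705e;
  0x2a5088b6c861; 0x57df6eb68e2a; 0xfba6b4638756; 0x1b3b4560cc62c;
  0xb4a6a5ea56e1; 0xb4c04cae56e5; 0xb4b3830256ab; 0x1fcd91e4f2c90;
  0x7b7cb1d95b1e; 0x1acaba8f61eb1; 0x1fb7c77a6a99a; 0x1fb7c779534eb;
  0x7c8917547790; 0x4b673caaec1b; 0x19bb5ec2f82e3; 0x5319b4b77856;
  0x1ce1a7755d5a4; 0x1a5f37866840b; 0x1ce1a77379f78; 0x1182ac8379f78;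
  0xf0efcaab07a8; 0x1a0d68f77703]%num.

(** * Deduction of the lifts of edges *)

Definition knows (k : PM.t (PM.t unit)) (b c : positive) : bool :=
  if PM.find b k is Some n then if PM.find c n is Some _ then true else false else false.
Definition learn (k : PM.t (PM.t unit)) (b c : positive) :=
  PM.add b (PM.add c tt (if PM.find b k is Some n then n else PM.empty _)) k.
Definition learn2 k b c := learn (learn k b c) c b.

Definition shift_additive (b c d : positive) : bool := eq3 (shift b d) (add3 (shift b c) (shift c d)).

(** Two known edges of a line determine its third edge, so a new edge b c also yields the last edge
    of its line as soon as one of the other two is known. *)
Definition infer k (b c : positive) :=
  let k' := learn2 k b c in
  if link b c is Some (_, Some d) then
    if knows k b d && shift_additive b c d then learn2 k' c d
    else if knows k c d && shift_additive b c d then learn2 k' b d else k'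
  else k'.

Definition edge (b c : positive) k := linked b c && knows k b c.

(** The three displacements are pairwise different, so they exhaust Z/3. The last group of tests
    guarantees that lifts with common ends would form a pentagon for walk 1 with walk 2 or 3, and a
    quadrangle for walks 2 and 3, both impossible in N. *)
Definition deducible (k : PM.t (PM.t unit)) (first : bool) (b v e s t c : positive) : bool :=
  let w1 := add3 (add3 (shift b v) (shift v e)) (shift e c) in
  let w2 := add3 (shift b s) (shift s c) in
  let w3 := add3 (shift b t) (shift t c) in
  [&& edge b v k, edge v e k, edge b s k, edge s c k & edge b t k] &&
  (if first then edge t c k && linked e c else edge e c k && linked t c) &&
  [&& ~~ eq3 w1 w2, ~~ eq3 w1 w3 & ~~ eq3 w2 w3] &&
  [&& ~~ Pos.eqb s t, ~~ linked b c, ~~ linked b e, ~~ Pos.eqb b c, ~~ Pos.eqb b e,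
      ~~ eqn (foot b) (foot e) & (if link e c is Some (_, Some d) then ~~ linked b d else true)].

(** A number that fails the test is skipped, so soundness requires nothing of [deductions]; that
    they reach every edge is [all_deduced]. *)
Definition infer_step k (n : N) :=
  if digits 256 7 n is [:: x; Npos b; Npos v; Npos e; Npos s; Npos t; Npos c] then
    let first := if x is N0 then false else true in
    if deducible k first b v e s t c then
      if first then infer k e c else infer k t c
    else k
  else k.

(** The closed walk 1 35 14 108 1 has 14 108 as its only edge outside the tree, so that this edge
    carries the holonomy that [oriented_fibre] normalises. *)
Definition initial := infer (foldl (fun k bc => infer k bc.1 bc.2) (PM.empty _) tree) 14 108.

(** The shift [Z0] on tree edges matches labels that are transported from the root; requiring c to
    be new lets each fibre be labelled once. *)
Fixpoint rooted (seen : seq positive) (l : seq (positive * positive)) : bool :=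
  if l is (b, c) :: l' then
    [&& b \in seen, c \notin seen, b \in types, linked b c, eq3 (shift b c) Z0 &
        rooted (c :: seen) l']
  else all (fun b => b \in seen) types.

Lemma tree_rooted : rooted [:: 1%positive] tree.
Proof. vm_cast_no_check (erefl true). Qed.

Lemma special_link : exists s, link 13 116 = Some (s, Some 137%positive).
Proof. by eexists; vm_compute; reflexivity. Qed.

Lemma special_walks : let b := 1%positive in
  all (fun vc => [&& linked b vc.1, linked vc.1 vc.2, ~~ linked b vc.2, ~~ Pos.eqb b vc.2,
      ~~ eqn (foot b) (foot vc.2) &
      all (fun w => if linked w vc.2 then Pos.eqb w vc.1 else true) (nbrs b)])
    [:: (162, 13); (165, 116); (2, 137)]%positive.
Proof. vm_cast_no_check (erefl true). Qed.

Lemma all_deduced : let k := foldl infer_step initial deductions in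
  all (fun b => all (knows k b) (nbrs b)) types.
Proof. vm_cast_no_check (erefl true). Qed.

(** Only these shapes occur: triples list rational indices first, and a point on two rational lines
    is itself rational, so that all its lines are. *)
Definition block_ok (t : index * index * index) : bool :=
  match t with
  | (Rat p, Rat q, Rat r) => has (fun t => on2 p t && on2 q t && on2 r t) hlines && [&& ~~ eqn p q, ~~ eqn p r & ~~ eqn q r]
  | (Rat p, Irr b i, Irr c j) =>
    [&& eqn p (foot b), Pos.eqb c (mate b) & eq3 j (add3 i (shift b c))]
  | (Irr b i, Irr c j, Irr d k) =>
    [&& (if link b c is Some (_, Some d') then Pos.eqb d d' else false),
      eq3 j (add3 i (shift b c)) & eq3 k (add3 i (shift b d))]
  | _ => false
  end.

Lemma blocks_ok : all (fun st => block_ok st.2) blocks.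
Proof. vm_cast_no_check (erefl true). Qed.

Lemma blocks_complete : all (fun b => all (fun i =>
    let ts := pmap lookup (span_points (basis8 (Irr b i))) in
    all (fun c => has (fun t => on_b (Irr b i) t && on_b (Irr c (add3 i (shift b c))) t) ts)
      (nbrs b)) elts3) types.
Proof. vm_cast_no_check (erefl true). Qed.

Lemma blocks_complete_rational : all (fun t => let: (p, q, r) := t in
    has (fun t => [&& on_b (Rat p) t, on_b (Rat q) t & on_b (Rat r) t])
      (pmap lookup (span_points (basis8 (Rat p))))) hlines.
Proof. vm_cast_no_check (erefl true). Qed.

(** * The points outside the subhexagon *)

Lemma all_all_in (S T : eqType) (P : S -> pred T) s t :
  all (fun p => all (P p) t) s -> {in s & t, forall p q, P p q}.
Proof. by move=> /allP h p q /h/allP; apply. Qed.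

Lemma all_in_dep (S T : eqType) (P : S -> pred T) (t : S -> seq T) s p q :
  all (fun p => all (P p) (t p)) s -> p \in s -> q \in t p -> P p q.
Proof. by move=> /allP h /h/allP; apply. Qed.

Lemma in_iota63 p : p < 63 -> p \in iota 0 63.
Proof. by rewrite mem_iota. Qed.

Lemma hdistP p q : p < 63 -> q < 63 ->
  [/\ (hdist p q == 0) = (p == q),
      (hdist p q == 1) = (p != q) && has (fun t => on2 p t && on2 q t) hlines,
      (forall k, hdist p q = k.+1 -> exists2 r, r < 63 & hdist p r = 1 /\ hdist r q = k),
      (hdist p q = 1 -> forall r, r < 63 -> hdist p r <= (hdist q r).+1) &
      (hdist p q = 2 -> forall r s, r < 63 -> s < 63 ->
         hdist p r = 1 -> hdist r q = 1 -> hdist p s = 1 -> hdist s q = 1 -> r = s)].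
Proof.
move=> p63 q63.
have /and5P[/eqP e0 /eqP e1 _ e3 /andP[e4 e5]] :=
  all_all_in hdist_spec (in_iota63 p63) (in_iota63 q63).
split=> // [k E | E r r63 | E r s r63 s63 pr rq ps sq].
- move: e3; rewrite E => /hasP[r]; rewrite mem_iota => r63 /andP[/eqnP pr /eqnP rq].
  by exists r.
- by move: e4; rewrite E [eqn 1 1]/= => /allP/(_ r (in_iota63 r63)).
- move: e5; rewrite E [eqn 2 2]/=.
  set l := filter _ _; have rl : r \in l by rewrite mem_filter pr rq in_iota63.
  have sl : s \in l by rewrite mem_filter ps sq in_iota63.
  by case: l rl sl => [|a [|//]]; rewrite // !inE => /eqP -> /eqP ->.
Qed.

Lemma on2P p t : reflect (on p t) (on2 p t).
Proof. by apply: (iffP or3P) => -[/eqnP|/eqnP|/eqnP]; constructor. Qed.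

Lemma hline_spec t : t \in hlines -> [/\ t.1.1 < 63, t.1.2 < 63, t.2 < 63, t.1.1 <> t.1.2 &
  t.1.1 <> t.2 /\ t.1.2 <> t.2].
Proof.
have ht : all (fun t => [&& t.1.1 < 63, t.1.2 < 63, t.2 < 63, ~~ eqn t.1.1 t.1.2,
  ~~ eqn t.1.1 t.2 & ~~ eqn t.1.2 t.2]) hlines by vm_compute.
by move/(allP ht)/and5P=> [? ? ? /eqnP ? /andP[/eqnP ? /eqnP ?]].
Qed.

Section Extension.
Variables (N : geometry) (hN : near_hexagon N) (h3 : three_points_per_line N).
Variable hp : nat -> point N.
Implicit Types (x y z w : point N) (b c e : positive) (p q r : nat).
Local Notation d := (dist hN).
Local Notation line3 := (@line3 N).
Hypothesis hp_dist : forall p q, p < 63 -> q < 63 -> d (hp p) (hp q) = hdist p q.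
Hypothesis hp_line : forall t, t \in hlines -> line3 (hp t.1.1) (hp t.1.2) (hp t.2).

Lemma hline3 p q r t : t \in hlines -> on p t -> on q t -> on r t ->
  p <> q -> p <> r -> q <> r -> line3 (hp p) (hp q) (hp r).
Proof.
case: t => -[a b] c /hp_line /= h.
have h1 := line3C h; have h2 := line3R h; have h3' := line3R h1.
have h4 := line3R h2; have h5 := line3R h3'.
by case=> /= ->; case=> /= ->; case=> /= ->.
Qed.

Definition outside x : Prop := forall p, p < 63 -> x <> hp p.

Lemma outside_or x : outside x \/ exists2 p, p < 63 & x = hp p.
Proof.
have [h | h] := excluded_middle_informative (exists2 p, p < 63 & x = hp p); [by right|].
by left=> p p63 xp; apply: h; exists p.
Qed.

Lemma collinear_hp p q : p < 63 -> q < 63 -> d (hp p) (hp q) = 1 ->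
  exists2 r, r < 63 & line3 (hp p) (hp q) (hp r).
Proof.
move=> p63 q63; rewrite hp_dist // => pq.
have [_ e1 _ _ _] := hdistP p63 q63; move: e1; rewrite pq eqxx.
case/esym/andP => npq /hasP[t th /andP[/on2P pt /on2P qt]].
have [r [r63 npr nqr] rt] : exists2 r, [/\ r < 63, p <> r & q <> r] & on r t.
  have [a63 b63 c63 ab [ac bc]] := hline_spec th.
  case: t {th} pt qt a63 b63 c63 ab ac bc => -[a b] c /= pt qt a63 b63 c63 ab ac bc.
  case: pt npq => /= ->; case: qt => /= ->; rewrite ?eqxx // => _.
  - by exists c; constructor.
  - by exists b; constructor=> //; exact: nesym.
  - by exists c; constructor.
  - by exists a; constructor=> //; exact: nesym.
  - by exists b; constructor=> //; exact: nesym.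
  - by exists a; constructor=> //; exact: nesym.
by exists r => //; apply: hline3 th pt qt rt _ npr nqr; apply/eqP.
Qed.

(** Two points of H on the line would be collinear in H, and the third point x of the line would
    belong to H as well. *)
Lemma outside_line x y p : outside x -> p < 63 -> line3 x (hp p) y -> outside y.
Proof.
move=> ox p63 h q q63 yq; rewrite {}yq in h.
have pq : d (hp p) (hp q) = 1 by exact: (line3_dist _ (line3R h)).
have [r r63 hr] := collinear_hp p63 q63 pq.
exact: (ox r r63) (line3_fun hN (line3R h) hr).
Qed.

(** * Every outer point induces one of the listed valuations *)

Definition profile x : seq nat := mkseq (fun p => d x (hp p)) 63.

Lemma nth_profile x p : p < 63 -> nth 0 (profile x) p = d x (hp p).
Proof. by move=> p63; rewrite nth_mkseq. Qed.

Lemma thirdE (i j k : nat) : near_rule i j k -> third i j = Some k.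
Proof.
rewrite /third eqnE; case=> -[-> ->].
- by rewrite ltn_eqF // ltn_eqF ?eqxx // ltnS leqnSn.
- by rewrite gtn_eqF // eqxx.
- by rewrite eqxx.
Qed.

Lemma third_rowE (f g h : nat -> nat) s :
  {in s, forall p, near_rule (f p) (g p) (h p)} ->
  third_row [seq f p | p <- s] [seq g p | p <- s] = Some [seq h p | p <- s].
Proof.
elim: s => //= p s IH H; rewrite (thirdE (H p (mem_head _ _))) IH // => q qs.
by apply: H; rewrite inE qs orbT.
Qed.

Lemma profile_line x y z : line3 x y z ->
  third_row (profile x) (profile y) = Some (profile z).
Proof.
move=> h; apply: third_rowE => p _; have := line3_near hN (hp p) h.
by rewrite !(distC hN (hp p)).
Qed.

Lemma profile_hp p : p < 63 -> profile (hp p) = hrow p.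
Proof.
move=> p63; have sz : size (hrow p) = 63.
  by apply/eqP; apply: (allP (_ : all (fun p => size (hrow p) == 63) (iota 0 63))) (in_iota63 p63).
rewrite -[RHS](mkseq_nth 0) sz; apply/eq_in_map => q; rewrite mem_iota => q63.
by rewrite hp_dist.
Qed.

Lemma profile_valuation x : valuation (profile x).
Proof.
apply/allP => t th; have [a63 b63 c63 _ _] := hline_spec th.
by rewrite !nth_profile // /third_is (thirdE (line3_near hN x (hp_line th))) eqnE eqxx.
Qed.

Lemma outside_bounds x : outside x -> all (fun a => (0 < a) && (a < 4)) (profile x).
Proof.
move=> ox; apply/allP => a /mapP[p]; rewrite mem_iota => p63 ->.
rewrite ltnS dist3 andbT lt0n; apply/eqP => /dist0; exact: ox.
Qed.

Lemma profile_admissible x : outside x -> admissible (profile x).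
Proof.
move=> ox; apply/allP => p; rewrite mem_iota => p63; rewrite nth_profile //.
case: eqnP => // xp; have [y h] := dist1_line3 h3 xp.
have oy := outside_line ox p63 h.
by rewrite -profile_hp // (profile_line h) profile_valuation outside_bounds.
Qed.

(** The prefix is stored in reverse, so offset i at stage k refers to the point [k - i.+1]. This
    ties the precomputed constraints to actual lines of H. *)
Lemma search_stepsP : all (fun k => let st := nth ([::], [::]) search_steps k in
  all (fun ij : nat * nat => [&& ij.1 < k, ij.2 < k, ij.1 != ij.2 &
    has (fun t => [&& on2 (k - ij.1.+1) t, on2 (k - ij.2.+1) t & on2 k t]) hlines]) st.1 &&
  all (fun i => (i < k) && (hdist (k - i.+1) k == 1)) st.2) (iota 0 63) &&
  (size search_steps == 63).
Proof. vm_cast_no_check (erefl true). Qed.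

Lemma searchS P pre st steps : search P pre (st :: steps) ->
  forall a, a \in [:: 1; 2; 3] -> consistent pre st a -> search P (a :: pre) steps.
Proof. by move=> /allP h a /h; case: ifP. Qed.

(** The branch that follows the distances from x is never pruned, because every constraint holds for
    them; at its end the search asserts [P] of the profile. *)
Lemma search_profile P x k : outside x -> k <= 63 ->
  search P (rev (take k (profile x))) (drop k search_steps) -> P (profile x).
Proof.
have /andP[/allP steps /eqP sz] := search_stepsP.
have szp : size (profile x) = 63 by rewrite size_mkseq.
move=> ox; have [n kn] := ubnP (63 - k); elim: n k kn => // n IH k kn k63.
have [k63' | k63'] := ltnP k 63; last first.
  have -> : k = 63 by apply/eqP; rewrite eqn_leq k63.
  by rewrite -{1}szp take_size -{1}sz drop_size /= revK.
rewrite (drop_nth ([::], [::])) ?sz // => /searchS/(_ (d x (hp k))) H.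
have := allP (outside_bounds ox) (d x (hp k)).
rewrite (map_f (fun p => d x (hp p)) (in_iota63 k63')) => /(_ isT) bnd.
apply: (IH k.+1) => //; first by lia.
rewrite (take_nth 0) ?szp // rev_rcons nth_profile //.
have /andP[/allP s1 /allP s2] := steps k (in_iota63 k63').
have nthr i : i < k -> nth 0 (rev (take k (profile x))) i = d x (hp (k - i.+1)).
  move=> ik; rewrite nth_rev size_takel ?szp // ?nth_take ?nth_profile //; lia.
apply: H; first by rewrite !inE; move: (d _ _) bnd; case=> [|[|[|[|]]]].
apply/andP; split; apply/allP.
  move=> [i j] /s1 /and4P[ik jk ij /hasP[t th /and3P[/on2P ti /on2P tj /on2P tk]]].
  rewrite /= in ik jk ij ti tj; have {}ij := elimN eqP ij.
  have [n1 n2 n3] : [/\ k - i.+1 <> k - j.+1, k - i.+1 <> k & k - j.+1 <> k].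
    by split; lia.
  rewrite !nthr // /third_is (thirdE (line3_near hN x (hline3 th ti tj tk n1 n2 n3))).
  by rewrite eqnE.
move=> i /s2/andP[ik /eqP hi]; rewrite nthr // /close.
have {}hi : d (hp (k - i.+1)) (hp k) = 1 by rewrite hp_dist //; lia.
have h1 := dist_triangle hN x (hp k) (hp (k - i.+1)).
have h2 := dist_triangle hN x (hp (k - i.+1)) (hp k).
by rewrite (distC hN (hp k)) in h1; lia.
Qed.

Lemma eqrowP f g : reflect (f = g) (eqrow f g).
Proof.
elim: f g => [|a f IH] [|a' g] /=; try by constructor.
by apply: (iffP andP) => [[/eqnP -> /IH ->] // | [<- <-]]; rewrite eqnE eqxx; split=> //; apply/(IH f).
Qed.

Definition over b x : Prop := b \in types /\ profile x = row b.

Lemma over_ex x : outside x -> exists b, over b x.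
Proof.
move=> ox; have := search_profile ox (leq0n 63) valuations_classified.
case: hasP => [[b bt /eqrowP E] _ | _]; first by exists b.
by rewrite profile_admissible.
Qed.

Lemma types_specP b : b \in types ->
  [/\ foot b < 63, all (fun a => (0 < a) && (a < 4)) (row b) /\ ones (row b) = 1,
      forall p, p < 63 -> (nth 0 (row b) p == 1) = (p == foot b),
      [/\ mate b \in types, foot (mate b) = foot b & mate b != b] &
      third_row (row b) (hrow (foot b)) = Some (row (mate b)) /\
      exists v, link b (mate b) = Some (v, None)].
Proof.
move=> /(allP types_spec)/and5P[_ f63 bd /eqnP o1].
case/andP=> /allP f /and5P[mt /eqnP mf mb tr lk].
split=> //.
- by move=> p p63; have := f p (in_iota63 p63); rewrite eqnE => /eqP.
split; first by case: third_row tr => // g /eqrowP ->.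
by case: link lk => // -[v []] // _; exists v.
Qed.

Lemma row_injective b c : b \in types -> c \in types -> row b = row c -> b = c.
Proof.
move=> bt ct E; have := all_all_in rows_distinct bt ct.
by rewrite (introT (eqrowP _ _) E) => /Pos.eqb_eq.
Qed.

Lemma over_fun b c x : over b x -> over c x -> b = c.
Proof. by move=> [bt bx] [ct cx]; apply: row_injective => //; rewrite -bx. Qed.

Lemma over_dist b x p : over b x -> p < 63 -> d x (hp p) = nth 0 (row b) p.
Proof. by move=> [_ <-] p63; rewrite nth_profile. Qed.

Lemma over_outside b x : over b x -> outside x.
Proof.
move=> [bt bx] p p63 E; have [_ [bd _] _ _ _] := types_specP bt.
have : d x (hp p) \in row b by rewrite -bx map_f ?in_iota63.
by move/(allP bd); rewrite E distxx.
Qed.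

Lemma over_foot b x p : over b x -> p < 63 -> d x (hp p) = 1 -> p = foot b.
Proof.
move=> bx p63 E; have [bt _] := bx; have [_ _ f _ _] := types_specP bt.
by apply/eqP; rewrite -f // -(over_dist bx) // E.
Qed.

Lemma dist_foot b x : over b x -> d x (hp (foot b)) = 1.
Proof.
move=> bx; have [bt _] := bx; have [f63 _ f _ _] := types_specP bt.
by apply/eqP; rewrite (over_dist bx) // f.
Qed.

Lemma linked_nbrs b c : linked b c -> c \in nbrs b.
Proof.
rewrite /linked /link; case E: (PM.find c _) => [v|//] _.
have : List.In c (nbrs b) := List.in_map fst _ _ (PM.elements_correct _ _ E).
elim: (nbrs b) => [|c' l IH] /=; first by [].
case=> [-> | /IH]; rewrite inE ?eqxx //.
by move=> ->; rewrite orbT.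
Qed.

Lemma links_specP b c : b \in types -> linked b c ->
  [/\ c \in types, linked c b, shift c b = opp3 (shift b c) &
    if link b c is Some (_, Some e) then
      [/\ nth 0 (row b) (foot c) = 2, hdist (foot b) (foot c) <> 1 /\ foot b <> foot c,
         forall c', linked b c' -> foot c' = foot c -> c' = c,
         ~~ linked e (mate c) & c <> e /\ exists v, link b e = Some (v, Some c)]
    else c = mate b].
Proof.
move=> bt /[dup] bc /linked_nbrs cn.
have /and4P[ct cb /eq3P s] := all_in_dep links_spec bt cn.
case: link => [[v [e|]]|]; try by move=> /Pos.eqb_eq; split.
case/and5P=> /eqnP n2 /eqnP h1 /eqnP f1 /allP uniq /and3P[le ce lk].
split=> //; split=> //.
- by move=> c' /linked_nbrs/uniq; case: eqnP => // _ /Pos.eqb_eq.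
- split; first by move=> E; move: ce; rewrite E Pos.eqb_refl.
  by case: link lk => // -[v' [c'|]] // /Pos.eqb_eq <-; exists v'.
Qed.

Lemma third_type b c v e : b \in types -> link b c = Some (v, Some e) ->
  [/\ c \in types, e \in types & linked b e].
Proof.
move=> bt E; have bc : linked b c by rewrite /linked E.
have [ct _ _] := links_specP bt bc; rewrite E => -[_ _ _ _ [_ [v' E']]].
have be : linked b e by rewrite /linked E'.
by have [et _ _ _] := links_specP bt be.
Qed.

Lemma line_link b c e x y z : line3 x y z -> over b x -> over c y -> over e z ->
  exists v, link b c = Some (v, Some e).
Proof.
move=> h [bt bx] [ct cy] [et ez]; have := all_all_in links_complete bt ct.
have [_ [_ o1] _ _ _] := types_specP et.
have := profile_line h; rewrite bx cy ez => ->; rewrite o1 [eqn 1 1]/=.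
case E: link => [[v [e'|]]|] // /eqrowP re; exists v.
have [_ et' _] := third_type bt E.
by rewrite (row_injective et' et re).
Qed.

Lemma foot_line b x y p : line3 x y (hp p) -> p < 63 -> over b x ->
  p = foot b /\ over (mate b) y.
Proof.
move=> h p63 bx; have h' := line3S h.
have pE : p = foot b by apply: over_foot bx p63 _; exact: line3_dist h'.
split=> //; have [bt bxE] := bx; have [_ _ _ [mt _ _] [tr _]] := types_specP bt.
by split=> //; have := profile_line h'; rewrite profile_hp // bxE pE tr => -[].
Qed.

Lemma outside_third b x : over b x -> exists2 y, over (mate b) y & line3 x y (hp (foot b)).
Proof.
move=> bx; have [f63 _ _ _ _] := types_specP (proj1 bx).
have [y h] := dist1_line3 h3 (dist_foot bx).
have h' : line3 x y (hp (foot b)) by exact: line3S h.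
by exists y => //; have [] := foot_line h' f63 bx.
Qed.

Lemma line_cases b c x y : over b x -> over c y -> d x y = 1 ->
  (exists v e z, [/\ link b c = Some (v, Some e), over e z & line3 x y z]) \/
  [/\ c = mate b & line3 x y (hp (foot b))].
Proof.
move=> bx cy xy; have [z h] := dist1_line3 h3 xy.
have [oz | [p p63 zE]] := outside_or z.
  have [e ez] := over_ex oz; left.
  by have [v E] := line_link h bx cy ez; exists v, e, z.
rewrite {}zE in h; right; have [pE my] := foot_line h p63 bx; rewrite -pE; split=> //.
exact: over_fun cy my.
Qed.

Lemma adjacent_linked b c x y : over b x -> over c y -> d x y = 1 -> linked b c.
Proof.
move=> bx cy xy; have [[v [e [z [E _ _]]]] | [-> _]] := line_cases bx cy xy.
  by rewrite /linked E.
have [_ _ _ _ [_ [v E]]] := types_specP (proj1 bx).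
by rewrite /linked E.
Qed.

Lemma linked_line b c v e x y : over b x -> over c y -> d x y = 1 ->
  link b c = Some (v, Some e) -> exists2 z, over e z & line3 x y z.
Proof.
move=> bx cy xy E; have [[v' [e' [z [E' ez h]]]] | [cE _]] := line_cases bx cy xy.
  by rewrite E in E'; case: E' => _ <- in ez *; exists z.
have [_ _ _ _ [_ [v' E']]] := types_specP (proj1 bx).
by rewrite -cE E in E'.
Qed.

Lemma mate_line b x y : over b x -> over (mate b) y -> d x y = 1 -> line3 x y (hp (foot b)).
Proof.
move=> bx my xy; have [[v' [e' [z [E' ez h]]]] | [//]] := line_cases bx my xy.
by have [_ _ _ _ [_ [v E]]] := types_specP (proj1 bx); rewrite E in E'.
Qed.

(** * Unique lifting of edges, and the fibres *)

Lemma no_triangle x y z : d x y = 1 -> d y z = 1 -> d x z = 1 -> line3 x y z.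
Proof.
move=> xy yz xz; have [w h] := dist1_line3 h3 yz.
have := line3_near hN x h; rewrite xy xz => -[[]//|[]//|[[/esym/dist0 xw] _]].
by rewrite -xw in h; exact: line3R (line3R h).
Qed.

(** On a shortest path from x to the foot of c, the middle point y cannot be in H: it would be the
    foot of b, which is not collinear with that of c. So y has a type linked to b with the same foot
    as c, which must be c. If c is the mate of b, the line from x to the foot gives y. *)
Lemma step b c x : over b x -> linked b c -> exists2 y, over c y & d x y = 1.
Proof.
move=> bx bc; have [bt _] := bx; have [ct _ _] := links_specP bt bc.
have [f63 _ _ _ _] := types_specP bt; have [g63 _ _ _ _] := types_specP ct.
case E: link => [[v [e|]]|]; last by rewrite /linked E in bc.
  case=> n2 [h1 _] uniq _ _; rewrite -(over_dist bx) // in n2.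
  have [y xy yc] := dist_step n2.
  have oy : outside y.
    move=> q q63 yq; rewrite {}yq in xy yc; rewrite (over_foot bx q63 xy) in yc.
    by rewrite hp_dist in yc.
  have [c' c'y] := over_ex oy; exists y => //.
  have <- // : c' = c.
  by apply: uniq; [exact: adjacent_linked bx c'y xy | rewrite (over_foot c'y g63 yc)].
move=> ->; have [y my h] := outside_third bx; exists y => //; exact: line3_dist h.
Qed.

(** Given two lifts y and y', let z and z' be the third points of their lines through x. Then z' is
    at distance 2 from y and from the foot of c, hence at distance 1 from the last point of the line
    joining these. That point is over [mate c], which is not linked to the type e of z'. *)
Lemma step_unique b c x y y' : over b x -> over c y -> over c y' ->
  d x y = 1 -> d x y' = 1 -> y = y'.
Proof.
move=> bx cy cy' xy xy'; have [bt _] := bx; have [ct _] := cy.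
have bc := adjacent_linked bx cy xy; have [_ _ _] := links_specP bt bc.
have [g63 _ _ _ _] := types_specP ct.
case E: link => [[v [e|]]|]; last by rewrite /linked E in bc.
  case=> n2 _ _ emc [ce _].
  have [z ez h] := linked_line bx cy xy E; have [z' ez' h'] := linked_line bx cy' xy' E.
  have [// | yy'] := excluded_middle_informative (y = y').
  have xp : d (hp (foot c)) x = 2 by rewrite distC (over_dist bx).
  have zp : d z' (hp (foot c)) = 2.
    rewrite distC; have := line3_near hN (hp (foot c)) h'.
    by rewrite xp (distC hN _ y') (dist_foot cy') => -[] []; lia.
  have zx : d z' x = 1 by exact: line3_dist (line3R (line3R h')).
  have zy : d z' y = 2.
    have := line3_near hN z' h; rewrite zx => -[[] // | [] [/esym/dist0 zy _] | [[/esym/dist0 zz] _]].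
      by case: ce; apply: over_fun cy _; rewrite -zy.
    by rewrite -zz in h; have := line3_fun hN (line3S h) (line3S h').
  have [w mw k] := outside_third cy.
  have zw : d z' w = 1 by have := line3_near hN z' k; rewrite zy zp => -[[]|[]|[]]; lia.
  by case/negP: emc; exact: adjacent_linked ez' mw zw.
move=> cE; rewrite cE in cy cy'.
have h := mate_line bx cy xy; have h' := mate_line bx cy' xy'.
by have := line3_fun hN (line3S h) (line3S h').
Qed.

Definition fibre b (phi : Z3 -> point N) : Prop :=
  [/\ forall i, over b (phi i), injective phi & forall x, over b x -> exists i, x = phi i].

(** Lifting c b undoes lifting b c, by uniqueness, so labels are carried over bijectively. *)
Lemma fibre_step b c phi : fibre b phi -> linked b c ->
  exists2 psi, fibre c psi & forall i, d (phi i) (psi i) = 1.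
Proof.
move=> [ov inj onto] bc.
have st i : exists y, over c y /\ d (phi i) y = 1.
  by have [y cy xy] := step (ov i) bc; exists y.
have [y0 [c0 a0]] := st Z0; have [y1 [c1 a1]] := st Z1; have [y2 [c2 a2]] := st Z2.
pose psi i := match i with Z0 => y0 | Z1 => y1 | Z2 => y2 end.
have ovp i : over c (psi i) by case: i.
have adj i : d (phi i) (psi i) = 1 by case: i.
exists psi => //; split=> // [i j E | y cy].
  apply: inj; apply: step_unique (ovp i) (ov i) (ov j) _ _; first by rewrite distC.
  by rewrite E distC.
have [bt _] := ov Z0; have [_ cb _ _] := links_specP bt bc.
have [x bx yx] := step cy cb; have [i xi] := onto x bx; exists i.
by apply: step_unique (ov i) cy (ovp i) _ (adj i); rewrite -xi distC.
Qed.

Lemma dist2 b c x y z : over b x -> over c y -> b <> c -> ~~ linked b c ->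
  d x z = 1 -> d z y = 1 -> d x y = 2.
Proof.
move=> bx cy bc nbc xz zy; have := dist_triangle hN x z y; rewrite xz zy.
case E: (d x y) => [|[|[|]]] // _.
  by move/dist0: E cy => <- /(over_fun bx).
by case/negP: nbc; exact: adjacent_linked bx cy E.
Qed.

(* The common neighbours of two points at distance 2 with different feet are
   outside the subhexagon. *)
Lemma middle b c x y : over b x -> over c y -> foot b <> foot c -> d x y = 2 ->
  exists v z, [/\ over v z, d x z = 1, d z y = 1 & linked b v /\ linked v c].
Proof.
move=> bx cy fbc /dist_step[z xz zy].
have [oz | [p p63 zp]] := outside_or z; last first.
  case: fbc; rewrite zp distC in zy; rewrite zp in xz.
  by rewrite -(over_foot bx p63 xz) (over_foot cy p63 zy).
have [v vz] := over_ex oz; exists v, z; split=> //.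
by split; [exact: adjacent_linked bx vz xz | exact: adjacent_linked vz cy zy].
Qed.

(* The walks 1 162 13, 1 165 116 and 1 2 137 are the only ones of length 2 with
   their ends, so x is at distance 2 from exactly one point over each of 13, 116
   and 137.  These form a line, each lift of which contains exactly one of the
   three points: it has three lifts. *)
Lemma special_fibre x : over 1 x -> exists phi, fibre 13 phi.
Proof.
move=> bx; have [bt _] := bx; have [s lk] := special_link; have /allP sp := special_walks.
have spec v c : (v, c) \in [:: (162, 13); (165, 116); (2, 137)]%positive ->
    [/\ linked 1 v, linked v c, ~~ linked 1 c, 1%positive <> c /\ foot 1 <> foot c &
      forall u, linked 1 u -> linked u c -> u = v].
  move=> /sp/and5P[h1 h2 h3' h4 /andP[h5 /allP h6]]; split=> //.
    by split; [move/Pos.eqb_eq; rewrite (negPf h4) | move/eqnP; rewrite (negPf h5)].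
  by move=> u /linked_nbrs/h6 + uc; rewrite uc => /Pos.eqb_eq.
have far v c y : (v, c) \in [:: (162, 13); (165, 116); (2, 137)]%positive -> over c y ->
    d x y = 2 \/ d x y = 3.
  move=> /spec[_ _ ln [nc fc] _] cy; have := dist3 hN x y.
  case E: (d x y) => [|[|[|[|]]]] // _; try by auto.
    by move/dist0: E cy => <- /(over_fun bx).
  by case/negP: ln; exact: adjacent_linked bx cy E.
have end_ v c : (v, c) \in [:: (162, 13); (165, 116); (2, 137)]%positive ->
    exists y, [/\ over c y, d x y = 2 & forall y', over c y' -> d x y' = 2 -> y' = y].
  move=> /spec[bv vc ln [nc fc] uq].
  have [z vz xz] := step bx bv; have [e ce ze] := step vz vc.
  exists e; split=> // [|e' ce' xe']; first exact: dist2 bx ce nc ln xz ze.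
  have [w [z' [wz' xz' ze' [bw wc]]]] := middle bx ce' fc xe'.
  have wv : w = v by exact: uq.
  rewrite wv in wz'; have zz := step_unique bx vz wz' xz xz'.
  by apply: step_unique vz ce' ce _ ze; rewrite zz.
have [e1 [c1 x1 u1]] := end_ 162%positive 13%positive isT.
have [e2 [c2 x2 u2]] := end_ 165%positive 116%positive isT.
have [e3 [c3 x3 u3]] := end_ 2%positive 137%positive isT.
have line y : over 13 y -> exists y2 y3, [/\ over 116 y2, over 137 y3 & line3 y y2 y3].
  move=> cy; have l12 : linked 13 116 by rewrite /linked lk.
  have [y2 cy2 yy2] := step cy l12; have [y3 cy3 h] := linked_line cy cy2 yy2 lk.
  by exists y2, y3.
have [_ l23 l31] : [/\ True, linked 116 13 & linked 137 13] by [].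
have [y2 k2 ey2] := step c2 l23; have [y3 k3 ey3] := step c3 l31.
pose phi i := match i with Z0 => e1 | Z1 => y2 | Z2 => y3 end.
exists phi.
have onto y : over 13 y -> exists i, y = phi i.
  move=> cy; have [z2 [z3 [cz2 cz3 h]]] := line y cy.
  have f1 := far 162%positive 13%positive _ isT cy; have f2 := far 165%positive 116%positive _ isT cz2.
  have f3 := far 2%positive 137%positive _ isT cz3.
  (* The three distances are 2 or 3, and [near_rule] then forces exactly one of them to be 2. *)
  have [n1 | [n2 | n3]] : d x y = 2 \/ (d x z2 = 2 \/ d x z3 = 2).
  - by have := line3_near hN x h => -[[]|[]|[]]; lia.
  - by exists Z0; exact: u1.
  - exists Z1; apply: step_unique c2 cy k2 _ ey2; rewrite -(u2 _ cz2 n2) distC.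
    exact: line3_dist h.
  - exists Z2; apply: step_unique c3 cy k3 _ ey3; rewrite -(u3 _ cz3 n3).
    exact: line3_dist (line3R (line3R h)).
(* A lift contains at most one of the three ends. *)
have one y : over 13 y -> forall z2 z3, over 116 z2 -> over 137 z3 -> line3 y z2 z3 ->
    [/\ ~ (y = e1 /\ z2 = e2), ~ (y = e1 /\ z3 = e3) & ~ (z2 = e2 /\ z3 = e3)].
  move=> cy z2 z3 cz2 cz3 h.
  have f1 := far 162%positive 13%positive _ isT cy; have f2 := far 165%positive 116%positive _ isT cz2.
  have f3 := far 2%positive 137%positive _ isT cz3; have := line3_near hN x h => nr.
  by split=> -[E E']; move: nr; rewrite ?E ?E' ?x1 ?x2 ?x3 => -[[]|[]|[]]; lia.
have ov i : over 13 (phi i) by case: i.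
split=> //.
have [z2 [z3 [cz2 cz3 h]]] := line y2 k2; have ze2 : z2 = e2.
  by apply: step_unique k2 cz2 c2 (line3_dist _ h) _; rewrite distC.
have [w2 [w3 [cw2 cw3 k]]] := line y3 k3; have we3 : w3 = e3.
  by apply: step_unique k3 cw3 c3 (line3_dist _ (line3S k)) _; rewrite distC.
have [n1 _ n3] := one _ k2 _ _ cz2 cz3 h; have [_ n2 _] := one _ k3 _ _ cw2 cw3 k.
have n23 : y2 <> y3.
  move=> E; rewrite E in h; apply: n3; split=> //; rewrite -we3.
  exact: step_unique k3 cz3 cw3 (line3_dist _ (line3S h)) (line3_dist _ (line3S k)).
by case=> -[] //= E; [case: n1 | case: n2 | case: n1 | case: n2 | case: n23].
Qed.

Lemma rooted_ind (P : positive -> Prop) seen l : rooted seen l ->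
  (forall b c, b \in types -> linked b c -> P b -> P c) ->
  (forall b, b \in seen -> P b) -> forall b, b \in types -> P b.
Proof.
move=> + next; elim: l seen => [|[b c] l IH] seen.
  by move=> h sP b bt; apply: sP; exact: (allP (h : all (fun b => b \in seen) types) b bt).
rewrite [rooted _ _]/=; case/and5P=> bs _ bt bc /andP[_ /IH{}IH] sP; apply: IH => e.
by rewrite inE => /orP[/eqP -> | /sP //]; exact: next bt bc (sP b bs).
Qed.

Lemma all_fibres : (exists x, outside x) -> forall b, b \in types -> exists phi, fibre b phi.
Proof.
case=> x ox; have [b0 bx] := over_ex ox.
have [z rz] : exists z, over 1 z.
  (* Stated as an implication, the induction from the root outwards carries a point over b back to a
     point over 1. *)
  pose P b := (exists y, over b y) -> exists z, over 1 z.
  apply: (rooted_ind (P := P) tree_rooted _ _ (proj1 bx)); last by exists x.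
  - move=> b c bt bc Pb [y cy]; apply: Pb; have [_ cb _ _] := links_specP bt bc.
    by have [y' by' _] := step cy cb; exists y'.
  - by move=> b; rewrite inE => /eqP ->.
have [phi f13] := special_fibre rz.
have spread b c : b \in types -> linked b c -> (exists phi, fibre b phi) -> exists phi, fibre c phi.
  by move=> _ bc [psi fb]; have [chi fc _] := fibre_step fb bc; exists chi.
apply: (rooted_ind tree_rooted spread) => b; rewrite inE => /eqP ->.
pose P b := (exists phi, fibre b phi) -> exists phi, fibre 1 phi.
apply: (rooted_ind (P := P) tree_rooted _ _ (_ : 13%positive \in types)) => //; last by exists phi.
- move=> e c et ec Pe fc; apply: Pe; have [ct ce _ _] := links_specP et ec.
  exact: spread _ _ ct ce fc.
- by move=> e; rewrite inE => /eqP ->.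
Qed.

Hypothesis outside_ex : exists x, outside x.

(** The foot of e is at distance 3 from x, so each of the three lifts of its line with e and
    [mate e] needs a walk of length 2 from x. The lift through x' would use two walks, making four,
    but the graph offers at most three. *)
Lemma no_quadrangle b e x x' y y' c c' : over b x -> over e x' -> over c y -> over c' y' ->
  d x y = 1 -> d x y' = 1 -> d y x' = 1 -> d y' x' = 1 -> x <> x' -> y = y'.
Proof.
move=> bx ex' cy cy' xy xy' yx' yx'' nxx.
have [// | nyy] := excluded_middle_informative (y = y'); exfalso.
have [bt _] := bx; have [et _] := ex'.
have bc := adjacent_linked bx cy xy; have bc' := adjacent_linked bx cy' xy'.
have ce := adjacent_linked cy ex' yx'; have ce' := adjacent_linked cy' ex' yx''.
have ncc : c <> c'.
  by move=> E; apply: nyy; rewrite -E in cy'; exact: step_unique bx cy cy' xy xy'.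
have nbe : e <> b.
  move=> E; apply: nxx; rewrite E in ex'; apply: step_unique cy bx ex' _ yx'.
  by rewrite distC.
have [ct _ _ _] := links_specP bt bc.
pose I := [seq v <- nbrs b | linked v e]; pose I' := [seq v <- nbrs b | linked v (mate e)].
have cI : c \in I by rewrite mem_filter ce linked_nbrs.
have cI' : c' \in I by rewrite mem_filter ce' linked_nbrs.
have : if 1 < size I then eqn (nth 0 (row b) (foot e)) 3 && (size I + size I' <= 3) else true.
  have /allP/(_ e (linked_nbrs ce)) := all_in_dep quadrangles_spec bt (linked_nbrs bc).
  by case: (Pos.eqb_spec e b) => // _ /andP[].
have -> : 1 < size I.
  by move: cI cI'; case: (I) => [|v [|]] //; rewrite !inE => /eqP <- /eqP /esym.
case/andP=> /eqnP row3 sz.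
pose W := [seq (v, e) | v <- I] ++ [seq (v, mate e) | v <- I'].
have szW : size W <= 3 by rewrite size_cat !size_map.
have [f63 _ _ [met fme nme] _] := types_specP et.
have [fb63 _ fbE _ _] := types_specP bt.
have nfb T : foot T = foot e -> foot b <> foot T.
  move=> -> E; have := fbE (foot e) f63; rewrite row3 E eqxx //.
have [phi [ov inj onto]] := all_fibres outside_ex et.
(* Every lift of the line through e and its mate contains a point at distance 2
   from x; the walks to these points are distinct. *)
have walk i : exists v T t z, [/\ (v, T) \in W, over T t, over v z, d x z = 1 &
    d z t = 1 /\ (T = e /\ t = phi i \/ T = mate e /\ d (phi i) t = 1)].
  have [m mm h] := outside_third (ov i).
  have [T [t [Tt xt hT]]] : exists T t, [/\ over T t, d x t = 2 &
      (T = e /\ t = phi i \/ T = mate e /\ d (phi i) t = 1)].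
    have := line3_near hN x h; rewrite (over_dist bx f63) row3 => nr.
    have b1 := dist3 hN x (phi i); have b2 := dist3 hN x m.
    have [d1 | d2] := near_rule3 nr b1 b2.
      by exists e, (phi i); split=> //; left.
    by exists (mate e), m; split=> //; right; split=> //; exact: line3_dist h.
  have fT : foot b <> foot T by apply: nfb; case: hT => -[->].
  have [v [z [vz xz zt [bv vT]]]] := middle bx Tt fT xt.
  exists v, T, t, z; split=> //; rewrite mem_cat.
  case: hT => -[TE _]; rewrite TE in vT *.
    by rewrite map_f // mem_filter vT linked_nbrs.
  by rewrite [X in _ || X]map_f ?orbT // mem_filter vT linked_nbrs.
have walk_inj i j v T t t' z z' : over T t -> over T t' -> over v z -> over v z' ->
    d x z = 1 -> d x z' = 1 -> d z t = 1 -> d z' t' = 1 ->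
    (T = e /\ t = phi i \/ T = mate e /\ d (phi i) t = 1) ->
    (T = e /\ t' = phi j \/ T = mate e /\ d (phi j) t' = 1) -> i = j.
  move=> Tt Tt' vz vz' xz xz' zt zt' hi hj.
  have zz := step_unique bx vz vz' xz xz'; rewrite -zz in zt'.
  have tt := step_unique vz Tt Tt' zt zt'; rewrite -tt in hj.
  apply: inj; case: hi hj => -[TE hi] [] [TE' hj].
  - by rewrite -hi -hj.
  - by case/eqP: nme; rewrite -TE' TE.
  - by case/eqP: nme; rewrite -TE TE'.
  - by apply: step_unique Tt (ov i) (ov j) _ _; rewrite distC.
have [j xj] := onto x' ex'.
pose i1 := add3 j Z1; pose i2 := add3 j Z2.
have [n1 n2 n12] : [/\ i1 <> j, i2 <> j & i1 <> i2] by rewrite /i1 /i2; case: (j).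
have [v1 [T1 [t1 [z1 [W1 o1 p1 q1 [r1 s1]]]]]] := walk i1.
have [v2 [T2 [t2 [z2 [W2 o2 p2 q2 [r2 s2]]]]]] := walk i2.
(* A coincidence between walks to different lifts would, by unique lifting, identify the labels of
   these lifts. *)
have u : uniq [:: (c, e); (c', e); (v1, T1); (v2, T2)].
  rewrite /= !inE !negb_or !andbT; apply/and3P; split.
  - apply/and3P; split; apply/eqP; [by case=> E1; apply: ncc | case=> E1 E2 | case=> E1 E2].
    + apply: n1; rewrite -E1 in p1; rewrite -E2 in o1 s1.
      by apply: (walk_inj i1 j c e t1 x' z1 y) => //; left.
    + apply: n2; rewrite -E1 in p2; rewrite -E2 in o2 s2.
      by apply: (walk_inj i2 j c e t2 x' z2 y) => //; left.
  - apply/andP; split; apply/eqP; case=> E1 E2.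
    + apply: n1; rewrite -E1 in p1; rewrite -E2 in o1 s1.
      by apply: (walk_inj i1 j c' e t1 x' z1 y') => //; left.
    + apply: n2; rewrite -E1 in p2; rewrite -E2 in o2 s2.
      by apply: (walk_inj i2 j c' e t2 x' z2 y') => //; left.
  - apply/eqP; case=> E1 E2; apply: n12; rewrite -E1 in p2; rewrite -E2 in o2 s2.
    exact: (walk_inj i1 i2 v1 T1 t1 t2 z1 z2).
have sub : {subset [:: (c, e); (c', e); (v1, T1); (v2, T2)] <= W}.
  move=> w; rewrite !inE => /or4P[] /eqP -> //; rewrite mem_cat map_f //.
by have := leq_trans (uniq_leq_size u sub) szW.
Qed.

(** * Labelling the fibres *)

Lemma add3A i j k : add3 i (add3 j k) = add3 (add3 i j) k.
Proof. by case: i; case: j; case: k. Qed.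

Lemma add3_0 i : add3 i Z0 = i.
Proof. by case: i. Qed.

Lemma add3NK i j : add3 (add3 i (opp3 j)) j = i.
Proof. by case: i; case: j. Qed.

Lemma add3_third (i j a b c : Z3) : a <> b -> a <> c -> b <> c ->
  j <> add3 i a -> j <> add3 i b -> j = add3 i c.
Proof. by case: i; case: j; case: a; case: b; case: c. Qed.

Section Labels.
Variable phi : positive -> Z3 -> point N.

Definition adjoined b c : Prop := forall i, d (phi b i) (phi c (add3 i (shift b c))) = 1.

Hypothesis phi_fibre : forall b, b \in types -> fibre b (phi b).

Lemma phi_over b i : b \in types -> over b (phi b i).
Proof. by case/phi_fibre. Qed.

Lemma adjoined_sym b c : b \in types -> linked b c -> adjoined b c -> adjoined c b.
Proof.
move=> bt bc bcE i; have [_ _ s _] := links_specP bt bc.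
by have := bcE (add3 i (shift c b)); rewrite s add3NK distC.
Qed.

Lemma adjoined_line b c e v : b \in types -> link b c = Some (v, Some e) -> shift_additive b c e ->
  adjoined b c -> adjoined b e <-> adjoined c e.
Proof.
move=> bt E /eq3P sh bcE; have [ct et be] := third_type bt E.
have line i : exists2 z, over e z & line3 (phi b i) (phi c (add3 i (shift b c))) z.
  exact: linked_line (phi_over _ bt) (phi_over _ ct) (bcE i) E.
split=> h i.
  have [z ez hz] := line (add3 i (opp3 (shift b c))); rewrite add3NK in hz.
  have <- : z = phi e (add3 i (shift c e)).
    apply: step_unique (phi_over _ bt) ez (phi_over _ et) (line3_dist _ (line3S hz)) _.
    by have := h (add3 i (opp3 (shift b c))); rewrite sh add3A add3NK.
  exact: line3_dist (line3R hz).
have [z ez hz] := line i.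
have <- : z = phi e (add3 i (shift b e)).
  apply: step_unique (phi_over _ ct) ez (phi_over _ et) (line3_dist _ (line3R hz)) _.
  by rewrite sh add3A; exact: h.
exact: line3_dist (line3S hz).
Qed.

(** As x is at distance 2 from y and z, it is collinear with the third point of their line. That
    point has a type not linked to b, or it is the foot of e, which is not that of b. *)
Lemma no_pentagon b e c x y z : over b x -> over e y -> over c z -> d y z = 1 ->
  d x y = 2 -> d x z = 2 -> foot b <> foot e ->
  (if link e c is Some (_, Some f) then ~~ linked b f else true) -> False.
Proof.
move=> bx ey cz yz xy xz fbe.
have [[v [f [w [E fw h]]]] | [_ h]] := line_cases ey cz yz.
  rewrite E => /negP[]; apply: adjacent_linked bx fw _.
  by have := line3_near hN x h; rewrite xy xz => -[[]|[]|[]]; lia.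
move=> _; have := line3_near hN x h; rewrite xy xz => nr.
have [f63 _ _ _ _] := types_specP (proj1 ey).
have /(over_foot bx f63) : d x (hp (foot e)) = 1 by case: nr => -[]; lia.
by move/esym.
Qed.

Let sound k : Prop := forall b c, knows k b c -> [/\ b \in types, linked b c & adjoined b c].

Lemma knows_learn k b c b' c' : knows (learn k b c) b' c' -> (b' = b /\ c' = c) \/ knows k b' c'.
Proof.
rewrite /knows /learn PositiveMapAdditionalFacts.gsspec; case: PM.E.eq_dec => [-> | _]; last by right.
rewrite PositiveMapAdditionalFacts.gsspec; case: PM.E.eq_dec => [-> | _]; first by left.
by case: (PM.find b k) => [n|]; [right | case: (c')].
Qed.

Lemma sound_learn2 k b c : sound k -> b \in types -> linked b c -> adjoined b c ->
  sound (learn2 k b c).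
Proof.
move=> sk bt bc bcE b' c' /knows_learn[[-> ->] | /knows_learn[[-> ->] // | /sk //]].
by have [ct cb _ _] := links_specP bt bc; split=> //; exact: adjoined_sym.
Qed.

Lemma sound_infer k b c : sound k -> b \in types -> linked b c -> adjoined b c ->
  sound (infer k b c).
Proof.
move=> sk bt bc bcE; have sk' := sound_learn2 sk bt bc bcE; rewrite /infer.
case E: link => [[v [e|]]|] //; have [ct et be] := third_type bt E.
have ce : linked c e.
  have [z ez h] := linked_line (phi_over Z0 bt) (phi_over _ ct) (bcE Z0) E.
  exact: adjacent_linked (phi_over _ ct) ez (line3_dist _ (line3R h)).
case: ifP => [/andP[/sk[_ _ beE] ad] | _].
  by apply: sound_learn2 => //; apply/(adjoined_line bt E ad bcE).
case: ifP => [/andP[/sk[_ _ ceE] ad] | _] //.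
by apply: sound_learn2 => //; apply/(adjoined_line bt E ad bcE).
Qed.

(** Start at the lift m of b from which the walk reaches the given lift i. The sought edge ends at a
    label j different from the ends of the other two walks from m, so j is the only displacement
    that remains. *)
Lemma sound_step k (first : bool) b v e s t c : sound k -> deducible k first b v e s t c ->
  (if first then e else t) \in types /\
  (if first then adjoined e c else adjoined t c) /\ linked (if first then e else t) c.
Proof.
move=> sk /andP[/andP[/andP[]]].
rewrite /edge => /and5P[/andP[_ /sk[bt bv bvE]] /andP[_ /sk[vt ve veE]]
  /andP[_ /sk[_ bs bsE]] /andP[_ /sk[st sc scE]] /andP[_ /sk[_ bt' btE]]].
move=> known /and3P[/eq3P w12 /eq3P w13 /eq3P w23].
case/and4P=> /Pos.eqb_spec nst nbc nbe /and4P[/Pos.eqb_spec bc /Pos.eqb_spec be /eqnP fbe pent].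
have [et ev _ _] := links_specP vt ve; have [tt tb _ _] := links_specP bt bt'.
have [ct _ _ _] := links_specP st sc.
have pE m : phi e (add3 m (add3 (shift b v) (shift v e))) =
    phi e (add3 (add3 m (shift b v)) (shift v e)) by rewrite add3A.
have far_e m : d (phi b m) (phi e (add3 m (add3 (shift b v) (shift v e)))) = 2.
  by rewrite pE; exact: (dist2 (phi_over m bt) (phi_over _ et) be nbe (bvE m)).
have far_c m j u : u \in types -> d (phi b m) (phi u j) = 1 ->
    forall l, d (phi u j) (phi c l) = 1 -> d (phi b m) (phi c l) = 2.
  by move=> ut bu l uc; exact: (dist2 (phi_over m bt) (phi_over l ct) bc nbc bu uc).
have pentagon m j u : u \in types -> d (phi b m) (phi u j) = 1 ->
    forall l, d (phi u j) (phi c l) = 1 ->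
    d (phi e (add3 m (add3 (shift b v) (shift v e)))) (phi c l) = 1 -> False.
  move=> ut bu l uc ec.
  exact: no_pentagon (phi_over m bt) (phi_over _ et) (phi_over l ct) ec (far_e m)
    (far_c _ _ _ ut bu _ uc) fbe pent.
case: first known => /andP[/andP[_ /sk[_ kc kcE]] uc]; split=> //; split=> // i.
  pose m := add3 i (opp3 (add3 (shift b v) (shift v e))).
  have iE : i = add3 m (add3 (shift b v) (shift v e)) by rewrite /m add3NK.
  have [z cz ez] := step (phi_over i et) uc.
  have [j zj] : exists j, z = phi c j by have [_ _] := phi_fibre ct; apply.
  rewrite zj iE in ez.
  have -> : add3 i (shift e c) = j; last by rewrite {1}iE.
  have n2 : j <> add3 m (add3 (shift b s) (shift s c)).
    move=> E; apply: (pentagon m _ s st (bsE m) j) => //.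
    by rewrite E add3A; exact: scE.
  have n3 : j <> add3 m (add3 (shift b t) (shift t c)).
    move=> E; apply: (pentagon m _ t tt (btE m) j) => //.
    by rewrite E add3A; exact: kcE.
  by rewrite (add3_third w23 (nesym w12) (nesym w13) n2 n3) {1}iE !add3A.
pose m := add3 i (opp3 (shift b t)).
have iE : i = add3 m (shift b t) by rewrite /m add3NK.
have [z cz tz] := step (phi_over i tt) uc.
have [j zj] : exists j, z = phi c j by have [_ _] := phi_fibre ct; apply.
rewrite zj iE in tz.
have -> : add3 i (shift t c) = j; last by rewrite {1}iE.
have n1 : j <> add3 m (add3 (add3 (shift b v) (shift v e)) (shift e c)).
  move=> E; apply: (pentagon m _ t tt (btE m) j) => //.
  by rewrite E (add3A m _ (shift e c)); exact: kcE.
(* Ending where the second walk does would create a quadrangle over b, s, c, t and hence force s =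
   t. *)
have n2 : j <> add3 m (add3 (shift b s) (shift s c)).
  move=> E; apply: nst; apply: over_fun (phi_over (add3 m (shift b s)) st) _.
  have -> : phi s (add3 m (shift b s)) = phi t (add3 m (shift b t)).
    apply: (no_quadrangle (phi_over m bt) (phi_over j ct) (phi_over _ st) (phi_over _ tt)) => //.
      by rewrite E add3A; exact: scE.
    by move=> x; apply: bc; apply: over_fun (phi_over m bt) _; rewrite x; exact: phi_over.
  exact: phi_over.
by rewrite (add3_third w12 w13 w23 n1 n2) {1}iE add3A.
Qed.

Lemma sound_infer_step k n : sound k -> sound (infer_step k n).
Proof.
move=> sk; rewrite /infer_step.
case: digits => [|x [|[|b] [|[|v] [|[|e] [|[|s] [|[|t] [|[|c] [|]]]]]]]] //.
set f := (if x is N0 then _ else _).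
case: ifP => // /(sound_step sk); case: f => -[ut [uE uc]]; exact: sound_infer.
Qed.
End Labels.

Lemma exists_third (i j : Z3) : i <> j ->
  exists k, [/\ k <> i, k <> j & forall l, [\/ l = k, l = i | l = j]].
Proof.
by case: i; case: j => // _; [exists Z2|exists Z1|exists Z2|exists Z0|exists Z1|exists Z0];
  split=> // -[]; by [apply: Or31 | apply: Or32 | apply: Or33].
Qed.

Lemma tree_labels seen l phi : rooted seen l -> (forall b, b \in seen -> fibre b (phi b)) ->
  exists phi', [/\ forall b, b \in seen -> phi' b = phi b,
    forall b, b \in types -> fibre b (phi' b) &
    forall bc, bc \in l -> adjoined phi' bc.1 bc.2].
Proof.
elim: l seen phi => [|[b c] l IH] seen phi.
  move=> h fs; exists phi; split=> // b bt; apply: fs.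
  exact: (allP (h : all (fun b => b \in seen) types) b bt).
rewrite [rooted _ _]/=; case/and5P=> bs cs bt bc /andP[/eq3P s0 rl] fs.
have [psi fc adj] := fibre_step (fs b bs) bc.
pose phi1 e := if e == c then psi else phi e.
have [|phi' [ext all adj']] := IH (c :: seen) phi1 rl.
  by move=> e; rewrite inE /phi1; case: eqP => [-> // | _ /= /fs].
have ext' e : e \in seen -> phi' e = phi e.
  move=> es; rewrite ext ?inE ?es ?orbT // /phi1; case: eqP => // ec.
  by move: cs; rewrite -ec es.
exists phi'; split=> // bc'; rewrite inE => /orP[/eqP -> i | /adj' //].
by rewrite /= s0 add3_0 ext' // ext ?mem_head // /phi1 eqxx.
Qed.

(* The holonomy of a closed walk of length 4 has no fixed point, hence is a
   3-cycle on the fibre. *)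
Lemma oriented_fibre : exists2 phi, fibre 1 phi &
  forall i, exists y z w, [/\ over 35 y, over 14 z, over 108 w,
    d (phi i) y = 1 /\ d y z = 1 & d z w = 1 /\ d w (phi (add3 i Z1)) = 1].
Proof.
pose b1 := 1%positive; pose b2 := 35%positive; pose b3 := 14%positive; pose b4 := 108%positive.
have [t1 l12 [l23 l34 l41]] : [/\ b1 \in types, linked b1 b2 &
    [/\ linked b2 b3, linked b3 b4 & linked b4 b1]] by [].
pose hol x u := exists y z w, [/\ over b2 y, over b3 z, over b4 w,
  d x y = 1 /\ d y z = 1 & d z w = 1 /\ d w u = 1].
have total x : over b1 x -> exists2 u, over b1 u & hol x u.
  move=> ox; have [y oy xy] := step ox l12; have [z oz yz] := step oy l23.
  have [w ow zw] := step oz l34; have [u ou wu] := step ow l41.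
  by exists u => //; exists y, z, w.
have inj x x' u : over b1 x -> over b1 x' -> over b1 u -> hol x u -> hol x' u -> x = x'.
  move=> ox ox' ou [y [z [w [oy oz ow [xy yz] [zw wu]]]]] [y' [z' [w' [oy' oz' ow' [xy' yz'] [zw' wu']]]]].
  have ww : w = w' by apply: step_unique ou ow ow' _ _; rewrite distC.
  rewrite -ww in zw'; have zz : z = z' by apply: step_unique ow oz oz' _ _; rewrite distC.
  rewrite -zz in yz'; have yy : y = y' by apply: step_unique oz oy oy' _ _; rewrite distC.
  by rewrite -yy in xy'; apply: step_unique oy ox ox' _ _; rewrite distC.
have nofix x u : over b1 x -> hol x u -> x <> u.
  move=> ox [y [z [w [oy oz ow [xy yz] [zw wu]]]]] xu; rewrite -xu in wu.
  have yw : y = w.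
    apply: (no_quadrangle ox oz oy ow xy _ yz); [by rewrite distC | by rewrite distC |].
    by move=> xz; rewrite -xz in oz; have := over_fun ox oz.
  by rewrite -yw in ow; have := over_fun oy ow.
have [phi [ov inj_phi onto]] := all_fibres outside_ex t1.
have [x1 o1 h0] := total _ (ov Z0); have [x2 o2 h1] := total _ o1; have [x3 o3 h2] := total _ o2.
set x0 := phi Z0 in h0; have o0 : over b1 x0 := ov Z0.
have n01 := nofix _ _ o0 h0; have n12 := nofix _ _ o1 h1; have n23 := nofix _ _ o2 h2.
have pick (u v : point N) : over b1 u -> over b1 v -> u <> v -> exists t, [/\ over b1 t, t <> u, t <> v &
    forall s, over b1 s -> [\/ s = t, s = u | s = v]].
  move=> /onto[i ->] /onto[j ->] ij.
  have [|k [ki kj all]] := @exists_third i j; first by move=> E; rewrite E in ij.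
  exists (phi k); split; [exact: ov | by move/inj_phi | by move/inj_phi |].
  by move=> s /onto[l ->]; case: (all l) => ->; constructor.
(* If the holonomy exchanged two points, it would fix the third one. *)
have n02 : x0 <> x2.
  move=> E; have [t [ot t0 t1' all]] := pick _ _ o0 o1 n01.
  have [u ou tu] := total _ ot; case: (all u ou) => uE; rewrite uE in tu.
  - by case: (nofix _ _ ot tu).
  - by apply: t1'; apply: inj ot o1 o2 _ h1; rewrite -E.
  - by apply: t0; exact: inj ot o0 o1 tu h0.
have [t [ot t0 t2 all]] := pick _ _ o0 o2 n02.
have tE : t = x1 by case: (all x1 o1) => // E; case: n01.
have x30 : x3 = x0.
  case: (all x3 o3) => // E; last by case: n23.
  by case: n02; apply: inj o0 o2 o1 h0 _; rewrite -tE -E.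
exists (fun i => match i with Z0 => x0 | Z1 => x1 | Z2 => x2 end).
  split; first by case.
    by case=> -[] // E; [case: n01|case: n02|case: n12].
  by move=> s /all[] ->; [exists Z1 | exists Z0 | exists Z2].
by case=> /=; [exact: h0 | exact: h1 | rewrite -x30; exact: h2].
Qed.

Lemma labelling : exists phi, (forall b, b \in types -> fibre b (phi b)) /\
  forall b c, b \in types -> linked b c -> adjoined phi b c.
Proof.
have [psi fpsi hol] := oriented_fibre.
have [|phi [root phi_fibre tree_adj]] := @tree_labels _ _ (fun _ => psi) tree_rooted.
  by move=> b; rewrite inE => /eqP ->.
exists phi; split=> // b c bt bc.
pose sound k := forall b c, knows k b c -> [/\ b \in types, linked b c & adjoined phi b c].
have infer_ok k e f : sound k -> e \in types -> linked e f -> adjoined phi e f -> sound (infer k e f).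
  exact: sound_infer.
have ok0 : sound (foldl (fun k bc => infer k bc.1 bc.2) (PM.empty _) tree).
  have : sound (PM.empty _) by move=> e f; rewrite /knows; case: e.
  have : {in tree, forall bc, [/\ bc.1 \in types, linked bc.1 bc.2 & adjoined phi bc.1 bc.2]}.
    have : rooted [:: 1%positive] tree -> {in tree, forall bc, bc.1 \in types /\ linked bc.1 bc.2}.
      elim: tree [:: 1%positive] => // -[e f] l IH seen; rewrite [rooted _ _]/=.
      case/and5P=> _ _ et ef /andP[_ /IH{}IH] bc'; rewrite inE => /orP[/eqP -> // | /IH //].
    by move/(_ tree_rooted) => h bc' /[dup]/h[h1 h2] /tree_adj.
  elim: tree (PM.empty _) => //= bc' l IH k h sk; apply: IH => [bc2 bc2l | ].
    by apply: h; rewrite inE bc2l orbT.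
  by have [] := h bc' (mem_head _ _); exact: infer_ok.
have ok1 : sound initial.
  apply: infer_ok => // i.
  have fibre_over e j : e \in types -> over e (phi e j) by case/phi_fibre.
  have tadj e f : (e, f) \in tree -> eq3 (shift e f) Z0 -> d (phi e i) (phi f i) = 1.
    by move=> /tree_adj h /eq3P s0; have := h i; rewrite /= s0 add3_0.
  have rootE j : phi 1%positive j = psi j by rewrite root.
  have [y [z [w [oy oz ow [xy yz] [zw wu]]]]] := hol i.
  rewrite -!rootE in xy wu.
  have yE : y = phi 35%positive i.
    by apply: step_unique (fibre_over 1%positive i _) oy (fibre_over _ _ _) xy _ => //; apply: tadj.
  have zE : z = phi 14%positive i.
    apply: step_unique oy oz (fibre_over _ _ _) yz _ => //; rewrite yE; exact: tadj.
  (* Here the orientation of the root fibre enters: with the opposite one the label would be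
     [add3 i Z2]. *)
  have -> : add3 i (shift 14 108) = add3 i Z1 by congr add3; vm_compute.
  have <- : w = phi 108%positive (add3 i Z1).
    apply: step_unique (fibre_over 1%positive (add3 i Z1) _) ow (fibre_over _ _ _) _ _ => //.
      by rewrite distC.
    have := tree_adj (1, 108)%positive isT (add3 i Z1).
    by rewrite (_ : shift _ _ = Z0) ?add3_0.
  by rewrite -zE.
have okN l k : sound k -> sound (foldl infer_step k l).
  by elim: l k => //= n l IH k sk; apply: IH; exact: sound_infer_step.
have := all_in_dep all_deduced bt (linked_nbrs bc).
by case/(okN deductions _ ok1).
Qed.

(** * Comparison with the dual of T(8, 2) *)

Lemma pmap_mem (S : Type) (T : eqType) (f : S -> option T) s t :
  t \in pmap f s -> exists u : S, f u = Some t.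
Proof.
elim: s => //= u s IH; case E: (f u) => [t1|] //=.
by rewrite inE => /orP[/eqP -> | //]; exists u.
Qed.

Lemma indices_spec (i : index) : (i \in indices) =
  match i with Rat p => p < 63 | Irr b _ => b \in types end.
Proof.
apply/idP/idP => [|h].
  have : all (fun i : index => match i with Rat p => p < 63 | Irr b _ => b \in types end) indices.
    by vm_compute.
  by move/allP => h /h.
apply: in_types_indices; case: i h => //= b _ bt.
have /allP h : all (fun b => in_types (Irr b Z0)) types by vm_compute.
exact: (h b bt).
Qed.

Section Coordinates.
Variable phi : positive -> Z3 -> point N.
Hypothesis phi_fibre : forall b, b \in types -> fibre b (phi b).
Hypothesis phi_adjoined : forall b c, b \in types -> linked b c -> adjoined phi b c.

Definition at_index (i : index) : point N :=
  match i with Rat p => hp p | Irr b i => phi b i end.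

Let dom (i : index) : Prop := i \in indices.
Let block t : Prop := exists s, lookup s = Some t.

Lemma at_over b i : b \in types -> over b (phi b i).
Proof. by case/phi_fibre. Qed.

Lemma at_index_inj : {in indices &, injective at_index}.
Proof.
move=> [p|b i] [q|c j]; rewrite !indices_spec /=.
- move=> p63 q63 E; have [e0 _ _ _ _] := hdistP p63 q63; congr Rat; apply/eqP.
  by rewrite -e0 -hp_dist // E distxx.
- by move=> p63 ct E; case: (over_outside (at_over j ct) p63).
- by move=> bt q63 E; case: (over_outside (at_over i bt) q63).
- move=> bt ct E; have bc : b = c by apply: over_fun (at_over i bt) _; rewrite E; exact: at_over.
  rewrite -bc in E *; have [_ inj _] := phi_fibre bt.
  by rewrite (inj _ _ E).
Qed.

Lemma at_index_onto x : exists2 i, i \in indices & x = at_index i.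
Proof.
have [/over_ex[b bx] | [p p63 ->]] := outside_or x; last by exists (Rat p); rewrite ?indices_spec.
have [bt _] := bx; have [_ _ onto] := phi_fibre bt; have [i ->] := onto x bx.
by exists (Irr b i); rewrite ?indices_spec.
Qed.

Lemma block_line3 t : block t -> line3 (at_index t.1.1) (at_index t.1.2) (at_index t.2).
Proof.
case=> s /[dup] /lookupP[_ _ _ it] /lookup_blocks/(all_In blocks_ok) bk.
have {}bk : block_ok t := bk.
have [d1 _] := it _ (Or31 _ _ erefl); have [d2 _] := it _ (Or32 _ _ erefl).
move: d1 d2 bk; case: t {it} => [[[p|b i] [q|c j]] [r|e k]]; rewrite !indices_spec; try by [].
- move=> _ _ bk; have [th npqr] : has (fun t => on2 p t && on2 q t && on2 r t) hlines /\
      [&& ~~ eqn p q, ~~ eqn p r & ~~ eqn q r] by apply/andP: bk.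
  have [t tH /andP[/andP[/on2P pt /on2P qt] /on2P rt]] := hasP th.
  have [/eqnP pq /eqnP pr /eqnP qr] := and3P npqr.
  exact: hline3 tH pt qt rt pq pr qr.
- move=> p63 ct bk.
  have {}bk : [&& eqn p (foot c), Pos.eqb e (mate c) & eq3 k (add3 j (shift c e))] := bk.
  have [/eqnP pE /Pos.eqb_eq eE /eq3P kE] := and3P bk.
  have [_ _ _ _ [_ [v lk]]] := types_specP ct.
  have ce : linked c (mate c) by rewrite /linked lk.
  have h := phi_adjoined ct ce j; rewrite pE eE kE eE.
  have [et _ _ _] := links_specP ct ce.
  exact: line3R (line3R (mate_line (at_over _ ct) (at_over _ et) h)).
- move=> bt ct bk.
  have {}bk : [&& (if link b c is Some (_, Some d') then Pos.eqb e d' else false),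
      eq3 j (add3 i (shift b c)) & eq3 k (add3 i (shift b e))] := bk.
  move: bk => /and3P[+ /eq3P jE /eq3P kE].
  case lk: link => [[v [e'|]]|] // /Pos.eqb_eq eE; rewrite -eE in lk.
  have [_ et be] := third_type bt lk; have bc : linked b c by rewrite /linked lk.
  have h := phi_adjoined bt bc i; rewrite -jE in h.
  have [z ez hz] := linked_line (at_over _ bt) (at_over _ ct) h lk.
  rewrite /=; have <- // : z = phi e k.
  apply: step_unique (at_over i bt) ez (at_over _ et) (line3_dist _ (line3S hz)) _.
  by rewrite kE; exact: phi_adjoined.
Qed.

Lemma on_line t l i : block t -> (forall x, inc x l <->
    [\/ x = at_index t.1.1, x = at_index t.1.2 | x = at_index t.2]) ->
  i \in indices -> inc (at_index i) l <-> on i t.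
Proof.
move=> [s /lookupP[_ _ _ it]] lE di; rewrite lE.
have [d1 _] := it _ (Or31 _ _ erefl); have [d2 _] := it _ (Or32 _ _ erefl).
have [d3 _] := it _ (Or33 _ _ erefl).
split=> -[E|E|E].
- by apply: Or31; apply: at_index_inj.
- by apply: Or32; apply: at_index_inj.
- by apply: Or33; apply: at_index_inj.
- by apply: Or31; rewrite E.
- by apply: Or32; rewrite E.
- by apply: Or33; rewrite E.
Qed.

Lemma line_of_block t l i j : block t -> i \in indices -> j \in indices -> i <> j ->
  on i t -> on j t -> inc (at_index i) l -> inc (at_index j) l ->
  forall k, k \in indices -> inc (at_index k) l <-> on k t.
Proof.
move=> bt di dj ij it jt il jl k dk; have [_ _ _ [m mE]] := block_line3 bt.
have <- : m = l; last exact: on_line.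
have im := (on_line bt mE di).2 it; have jm := (on_line bt mE dj).2 jt.
apply: (line_unique hN) im jm il jl => E; apply: ij; exact: at_index_inj.
Qed.

(** A line has two outer points or lies in H: a single outer point is excluded by the fullness of
    the lines of H, and two points of H force the third into H. Two points are enough to identify
    the line with a block. *)
Lemma line_index l : exists i j t, [/\ block t, i \in indices, j \in indices, i <> j &
  [/\ on i t, on j t, inc (at_index i) l & inc (at_index j) l]].
Proof.
have outer x y : outside x -> outside y -> x <> y -> inc x l -> inc y l ->
    exists i j t, [/\ block t, i \in indices, j \in indices, i <> j &
      [/\ on i t, on j t, inc (at_index i) l & inc (at_index j) l]].
  move=> /over_ex[b bx] /over_ex[c cy] xy xl yl.
  have d1 : d x y = 1 by apply/dist1P; split=> //; exists l.
  have bc := adjacent_linked bx cy d1; have [bt _] := bx; have [ct _] := cy.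
  have [_ _ onto] := phi_fibre bt; have [i xi] := onto x bx.
  have yE : y = phi c (add3 i (shift b c)).
    by apply: step_unique bx cy (at_over _ ct) d1 _; rewrite xi; exact: phi_adjoined.
  have /allP/(_ b bt)/allP/(_ i (mem_elts3 i))/allP/(_ c (linked_nbrs bc)) := blocks_complete.
  case/hasP=> t /pmap_mem[s st] /andP[/on_bP it /on_bP jt].
  exists (Irr b i), (Irr c (add3 i (shift b c))), t; split; rewrite ?indices_spec //.
  - by exists s.
  - by move=> E; apply: xy; rewrite xi yE; exact: (f_equal at_index E).
  - by split=> //=; [rewrite -xi | rewrite -yE].
have [x [y [z [h lE]]]] := line_points h3 l.
have [xl yl zl] : [/\ inc x l, inc y l & inc z l] by split; apply/lE; constructor.
have [xy xz yz _] := h.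
have [ox | [p p63 xp]] := outside_or x.
  have [oy | [q q63 yq]] := outside_or y; first exact: outer ox oy xy xl yl.
  have [oz | [r r63 zr]] := outside_or z; first exact: outer ox oz xz xl zl.
  have oz : outside z by rewrite yq in h; exact: outside_line ox q63 h.
  exact: outer ox oz xz xl zl.
have [oy | [q q63 yq]] := outside_or y.
  have oz : outside z by rewrite xp in h; exact: outside_line oy p63 (line3C h).
  exact: outer oy oz yz yl zl.
have pq : d (hp p) (hp q) = 1 by rewrite -xp -yq; exact: line3_dist h.
rewrite hp_dist // in pq; have [_ e1 _ _ _] := hdistP p63 q63.
move: e1; rewrite pq eqxx => /esym/andP[npq /hasP[t th /andP[/on2P pt /on2P qt]]].
have := allP blocks_complete_rational t th; case: t {th} pt qt => -[p' q'] r' pt qt.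
case/hasP=> t /pmap_mem[s st] /and3P[/on_bP pt' /on_bP qt' /on_bP rt'].
have on_t k : on k (p', q', r') -> on (Rat k) t by case=> /= ->.
exists (Rat p), (Rat q), t; split; rewrite ?indices_spec //; first by exists s.
  by case=> E; rewrite E eqxx in npq.
by split; rewrite /= -?xp -?yq //; exact: on_t.
Qed.

Lemma extension_models : models dom block (fun i x => x = at_index i).
Proof.
split=> [i _ | x | i j x di dj -> | i x y _ -> -> // | t bt | l].
- by exists (at_index i).
- exact: at_index_onto.
- exact: at_index_inj.
- have [_ _ _ [l lE]] := block_line3 bt; exists l => i x di ->; exact: on_line.
- have [i [j [t [bt di dj ij [it jt il jl]]]]] := line_index l.
  exists t => // k x dk ->; exact: line_of_block bt di dj ij it jt il jl k dk.
Qed.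
End Coordinates.

(** * The axioms of a generalized hexagon *)

Lemma common_neighbour x y z z' : d x y = 2 -> d x z = 1 -> d z y = 1 ->
  d x z' = 1 -> d z' y = 1 -> z = z'.
Proof.
(* For p in H and y1 outside, a common neighbour is the foot of y1 or an outer point with foot p.
   [links_spec] forbids both kinds together and allows only one type of the second kind. *)
have mixed p y1 z1 z1' b : p < 63 -> over b y1 -> d (hp p) y1 = 2 ->
    d (hp p) z1 = 1 -> d z1 y1 = 1 -> d (hp p) z1' = 1 -> d z1' y1 = 1 -> z1 = z1'.
  move=> p63 by1 py pz zy pz' zy'; have [bt _] := by1.
  have inner u : d (hp p) u = 1 -> d u y1 = 1 ->
      (u = hp (foot b) /\ hdist p (foot b) = 1) \/ exists c, [/\ over c u, linked b c & foot c = p].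
    move=> pu uy; have [ou | [q q63 uq]] := outside_or u.
      have [c cu] := over_ex ou; right; exists c; split=> //.
        by apply: adjacent_linked by1 cu _; rewrite distC.
      by symmetry; apply: over_foot cu p63 _; rewrite distC.
    left; rewrite uq in pu uy *; rewrite distC in uy.
    have qE := over_foot by1 q63 uy; rewrite -qE; split=> //.
    by rewrite -hp_dist.
  have np : p <> foot b by move=> pE; rewrite pE distC (dist_foot by1) in py.
  have case2 c : linked b c -> foot c = p -> hdist p (foot b) <> 1 /\
      forall c', linked b c' -> foot c' = p -> c' = c.
    move=> bc fc; have [ct _ _] := links_specP bt bc.
    have [f63 _ _ [_ fm _] _] := types_specP bt.
    case lk: link => [[v [e|]]|]; last by rewrite /linked lk in bc.
      case=> _ [h1 _] uq _ _; rewrite -{1}fc; split=> [h | c' bc' fc'].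
        apply: h1; rewrite -hp_dist // ?fc // distC hp_dist ?fc //.
        by rewrite fc in h.
      by apply: uq; rewrite ?fc.
    by move=> cE; case: np; rewrite -fc cE fm.
  case: (inner _ pz zy) (inner _ pz' zy') => [[-> h] | [c [cz bc fc]]] [[-> h'] | [c' [cz' bc' fc']]] //.
  - by case: (case2 _ bc' fc').
  - by case: (case2 _ bc fc).
  - have [_ uq] := case2 _ bc fc; rewrite (uq _ bc' fc') in cz'.
    by apply: step_unique by1 cz cz' _ _; rewrite distC.
move=> xy xz zy xz' zy'.
have [ox | [p p63 xp]] := outside_or x; last first.
  rewrite {}xp in xy xz xz'.
  have [/over_ex[b by1] | [q q63 yq]] := outside_or y; first exact: mixed p63 by1 xy xz zy xz' zy'.
  rewrite {}yq in xy zy zy'.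
  have pq : p <> q by move=> E; rewrite E distxx in xy.
  have inner u : d (hp p) u = 1 -> d u (hp q) = 1 -> exists2 r, r < 63 & u = hp r.
    move=> pu uq; have [/over_ex[c cu] | //] := outside_or u; case: pq.
    rewrite (over_foot cu q63 uq); apply: over_foot cu p63 _; by rewrite distC.
  have [r r63 zr] := inner _ xz zy; have [s s63 zs] := inner _ xz' zy'.
  rewrite zr zs !hp_dist // in xy xz zy xz' zy' *; have [_ _ _ _ u] := hdistP p63 q63.
  by congr hp; exact: u.
have [/over_ex[e ey] | [q q63 yq]] := outside_or y; last first.
  rewrite {}yq in xy zy zy'; have [b bx] := over_ex ox.
  by apply: mixed q63 bx _ _ _ _ _; rewrite distC.
have [b bx] := over_ex ox; have [bt _] := bx.
have nxy : x <> y by move=> E; rewrite E distxx in xy.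
(* A common neighbour in H makes the feet equal. With an outer common neighbour as well,
   [quadrangles_spec] leaves only e = b, and unique lifting then gives x = y. *)
have inner u r c w : r < 63 -> u = hp r -> d x u = 1 -> d u y = 1 -> over c w -> d x w = 1 -> d w y = 1 -> False.
  move=> r63 uE xu uy cw xw wy; rewrite uE in xu uy; rewrite distC in uy.
  have fbe : foot e = foot b by rewrite -(over_foot bx r63 xu) -(over_foot ey r63 uy).
  have bc := adjacent_linked bx cw xw; have ce := adjacent_linked cw ey wy.
  have /allP/(_ e (linked_nbrs ce)) := all_in_dep quadrangles_spec bt (linked_nbrs bc).
  case: (Pos.eqb_spec e b) => [eb _ | _ /andP[]]; last by rewrite fbe eqnE eqxx.
  rewrite eb in ey; apply: nxy; apply: step_unique cw bx ey _ wy; by rewrite distC.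
have [/over_ex[c cz] | [r r63 zr]] := outside_or z; have [/over_ex[c' cz'] | [s s63 zs]] := outside_or z'.
- exact: no_quadrangle bx ey cz cz' xz xz' zy zy' nxy.
- by case: (inner _ _ _ _ s63 zs xz' zy' cz xz zy).
- by case: (inner _ _ _ _ r63 zr xz zy cz' xz' zy').
- by rewrite zr zs in xz xz' *; rewrite (over_foot bx r63 xz) (over_foot bx s63 xz').
Qed.

Lemma two_lines x : exists l m, [/\ l <> m, inc x l & inc x m].
Proof.
have two y z : d x y = 1 -> d x z = 1 -> d y z <> 1 -> y <> z -> exists l m, [/\ l <> m, inc x l & inc x m].
  move=> /dist1P[_ [l [xl yl]]] /dist1P[_ [m [xm zm]]] yz nyz; exists l, m; split=> // lm.
  by apply: yz; apply/dist1P; split=> //; exists l; split=> //; rewrite lm.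
have [ox | [p p63 xp]] := outside_or x.
  have [b bx] := over_ex ox; have [bt _] := bx; have [f63 _ _ _ _] := types_specP bt.
  have ex : all (fun b => has (fun c => linked b c && ~~ Pos.eqb c (mate b)) (nbrs b)) types.
    by vm_compute.
  have [c _ /andP[bc cm]] := hasP (allP ex b bt).
  have [y cy xy] := step bx bc.
  apply: (two _ _ (dist_foot bx) xy).
    (* If y were collinear with the foot of x, it would be the third point of that line, hence over
       [mate b], contrary to the choice of c. *)
    rewrite distC => yf; have [z mz h] := outside_third bx.
    have hy := no_triangle xy yf (dist_foot bx).
    case/negP: cm; apply/Pos.eqb_eq; apply: over_fun cy _.
    by rewrite (line3_fun hN (line3S hy) (line3S h)).
  by move=> E; apply: (over_outside cy f63 (esym E)).
have ex : all (fun p => has (fun q => has (fun r =>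
    [&& p < 63, q < 63, r < 63, eqn (hdist p q) 1, eqn (hdist p r) 1 & eqn (hdist q r) 2])
  (iota 0 63)) (iota 0 63)) (iota 0 63) by vm_compute.
have [q _ hr] := hasP (allP ex p (in_iota63 p63)).
have [r _ /and5P[_ q63 r63 /eqnP pq /andP[/eqnP pr /eqnP qr]]] := hasP hr.
have qr2 : d (hp q) (hp r) = 2 by rewrite (hp_dist q63 r63) qr.
apply: (two (hp q) (hp r)).
- by rewrite xp (hp_dist p63 q63) pq.
- by rewrite xp (hp_dist p63 r63) pr.
- by rewrite qr2.
- by move=> E; rewrite E distxx in qr2.
Qed.
End Extension.

(** * The given subgeometry in coordinates *)

Lemma models_along (I : Type) (dom : I -> Prop) block (G G' : geometry)
    (f : point G -> point G') (g : line G -> line G') (r : I -> point G' -> Prop) :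
  bijective f -> bijective g -> (forall x l, inc x l <-> inc (f x) (g l)) ->
  models dom block r -> models dom block (fun i x => r i (f x)).
Proof.
move=> [f' fK f'K] [g' gK g'K] inc_fg m.
split=> /= [i di | x | i j x | i x y di ix iy | t bt | l].
- by have [y iy] := rep_ex m di; exists (f' y); rewrite f'K.
- exact: rep_onto m (f x).
- exact: (@rep_inj _ _ _ _ _ m i j (f x)).
- by apply: (can_inj fK); exact: (rep_fun m di ix iy).
- have [l' lE] := block_line m bt; exists (g' l') => i x di ix.
  by rewrite inc_fg g'K; exact: lE.
- have [t bt lE] := line_block m (g l); exists t => // i x di ix.
  by rewrite inc_fg; exact: lE.
Qed.

Lemma in_hlines t : t \in hlines <-> exists s, List.In (s, t) blocks2.
Proof.
have -> : hlines = map snd blocks2 by vm_compute.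
elim: blocks2 => [|[s' t'] l IH]; first by split=> // -[].
rewrite inE; split=> [/orP[/eqP -> | /IH[s st]] | [s [[_ ->] | st]]].
- by exists s'; left.
- by exists s; right.
- by rewrite eqxx.
- by rewrite (introT orP) //; right; apply/IH; exists s.
Qed.

Section Subhexagon.
Variables (G : geometry) (r : nat -> point G -> Prop).
Hypothesis m : models (fun p => p < 63) (fun t => exists s, List.In (s, t) blocks2) r.
Variable h : nat -> point G.
Hypothesis hP : forall p, p < 63 -> r p (h p).

Lemma sub_onto x : exists2 p, p < 63 & x = h p.
Proof.
by have [p p63 px] := rep_onto m x; exists p => //; exact: (rep_fun m p63 px (hP p63)).
Qed.

Lemma sub_inj p q : p < 63 -> q < 63 -> h p = h q -> p = q.
Proof.
move=> p63 q63 E; have rq := hP q63; rewrite -E in rq.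
exact: (rep_inj m p63 q63 (hP p63) rq).
Qed.

Lemma sub_line_block t : t \in hlines ->
  exists l, forall p, p < 63 -> inc (h p) l <-> on p t.
Proof.
move=> /in_hlines/(block_line m)[l lE]; exists l => p p63.
exact: lE p63 (hP p63).
Qed.

Lemma sub_collinear p q : p < 63 -> q < 63 -> collinear (h p) (h q) <-> hdist p q = 1.
Proof.
move=> p63 q63; have [_ e1 _ _ _] := hdistP p63 q63; split=> [[pq [l [pl ql]]] | E].
  apply/eqP; rewrite e1; apply/andP; split; first by apply/eqP => E; apply: pq; rewrite E.
  have [t /in_hlines th tE] := line_block m l; apply/hasP; exists t => //.
  by apply/andP; split; apply/on2P; [apply/(tE p _ p63 (hP p63)) | apply/(tE q _ q63 (hP q63))].
move: e1; rewrite E eqxx => /esym/andP[/eqP npq /hasP[t th /andP[/on2P pt /on2P qt]]].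
split; first by move/(sub_inj p63 q63).
by have [l lE] := sub_line_block th; exists l; split; apply/lE.
Qed.

(** The table provides a next step that decreases [hdist], which gives a walk of that length, and
    [hdist] drops by at most 1 along any edge, which bounds all walks from below. *)
Lemma sub_distance p q : p < 63 -> q < 63 -> distance (h p) (h q) (hdist p q).
Proof.
move=> p63 q63; split.
  move E: (hdist p q) => n; elim: n p p63 E => [|n IH] p p63 E.
    by have [e0 _ _ _ _] := hdistP p63 q63; move: e0; rewrite E eqxx => /esym/eqP ->.
  have [_ _ e3 _ _] := hdistP p63 q63; have [s s63 [ps sq]] := e3 n E.
  by exists (h s); [exact/sub_collinear | exact: IH].
move=> n; elim: n p p63 => [|n IH] p p63 /=.
  move/(sub_inj p63 q63) => ->.
  by have [e0 _ _ _ _] := hdistP q63 q63; move: e0; rewrite eqxx => /eqP ->.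
case=> z; have [s s63 ->] := sub_onto z; move=> /(sub_collinear p63 s63) ps /(IH s s63) le.
by have [_ _ _ e4 _] := hdistP p63 s63; exact: leq_trans (e4 ps q q63) _.
Qed.
End Subhexagon.

Theorem theorem3p13 (N : geometry) (hN : near_hexagon N)
    (h3 : three_points_per_line N) (H : subgeometry N)
    (H_full : full_subgeometry H) (H_proper : proper_subgeometry H)
    (H_iso : isomorphic (geometry_of H) HD2)
    (H_isom : isometrically_embedded H) :
  generalized_hexagon N /\ isomorphic N T28.
Proof.
have [r0 m0] := HD2_models; have [f [g [bf bg inc_fg]]] := H_iso.
pose r p (x : point (geometry_of H)) := r0 p (f x).
have m : models (fun p => p < 63) (fun t => exists s, List.In (s, t) blocks2) r :=
  models_along bf bg inc_fg m0.
have [x0 _] := rep_ex m (isT : 0 < 63).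
have hex p : exists x, p < 63 -> r p x.
  have [p63 | p63] := boolP (p < 63); last by exists x0.
  by have [x px] := rep_ex m p63; exists x.
pose h p := proj1_sig (constructive_indefinite_description _ (hex p)).
have hP p : p < 63 -> r p (h p) := proj2_sig (constructive_indefinite_description _ (hex p)).
pose hp p := proj1_sig (h p).
have hp_dist p q : p < 63 -> q < 63 -> dist hN (hp p) (hp q) = hdist p q.
  by move=> p63 q63; apply/distE/H_isom; exact: (sub_distance m hP p63 q63).
have hp_inj p q : p < 63 -> q < 63 -> p <> q -> hp p <> hp q.
  move=> p63 q63 pq E; have [e0 _ _ _ _] := hdistP p63 q63.
  by apply: pq; apply/eqP; rewrite -e0 -hp_dist // E distxx.
have hp_line t : t \in hlines -> line3 (hp t.1.1) (hp t.1.2) (hp t.2).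
  move=> th; have [a63 b63 c63 ab [ac bc]] := hline_spec th.
  split; [exact: hp_inj | exact: hp_inj | exact: hp_inj |].
  have [l lE] := sub_line_block m hP th; exists (proj1_sig l) => x; split=> [xl | ].
    (* Fullness is needed here: a line of H acquires no further points in N. *)
    have [p p63 E] := sub_onto m hP (exist _ x (H_full _ _ (proj2_sig l) xl)).
    have /(lE p p63) pt : inc (h p) l by rewrite -E.
    have -> : x = hp p by rewrite /hp -E.
    by case: pt => ->; constructor.
  by case=> ->; [apply/(lE _ a63) | apply/(lE _ b63) | apply/(lE _ c63)]; constructor.
(* If H contained all points, two points of any line of N would be at distance 1 in H as well, hence
   on a line of H, which is that line; then H would not be proper. *)
have outside_ex : exists x, outside hp x.
  have [// | none] := excluded_middle_informative (exists x, outside hp x).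
  have all_hp x : exists2 p, p < 63 & x = hp p.
    by have [ox | //] := outside_or hp x; case: none; exists x.
  case: H_proper; split=> [x | l].
    by have [p _ ->] := all_hp x; exact: proj2_sig (h p).
  have [x [y [z [[xy _ _ _] lE]]]] := line_points h3 l.
  have [p p63 xp] := all_hp x; have [q q63 yq] := all_hp y.
  have [xl yl] : inc x l /\ inc y l by split; apply/lE; constructor.
  have : hdist p q = 1.
    by rewrite -hp_dist // -xp -yq; apply/dist1P; split=> //; exists l.
  move/(sub_collinear m hP p63 q63) => [_ [l' [pl ql]]].
  have -> : l = proj1_sig l'; last exact: proj2_sig l'.
  by apply: (line_unique hN) xy xl yl _ _; rewrite ?xp ?yq.
have [T28_ext [s sm]] := T28_models.
have [phi [phi_fibre phi_adjoined]] := labelling h3 hp_dist hp_line outside_ex.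
split; last first.
  exact: models_isomorphic (near_extensional hN) T28_ext
    (extension_models h3 hp_dist hp_line phi_fibre phi_adjoined) sm.
split=> // [x | x y xy]; first exact: (two_lines h3 hp_dist hp_line x).
have xy2 : dist hN x y = 2 by exact: distE.
have [z xz zy] := dist_step xy2; exists z; split; first by split; apply/dist1P.
move=> z' [/(dist1P hN) xz' /(dist1P hN) zy'].
exact: (common_neighbour h3 hp_dist hp_line outside_ex xy2 xz zy xz' zy').
Qed.
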